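(* Let $f(t)=1-H(t)$ on $[0,1]$ and $f^{(2)}=f\circ f$. Let $\mu^1_+$ be a fixed point of $f^{(2)}$ and let $\mu^1_-=f(\mu^1_+)$. Let $\varsigma_+$ be the law of the corresponding conditional probability solution $C^+$ (with mean $\mu^1_+$) of the iterated RDE, let $B(\varsigma_+)$ be its basin of attraction under $\mathcal T^2$, and let $b^2(\mu^1_+)$ be the basin of attraction of $\mu^1_+$ under the map $f^{(2)}$. Then the following dichotomy holds: (i) if $H'(\mu^1_+)H'(\mu^1_-)>1$, then $B(\varsigma_+)=\{\pi\in\mathcal P:\ \pi\text{ has mean }\mu^1_+\text{ and }\pi\text{ is not concentrated on }\{0,1\}\}$; (ii) if $H'(\mu^1_+)H'(\mu^1_-)\le1$, then $B(\varsigma_+)=\{\pi\in\mathcal P:\ \pi\text{ has mean }m\in b^2(\mu^1_+)\}$.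
   Context: $N$ is a random variable with values in $\{1,2,\dots\}\cup\{\infty\}$, and $H(s)=\mathbb E[s^N]$ for $s\in[0,1]$, with conventions $s^\infty=0$ for $0\le s<1$ and $1^\infty=1$; in particular $H(0)=0$. $H'$ is the derivative of $H$ (one-sided at an endpoint of $[0,1]$). Standing assumption: $H$ is strictly convex, so that $\mathbb P(2\le N<\infty)>0$. $\mathcal P$ is the set of probability measures on $[0,1]$. The map $\mathcal T:\mathcal P\to\mathcal P$ sends $\nu$ to the law of $1-\prod_{i=1}^N X_i$, where $X_1,X_2,\dots$ are i.i.d. with law $\nu$ and independent of $N$ (an infinite product is the limit of its partial products). $B(\varsigma_+)=\{\pi\in\mathcal P:(\mathcal T^2)^n(\pi)\to\varsigma_+\text{ weakly as }n\to\infty\}$ and $b^2(\mu^1_+)=\{m\in[0,1]:(f^{(2)})^n(m)\to\mu^1_+\text{ as }n\to\infty\}$, where exponents $n$ denote $n$-fold composition. $\mathbf T=\bigcup_{n\ge0}\mathbb N^n$ is the tree of finite sequences of positive integers, $\emptyset$ its root, $|u|$ the length of $u$, and $u1,u2,\dots$ the daughters of $u$; $(N_u;u\in\mathbf T)$ are i.i.d. copies of $N$. The iterated RDE is $X=1-\prod_{i=1}^{N_\emptyset}\big(1-\prod_{j=1}^{N_i}X_{ij}\big)$. A tree-indexed solution of it is a family $(X_u;|u|\text{ even})$ of $[0,1]$-valued random variables, all with the same law, such that for every $n$ the $(X_u;|u|=2n)$ are mutually independent and independent of $(N_v;|v|\le 2n-1)$, and $X_u=1-\prod_{i=1}^{N_u}\big(1-\prod_{j=1}^{N_{ui}}X_{uij}\big)$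 for every $u$ with $|u|$ even. Let $S^+$ be the tree-indexed solution with values in $\{0,1\}$ and $\mathbb P(S^+_u=1)=\mu^1_+$. The conditional probability solution is $C^+_u=\mathbb P(S^+_u=1\mid N_v;v\in\mathbf T)$; $\varsigma_+$ is the law of $C^+_\emptyset$.
   Formalization: Part (i) is stated only for 0 < μ¹₊ < 1: at the fixed points μ¹₊ = 0 or 1 it is false, since ς₊ is then a point mass lying in its own basin while no law of mean 0 or 1 fails to be concentrated on {0,1}. *)

(* Defs.v *)
From HB Require Import structures.
From mathcomp Require Import all_boot all_order all_algebra.
From mathcomp Require Import all_classical all_reals all_analysis.

Set Implicit Arguments.
Unset Strict Implicit.
Unset Printing Implicit Defensive.

Import Order.TTheory GRing.Theory Num.Theory.
Import numFieldNormedType.Exports.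

Local Open Scope classical_set_scope.
Local Open Scope ring_scope.

(* [None] stands for infinity. *)
Definition enat : Type := option nat.

HB.instance Definition _ := Pointed.copy enat (option nat).
HB.instance Definition _ := @isMeasurable.Build default_measure_display
  enat discrete_measurable discrete_measurable0
  discrete_measurableC discrete_measurableU.

Definition epow (R : realType) (s : R) (n : enat) : R :=
  if n is Some k then s ^+ k else (s == 1)%:R.

(* The product of the first [n] terms of [x]; for n = oo, the limit of the
   partial products, which exists when all terms are in [0, 1]. *)
Definition eprod (R : realType) (n : enat) (x : nat -> R) : R :=
  if n is Some k then \prod_(i < k) x i
  else limn (fun k => \prod_(i < k) x i).

Section Independence.
Context d d' (Om : measurableType d) (U : measurableType d') (R : realType).
Variable P : probability Om R.

Definition sigma_of (I : Type) (J : set I) (X : I -> Om -> U) : set (set Om) :=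
  <<s \bigcup_(i in J) preimage_set_system setT (X i) measurable >>.

Definition indep_systems (F G : set (set Om)) : Prop :=
  forall A B, F A -> G B -> (P (A `&` B) = P A * P B)%E.

Definition mutually_indep (I : eqType) (J : set I) (X : I -> Om -> U) : Prop :=
  forall (s : seq I) (A : I -> set U), uniq s -> [set` s] `<=` J ->
    (forall i, measurable (A i)) ->
    (P (\bigcap_(i in [set` s]) X i @^-1` A i)
     = \prod_(i <- s) P (X i @^-1` A i))%E.

Definition is_cond_prob (G : set (set Om)) (E : set Om) (Y : Om -> R) : Prop :=
  [/\ forall B : set R, measurable B -> G (Y @^-1` B),
      P.-integrable setT (EFin \o Y)
    & forall A, G A -> (\int[P]_(w in A) (Y w)%:E = P (A `&` E))%E].

End Independence.

Definition same_law d1 d2 d' (S1 : measurableType d1) (S2 : measurableType d2)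
    (U : measurableType d') (R : realType)
    (P1 : probability S1 R) (P2 : probability S2 R)
    (X1 : S1 -> U) (X2 : S2 -> U) : Prop :=
  forall A, measurable A -> P1 (X1 @^-1` A) = P2 (X2 @^-1` A).

Section GeneratingFunction.
Context d (S : measurableType d) (R : realType) (P : probability S R).
Variable N : {RV P >-> enat}.

Definition pgf (s : R) : R := fine ('E_P[fun w => epow s (N w)])%E.

Definition pgf_compl (t : R) : R := 1 - pgf t.

End GeneratingFunction.

Definition strictly_convex01 (R : realType) (h : R -> R) : Prop :=
  forall x y t : R, 0 <= x <= 1 -> 0 <= y <= 1 -> x != y -> 0 < t < 1 ->
    h (t * x + (1 - t) * y) < t * h x + (1 - t) * h y.

(* Derivative of a function on [0, 1]: two-sided in the interior, one-sided at
   the endpoints. It is extended-real valued because the slope of a generating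
   function at 1 may be +oo. *)
Definition slope01 (R : realType) (h : R -> R) (x : R) : \bar R :=
  lim (((h y - h x) / (y - x))%:E @[y --> within `[0, 1]%classic (x^')]).

Section Measures01.
Context (R : realType).

(* Probability measures on [0, 1] are the Borel probability measures [nu] on
   the line with [on01 nu]. *)
Notation law := (probability R R).

Definition on01 (nu : law) : Prop := nu `[0, 1]%classic = 1%E.

Definition has_mean (nu : law) (m : R) : Prop := (\int[nu]_x x%:E = m%:E)%E.

Definition on_zero_one (nu : law) : Prop := nu [set 0; 1] = 1%E.

Definition weakly_cvg (nu_ : nat -> law) (nu : law) : Prop :=
  forall g : R -> R, continuous g -> (exists M : R, forall x, `|g x| <= M) ->
    (\int[nu_ n]_x (g x)%:E @[n --> \oo] --> \int[nu]_x (g x)%:E)%E.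

Context d (S : measurableType d) (P : probability S R) (N : {RV P >-> enat}).

(* [nu'] is the law of 1 - prod_(i <= N) X_i for X_1, X_2, ... i.i.d. with law
   [nu] and independent of (a copy of) [N]. *)
Definition is_image (nu nu' : law) : Prop :=
  exists (d' : measure_display) (Om : measurableType d')
    (Q : probability Om R) (M : {RV Q >-> enat}) (X : nat -> {RV Q >-> R}),
    same_law Q P M N /\
    (forall i w, 0 <= X i w <= 1) /\
    (forall i A, measurable A -> Q (X i @^-1` A) = nu A) /\
    mutually_indep Q setT (fun i => X i : Om -> R) /\
    indep_systems Q (sigma_of [set: unit] (fun=> M : Om -> enat))
                    (sigma_of setT (fun i => X i : Om -> R)) /\
    (forall A, measurable A ->
       nu' A = Q ((fun w => 1 - eprod (M w) (fun i => X i w)) @^-1` A)).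

(* The law picked by [xget] is unique on Borel sets; it exists when [on01 nu],
   the default value [nu] being reached only outside of that case. *)
Definition mapT (nu : law) : law := xget nu [set nu' | is_image nu nu'].

Definition basinT2 (sigma : law) : set law :=
  [set nu | on01 nu /\ weakly_cvg (fun n => iter n (mapT \o mapT) nu) sigma].

End Measures01.

Definition basin01 (R : realType) (h : R -> R) (mu : R) : set R :=
  [set m | 0 <= m <= 1 /\ iter n h m @[n --> \oo] --> mu].

(* Vertices of the tree are sequences of naturals; the daughters of [u] are
   [rcons u i], numbered from 0, so that the first [n] are those with i < n. *)
Section Tree.
Context d0 (S : measurableType d0) d (Om : measurableType d) (R : realType).
Variables (P0 : probability S R) (N : {RV P0 >-> enat}) (P : probability Om R).

Definition iid_copies (Nu : seq nat -> {RV P >-> enat}) : Prop :=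
  (forall u, same_law P P0 (Nu u) N) /\
  mutually_indep P setT (fun u => Nu u : Om -> enat).

(* A tree-indexed solution is a family indexed by the vertices of even depth:
   the values of [X] at odd depths are irrelevant. *)
Definition tree_solution (Nu : seq nat -> {RV P >-> enat})
    (X : seq nat -> {RV P >-> R}) : Prop :=
  (forall u w, ~~ odd (size u) -> 0 <= X u w <= 1) /\
  (forall u v, ~~ odd (size u) -> ~~ odd (size v) ->
     same_law P P (X u : Om -> R) (X v)) /\
  (forall n,
     mutually_indep P [set u | size u = n.*2] (fun u => X u : Om -> R) /\
     indep_systems P
       (sigma_of [set u | size u = n.*2] (fun u => X u : Om -> R))
       (sigma_of [set v | (size v < n.*2)%N] (fun v => Nu v : Om -> enat))) /\
  (forall u, ~~ odd (size u) ->
     {ae P, forall w, X u w =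
       1 - eprod (Nu u w) (fun i =>
             1 - eprod (Nu (rcons u i) w) (fun j =>
                   X (rcons (rcons u i) j) w))}).

Definition zero_one_solution (Nu : seq nat -> {RV P >-> enat})
    (X : seq nat -> {RV P >-> R}) (mu : R) : Prop :=
  [/\ tree_solution Nu X,
      forall u w, ~~ odd (size u) -> X u w = 0 \/ X u w = 1
    & forall u, ~~ odd (size u) -> P (X u @^-1` [set 1]) = mu%:E].

Definition cond_prob_solution (Nu : seq nat -> {RV P >-> enat})
    (X C : seq nat -> {RV P >-> R}) : Prop :=
  forall u, ~~ odd (size u) ->
    is_cond_prob P (sigma_of setT (fun v => Nu v : Om -> enat))
      (X u @^-1` [set 1]) (C u).

End Tree.

(* Main.v *)
(* Write H for the generating function of N, a = mu_plus, b = mu_minus = 1 - H(a).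
   If (X, Y) is a coupling of two laws on [0, 1], then using the same N and i.i.d.
   copies of (X, Y) couples their images under T, and
     E[X'] = 1 - H(E X),   E[X' Y'] = 1 - H(E X) - H(E Y) + H(E[X Y]).
   Hence E[(X_n - Y_n)^2] is governed by scalar recursions; we couple the iterates
   of pi with those of the point mass at a.  The latter satisfy T^{2n}(delta_a) =
   law of E[S_root | N_v, |v| < 2n], which converges in L^1 to C_root because the
   sigma-algebras of the first generations are dense in that of the whole tree.
   So pi is in the basin as soon as E[(X_{2n} - Y_{2n})^2] tends to 0.
   When the means are a and b alternately, the deficits a - E[X_{2n}^2] are iterates
   of a strictly concave map vanishing at 0 with slope H'(a)H'(b) there.
   If this slope is > 1, the deficits of pi (not concentrated on {0, 1}) and of
   delta_a are squeezed together, their ratio increasing to 1, while the limit is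
   positive; laws on {0, 1} keep deficit 0, and the fixed point a of the mean repels.
   If it is <= 1, all the second moments tend to a as soon as the means do, so the
   mean decides; the same holds trivially when a is 0 or 1. *)

(* The laws [mapT N nu] are selected by [xget] and known only through [is_image], each on a sample
   space of its own, so iterates cannot be coupled as they stand. Everything is therefore simulated
   on one space, the line with the uniform law [lam]: splitting binary digits yields a copy of N and
   infinitely many independent uniform variables, and T becomes the map [recfun] on functions. The
   three incarnations of an iterate (selected law, function on the line, expectation [cval] on the
   tree) are identified through their moments: these evolve under the same map [mommap], and they
   determine integrals of continuous functions by Bernstein approximation. One feature of H shapes
   the analysis: it may jump or have infinite slope at 1. Derivative bounds are therefore uniform on
   [0, q] with q < 1 only, limits are kept strictly inside the interval, and a in {0, 1} gets an
   argument free of slopes. *)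
Require Import Defs.
From HB Require Import structures.
From mathcomp Require Import all_boot all_order all_algebra.
From mathcomp Require Import all_classical all_reals all_analysis.
From mathcomp Require Import measurable_realfun.
From mathcomp Require Import ring lra.

Set Implicit Arguments.
Unset Strict Implicit.
Unset Printing Implicit Defensive.

Import Order.TTheory GRing.Theory Num.Theory.
Import numFieldNormedType.Exports.

Local Open Scope classical_set_scope.
Local Open Scope ring_scope.

(** * Expectations of bounded functions *)

Section Expectation.
Context d (T : measurableType d) (R : realType).
Implicit Types f g : T -> R.

(** Bounded measurable functions are integrable for every probability and closed under ring
    operations, so integrability never has to be tracked. No measure occurs here, so that the
    predicate can also be read over a smaller sigma-algebra, as is done later with [belowT]. *)
Definition bmf f : Prop :=
  measurable_fun setT f /\ exists M : R, forall w, `|f w| <= M.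

Definition u01 f : Prop :=
  measurable_fun setT f /\ forall w, 0 <= f w <= 1.

Lemma u01_bmf f : u01 f -> bmf f.
Proof.
by move=> [mf f01]; split=> //; exists 1 => w; have /andP[? ?] := f01 w; rewrite ger0_norm.
Qed.

Lemma bmf_cst (c : R) : bmf (fun=> c).
Proof. by split; [exact: measurable_cst | exists `|c|]. Qed.

Lemma bmfD f g : bmf f -> bmf g -> bmf (fun w => f w + g w).
Proof.
move=> [mf [M fM]] [mg [K gK]]; split; first exact: measurable_funD.
by exists (M + K) => w; rewrite (le_trans (ler_normD _ _))// lerD.
Qed.

Lemma bmfM f g : bmf f -> bmf g -> bmf (fun w => f w * g w).
Proof.
move=> [mf [M fM]] [mg [K gK]]; split; first exact: measurable_funM.
by exists (M * K) => w; rewrite normrM ler_pM.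
Qed.

Lemma bmfN f : bmf f -> bmf (fun w => - f w).
Proof.
move=> [mf [M fM]]; split; first exact: measurable_funN.
by exists M => w; rewrite normrN.
Qed.

Lemma bmfB f g : bmf f -> bmf g -> bmf (fun w => f w - g w).
Proof. by move=> ? ?; apply: bmfD => //; exact: bmfN. Qed.

Lemma bmfX f n : bmf f -> bmf (fun w => f w ^+ n).
Proof.
move=> bf; elim: n => [|n IH].
  by under eq_fun do rewrite expr0; exact: bmf_cst.
by under eq_fun do rewrite exprS; exact: bmfM.
Qed.

Lemma bmf_norm f : bmf f -> bmf (fun w => `|f w|).
Proof.
move=> [mf [M fM]]; split; last by exists M => w; rewrite normr_id.
by apply: measurableT_comp.
Qed.

Lemma bmf_indic (A : set T) : measurable A -> bmf (fun w => \1_A w).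
Proof.
move=> mA; split; first exact: measurable_indic.
by exists 1 => w; rewrite indicE; case: (_ \in _); rewrite ?normr1 ?normr0.
Qed.

Lemma bmf_sum (I : Type) (s : seq I) (Q : pred I) (F : I -> T -> R) :
  (forall i, bmf (F i)) -> bmf (fun w => \sum_(i <- s | Q i) F i w).
Proof.
move=> bF; elim: s => [|i s IH].
  by under eq_fun do rewrite big_nil; exact: bmf_cst.
under eq_fun do rewrite big_cons.
by case: (Q i) => //; exact: bmfD.
Qed.

Lemma bmf_prod (I : Type) (s : seq I) (Q : pred I) (F : I -> T -> R) :
  (forall i, bmf (F i)) -> bmf (fun w => \prod_(i <- s | Q i) F i w).
Proof.
move=> bF; elim: s => [|i s IH].
  by under eq_fun do rewrite big_nil; exact: bmf_cst.
under eq_fun do rewrite big_cons.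
by case: (Q i) => //; exact: bmfM.
Qed.

Lemma u01_cst (c : R) : 0 <= c <= 1 -> u01 (fun=> c).
Proof. by move=> c01; split=> //; exact: measurable_cst. Qed.

Lemma u01M f g : u01 f -> u01 g -> u01 (fun w => f w * g w).
Proof.
move=> [mf f01] [mg g01]; split; first exact: measurable_funM.
move=> w; have /andP[? ?] := f01 w; have /andP[? ?] := g01 w.
by rewrite mulr_ge0//= mulr_ile1.
Qed.

Lemma u01X f n : u01 f -> u01 (fun w => f w ^+ n).
Proof.
move=> uf; elim: n => [|n IH].
  by under eq_fun do rewrite expr0; apply: u01_cst; rewrite ler01 lexx.
by under eq_fun do rewrite exprS; exact: u01M.
Qed.

Lemma u01_onem f : u01 f -> u01 (fun w => 1 - f w).
Proof.
move=> [mf f01]; split; first by apply: measurable_funB.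
by move=> w; have := f01 w; lra.
Qed.

Variable P : probability T R.

Definition Ex f : R := fine (\int[P]_w (f w)%:E).

Lemma bmf_integrable f : bmf f -> P.-integrable setT (EFin \o f).
Proof.
move=> [mf [M fM]]; apply: (@le_integrable _ _ _ _ _ _ _ (cst M%:E)) => //.
- exact/measurable_EFinP.
- by move=> w _ /=; rewrite lee_fin (le_trans (fM w))// ler_norm.
- exact: finite_measure_integrable_cst.
Qed.

Lemma ExE f : bmf f -> (\int[P]_w (f w)%:E = (Ex f)%:E)%E.
Proof. by move=> bf; rewrite /Ex fineK// integrable_fin_num//; exact: bmf_integrable. Qed.

Lemma eq_Ex f g : (forall w, f w = g w) -> Ex f = Ex g.
Proof. by move=> fg; rewrite /Ex; congr fine; apply: eq_integral => w _; rewrite fg. Qed.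

Lemma Ex_cst (c : R) : Ex (fun=> c) = c.
Proof. by rewrite /Ex integral_cst//= probability_setT mule1. Qed.

Lemma ExD f g : bmf f -> bmf g -> Ex (fun w => f w + g w) = Ex f + Ex g.
Proof.
move=> bf bg; apply: EFin_inj; rewrite EFinD -!ExE//; last exact: bmfD.
under eq_integral do rewrite EFinD.
by rewrite integralD//; exact: bmf_integrable.
Qed.

Lemma ExZ (c : R) f : bmf f -> Ex (fun w => c * f w) = c * Ex f.
Proof.
move=> bf; apply: EFin_inj; rewrite EFinM -!ExE//; last by apply: bmfM => //; exact: bmf_cst.
under eq_integral do rewrite EFinM.
by rewrite integralZl//; exact: bmf_integrable.
Qed.

Lemma ExB f g : bmf f -> bmf g -> Ex (fun w => f w - g w) = Ex f - Ex g.
Proof.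
move=> bf bg; rewrite ExD//; last exact: bmfN.
by congr (_ + _); under eq_Ex do rewrite -mulN1r; rewrite ExZ// mulN1r.
Qed.

Lemma Ex_sum (I : Type) (s : seq I) (F : I -> T -> R) :
  (forall i, bmf (F i)) ->
  Ex (fun w => \sum_(i <- s) F i w) = \sum_(i <- s) Ex (F i).
Proof.
move=> bF; elim: s => [|i s IH].
  by under eq_Ex do rewrite big_nil; rewrite big_nil Ex_cst.
under eq_Ex do rewrite big_cons.
by rewrite big_cons ExD ?IH//; exact: bmf_sum.
Qed.

Lemma le_Ex f g : bmf f -> bmf g -> (forall w, f w <= g w) -> Ex f <= Ex g.
Proof.
move=> bf bg fg; rewrite -lee_fin -!ExE//.
apply: le_integral => //; try exact: bmf_integrable.
by move=> w _; rewrite lee_fin.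
Qed.

Lemma Ex_ge0 f : bmf f -> (forall w, 0 <= f w) -> 0 <= Ex f.
Proof. by move=> bf f0; rewrite -(Ex_cst 0) le_Ex//; exact: bmf_cst. Qed.

Lemma Ex_le_cst f c : bmf f -> (forall w, f w <= c) -> Ex f <= c.
Proof. by move=> bf f0; rewrite -[leRHS](Ex_cst c) le_Ex//; exact: bmf_cst. Qed.

Lemma Ex01 f : u01 f -> 0 <= Ex f <= 1.
Proof.
move=> uf; have bf := u01_bmf uf; apply/andP; split.
  by apply: Ex_ge0 => // w; have /andP[] := uf.2 w.
by apply: Ex_le_cst => // w; have /andP[] := uf.2 w.
Qed.

Lemma ler_norm_Ex f : bmf f -> `|Ex f| <= Ex (fun w => `|f w|).
Proof.
move=> bf; have bn := bmf_norm bf; rewrite ler_norml; apply/andP; split.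
  rewrite lerNl -mulN1r -ExZ//; apply: le_Ex => //.
    by apply: bmfM => //; exact: bmf_cst.
  by move=> w; rewrite mulN1r -normrN ler_norm.
by apply: le_Ex => // w; exact: ler_norm.
Qed.

Lemma Ex_indic (A : set T) : measurable A -> (Ex (fun w => \1_A w))%:E = P A.
Proof.
move=> mA; rewrite -ExE; last exact: bmf_indic.
by rewrite integral_indic// setIT.
Qed.

Lemma Ex_ae f g : bmf f -> bmf g -> {ae P, forall w, f w = g w} -> Ex f = Ex g.
Proof.
move=> bf bg fg; rewrite /Ex; congr fine; apply: ae_eq_integral => //.
- by apply/measurable_EFinP; exact: bf.1.
- by apply/measurable_EFinP; exact: bg.1.
- by apply: filterS fg => w /= -> _.
Qed.

Lemma Ex_cvg (F : nat -> T -> R) f (M : R) :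
  (forall n, measurable_fun setT (F n)) -> (forall n w, `|F n w| <= M) ->
  (forall w, F n w @[n --> \oo] --> f w) ->
  bmf f /\ Ex (F n) @[n --> \oo] --> Ex f.
Proof.
move=> mF FM Ff.
have mf : measurable_fun setT f.
  by apply: (measurable_fun_cvg (h := F)) => // w _; exact: Ff.
have bf : bmf f.
  split=> //; exists M => w.
  apply/ler_addgt0Pr => e e0.
  have [n _ Hn] : \forall n \near \oo, `|f w - F n w| < e.
    by move/cvgrPdist_lt : (Ff w) => /(_ _ e0).
  have := Hn n (leqnn n) => /= Hn'.
  rewrite (_ : f w = F n w + (f w - F n w)); last by rewrite addrC subrK.
  by rewrite (le_trans (ler_normD _ _))// lerD// ltW.
have bF n : bmf (F n) by split=> //; exists M.
split=> //.
have fcv : (\int[P]_w (F n w)%:E)%E @[n --> \oo] --> (\int[P]_w (f w)%:E)%E.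
  have [] // := @dominated_convergence _ _ _ P setT measurableT
    (fun n w => (F n w)%:E) (fun w => (f w)%:E) (cst M%:E).
  - by move=> n; apply/measurable_EFinP; exact: mF.
  - exact/measurable_EFinP.
  - by apply: aeW => w _; apply: cvg_EFin; [exact: nearW | exact: Ff].
  - exact: finite_measure_integrable_cst.
  - by apply: aeW => w n _ /=; rewrite lee_fin.
move: fcv; rewrite ExE//.
under eq_fun do rewrite ExE//.
by move/fine_cvgP => [].
Qed.

End Expectation.
Arguments bmf_cst {d T R} c.

(** * Products of random length *)

Section StepApproximation.
Context d (T : measurableType d) (R : realType).

Definition level (g : T -> R) (k i : nat) : set T :=
  [set w | i.+1%:R / k%:R <= g w].

Lemma measurable_level g k i : measurable_fun setT g -> measurable (level g k i).
Proof.
move=> mg; have := mg measurableT _ (measurable_itv `[i.+1%:R / k%:R, +oo[).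
by rewrite setTI (_ : _ @^-1` _ = level g k i)//; apply/seteqP; split=> w /=;
  rewrite in_itv/= andbT.
Qed.

(** For [g] in [0, 1] this is the integer part of [k * g] divided by [k]; the form with level sets
    makes its expectation a combination of probabilities of events. *)
Definition step (g : T -> R) (k : nat) (w : T) : R :=
  k%:R^-1 * \sum_(i < k) \1_(level g k i) w.

Lemma step_dist g k w : (0 < k)%N -> 0 <= g w <= 1 ->
  `|g w - step g k w| <= k%:R^-1.
Proof.
move=> k0 /andP[g0 g1].
have k0R : (0 : R) < k%:R by rewrite ltr0n.
set t := g w * k%:R.
have t0 : 0 <= t by rewrite mulr_ge0// ltW.
have tk : t <= k%:R by rewrite /t ler_piMl// ltW.
pose j := Num.truncn t.
have /andP[jt tj] : j%:R <= t < j.+1%:R by exact: truncn_itv.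
have jk : (j <= k)%N by rewrite -(ler_nat R) (le_trans jt).
have -> : step g k w = k%:R^-1 * j%:R.
  rewrite /step; congr (_ * _).
  transitivity (\sum_(i < k) ((i < j)%N%:R : R)).
    apply: eq_bigr => i _; rewrite indicE; congr (_%:R); congr nat_of_bool.
    apply/idP/idP; rewrite inE /level /= ler_pdivrMr// -/t.
      by move=> h; have := le_lt_trans h tj; rewrite ltr_nat ltnS.
    by move=> h; apply: le_trans jt; rewrite ler_nat.
  rewrite -natr_sum; congr (_%:R).
  rewrite -(big_mkord xpredT (fun i => (i < j)%N : nat)) (big_cat_nat (n:=j))//=.
  rewrite [X in (_ + X)%N]big1_seq ?addn0; last first.
    by move=> i /andP[_]; rewrite mem_index_iota => /andP[ji _]; rewrite ltnNge ji.
  rewrite (eq_big_nat _ _ (F2 := fun=> 1%N)) ?sum_nat_const_nat ?subn0 ?muln1//.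
  by move=> i /andP[_ ->].
have -> : g w = k%:R^-1 * t by rewrite /t mulrCA mulVf ?mulr1// gt_eqF.
rewrite -mulrBr normrM ger0_norm ?invr_ge0 ?ler0n// ler_piMr ?invr_ge0 ?ler0n//.
rewrite ger0_norm ?subr_ge0//.
by rewrite lerBlDr -natr1 addrC in tj *; lra.
Qed.

Lemma bmf_step g k : measurable_fun setT g -> bmf (step g k).
Proof.
move=> mg; apply: bmfM; first exact: bmf_cst.
by apply: bmf_sum => i; apply: bmf_indic; exact: measurable_level.
Qed.

End StepApproximation.

Section TransferFun.
Context d (T : measurableType d) (R : realType) (P : probability T R).

Lemma Ex_step_dist (Z : T -> R) d' (U : measurableType d') (X : T -> U)
    (g : U -> R) (M : R) k : measurable_fun setT Z -> (forall w, `|Z w| <= M) ->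
  measurable_fun setT X -> u01 g -> (0 < k)%N ->
  `|Ex P (fun w => Z w * g (X w)) -
    k%:R^-1 * \sum_(i < k) Ex P (fun w => Z w * \1_(level g k i) (X w))|
  <= M * k%:R^-1.
Proof.
move=> mZ ZM mX [mg g01] k0.
have bZ : bmf Z by split=> //; exists M.
have bl i : bmf (fun w => \1_(level g k i) (X w) : R).
  split; first by apply: measurableT_comp => //; exact/measurable_indic/measurable_level.
  by exists 1 => w; rewrite indicE; case: (_ \in _); rewrite ?normr1 ?normr0.
have bg : bmf (fun w => g (X w)).
  by apply: u01_bmf; split; [exact: measurableT_comp | move=> w; exact: g01].
rewrite -Ex_sum; last by move=> i; exact: bmfM.
rewrite -ExZ; last by apply: bmf_sum => i; exact: bmfM.
rewrite -ExB; first last.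
- by apply: bmfM; [exact: bmf_cst | apply: bmf_sum => i; exact: bmfM].
- exact: bmfM.
have bd : bmf (fun w => Z w * g (X w) -
    k%:R^-1 * (\sum_(i < k) Z w * \1_(level g k i) (X w))).
  apply: bmfB; first exact: bmfM.
  by apply: bmfM; [exact: bmf_cst | apply: bmf_sum => i; exact: bmfM].
apply: (le_trans (ler_norm_Ex P bd)); apply: Ex_le_cst; first exact: bmf_norm.
move=> w; rewrite -mulr_sumr mulrCA -mulrBr normrM ler_pM//.
exact: step_dist.
Qed.

End TransferFun.

(** The level-set approximations of [g] have equal expectations on both sides by hypothesis, and
    cost an error of at most [(M1 + M2) / k]. The weights [Z1] and [Z2] carry the other factors of a
    product while one factor is upgraded from an indicator to [g]. *)
Lemma Ex_transfer_fun (R : realType) d1 (T1 : measurableType d1)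
    (P1 : probability T1 R) d2 (T2 : measurableType d2) (P2 : probability T2 R)
    d' (U : measurableType d') (Z1 : T1 -> R) (Z2 : T2 -> R)
    (X1 : T1 -> U) (X2 : T2 -> U) (g : U -> R) :
  bmf Z1 -> bmf Z2 -> measurable_fun setT X1 -> measurable_fun setT X2 -> u01 g ->
  (forall A, measurable A ->
    Ex P1 (fun w => Z1 w * \1_A (X1 w)) = Ex P2 (fun w => Z2 w * \1_A (X2 w))) ->
  Ex P1 (fun w => Z1 w * g (X1 w)) = Ex P2 (fun w => Z2 w * g (X2 w)).
Proof.
move=> [mZ1 [M1 ZM1]] [mZ2 [M2 ZM2]] mX1 mX2 ug H.
have H1 k := Ex_step_dist (k := k) P1 mZ1 ZM1 mX1 ug.
have H2 k := Ex_step_dist (k := k) P2 mZ2 ZM2 mX2 ug.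
apply/eqP; rewrite -subr_eq0 -normr_le0; apply/ler_addgt0Pr => e e0; rewrite add0r.
pose k := (Num.truncn ((M1 + M2) / e)).+1.
have k0 : (0 < k)%N by [].
have kR : (0 : R) < k%:R by rewrite ltr0n.
have := H1 _ k0; have := H2 _ k0.
under eq_bigr => i _ do rewrite -(H _ (measurable_level k i ug.1)).
move: (_ * \sum_(i < k) _) => c h2 h1.
have : (M1 + M2) / k%:R <= e.
  rewrite ler_pdivrMr// -ler_pdivrMl// mulrC ltW//.
  by rewrite truncnS_gt.
rewrite mulrDl; apply: le_trans.
rewrite (_ : _ - _ = (Ex P1 (fun w => Z1 w * g (X1 w)) - c) -
  (Ex P2 (fun w => Z2 w * g (X2 w)) - c)); last by ring.
by rewrite (le_trans (ler_normB _ _))// lerD.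
Qed.

Section InfiniteProducts.
Context (R : realType).

(** Truncating the length at [K] presents finite and infinite products alike as limits of finite
    ones. *)
Definition emin (n : enat) (K : nat) : nat := if n is Some k then minn k K else K.

Lemma prod_ge0_le1 (x : nat -> R) K : (forall i, 0 <= x i <= 1) ->
  0 <= \prod_(i < K) x i <= 1.
Proof.
move=> x01; apply/andP; split.
  by apply: prodr_ge0 => i _; have /andP[] := x01 i.
by apply: prodr_ile1 => i _.
Qed.

Arguments prod_ge0_le1 {x} K _.

Lemma cvg_eprod (n : enat) (x : nat -> R) : (forall i, 0 <= x i <= 1) ->
  \prod_(i < emin n K) x i @[K --> \oo] --> eprod n x.
Proof.
move=> x01; case: n => [k|] /=.
  apply: cvg_near_cst; near=> K.
  by rewrite (minn_idPl _)//; near: K; exact: nbhs_infty_ge.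
apply: nonincreasing_is_cvgn; last first.
  by exists 0 => _ [K _ <-]; have /andP[] := prod_ge0_le1 K x01.
apply/nonincreasing_seqP => K; rewrite big_ord_recr/= ler_piMr//.
  by have /andP[] := prod_ge0_le1 K x01.
by have /andP[] := x01 K.
Unshelve. all: by end_near.
Qed.

Arguments cvg_eprod n {x} _.

Lemma eprod01 (n : enat) (x : nat -> R) : (forall i, 0 <= x i <= 1) ->
  0 <= eprod n x <= 1.
Proof.
move=> x01; have cx := cvg_eprod n x01.
have h K := prod_ge0_le1 (emin n K) x01.
apply/andP; split.
  by apply: (cvgr_to_ge cx); apply: nearW => K; have /andP[] := h K.
by apply: (cvgr_to_le cx); apply: nearW => K; have /andP[] := h K.
Qed.

Lemma eprodM (n : enat) (x y : nat -> R) :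
  (forall i, 0 <= x i <= 1) -> (forall i, 0 <= y i <= 1) ->
  eprod n (fun i => x i * y i) = eprod n x * eprod n y.
Proof.
move=> x01 y01.
have xy01 i : 0 <= x i * y i <= 1.
  by have /andP[? ?] := x01 i; have /andP[? ?] := y01 i; rewrite mulr_ge0//= mulr_ile1.
have := cvg_eprod n xy01; under eq_cvg do rewrite big_split/=.
move/cvg_unique => /(_ (@norm_hausdorff _ _)); apply.
by apply: cvgM; exact: cvg_eprod.
Qed.

Lemma eprodX (n : enat) (x : nat -> R) k : (forall i, 0 <= x i <= 1) ->
  eprod n (fun i => x i ^+ k) = eprod n x ^+ k.
Proof.
move=> x01.
have x01X i : 0 <= x i ^+ k <= 1.
  by have /andP[? ?] := x01 i; rewrite exprn_ge0//= exprn_ile1.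
have cX j : (\prod_(i < emin n K) x i) ^+ j @[K --> \oo] --> eprod n x ^+ j.
  elim: j => [|j IH]; first exact: cvg_cst.
  by rewrite exprS; under eq_cvg do rewrite exprS; apply: cvgM => //; exact: cvg_eprod.
have := cvg_eprod n x01X; under eq_cvg do rewrite prodrXl.
move/cvg_unique => /(_ (@norm_hausdorff _ _)); apply.
exact: cX.
Qed.

Lemma eprod_cst (n : enat) (m : R) : 0 <= m <= 1 -> eprod n (fun=> m) = epow m n.
Proof.
move=> /andP[m0 m1]; case: n => [k|] /=; first by rewrite prodr_const card_ord.
under eq_fun do rewrite prodr_const card_ord.
apply/cvg_lim => //; have [->|m_neq1] := eqVneq m 1.
  by under eq_cvg do rewrite expr1n; exact: cvg_cst.
by apply: cvg_expr; rewrite ger0_norm// lt_neqAle m_neq1.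
Qed.

Definition etail (K : nat) : set enat := ~` [set n | exists2 k, (k < K)%N & n = Some k].

(** The lengths split into [Some k] with [k < K] and all others, [None] included. A product of
    random length thus becomes a finite combination of events on the length times products of fixed
    length, which independence can evaluate. *)
Lemma prod_emin (n : enat) (x : nat -> R) K : \prod_(i < emin n K) x i =
  \sum_(k < K) \1_[set Some (k : nat)] n * \prod_(i < k) x i +
  \1_(etail K) n * \prod_(i < K) x i.
Proof.
have [[k kK ->]|nK] := pselect (exists2 k, (k < K)%N & n = Some k).
  rewrite /= (minn_idPl (ltnW kK)) [X in _ = _ + X * _]indicE memNset ?mul0r ?addr0; last first.
    by move=> H; apply: H; exists k.
  rewrite (bigD1 (Ordinal kK))//= indicE mem_set// mul1r [X in _ = _ + X]big1 ?addr0// => i ik.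
  rewrite indicE memNset ?mul0r// => -[] ki; move/eqP: ik; apply.
  by apply: val_inj.
rewrite [X in _ = X + _]big1 ?add0r; last first.
  move=> i _; rewrite indicE memNset ?mul0r// => ni; apply: nK; exists i => //.
rewrite indicE mem_set// mul1r; case: n nK => [k|//] nK /=.
rewrite (minn_idPr _)// leqNgt; apply/negP => kK; apply: nK; by exists k.
Qed.

Lemma u01_eprod d (T : measurableType d) (M : T -> enat) (x : nat -> T -> R) :
  measurable_fun setT M -> (forall i, u01 (x i)) ->
  u01 (fun w => eprod (M w) (fun i => x i w)).
Proof.
move=> mM ux; split; last first.
  by move=> w; apply: eprod01 => i; have := (ux i).2 w.
apply: (measurable_fun_cvg (h := fun K w => \prod_(i < emin (M w) K) x i w)); last first.
  by move=> w _; apply: cvg_eprod => i; have := (ux i).2 w.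
move=> K; rewrite (funext (fun w => prod_emin (M w) (x^~ w) K)).
have bM (B : set enat) : bmf (fun w => \1_B (M w) : R).
  split; first by apply: measurableT_comp => //; exact: measurable_indic.
  by exists 1 => w; rewrite indicE; case: (_ \in _); rewrite ?normr1 ?normr0.
have bp k : bmf (fun w => \prod_(i < k) x i w).
  by apply: bmf_prod => i; exact/u01_bmf.
suff [] : bmf (fun w => \sum_(k < K) \1_[set Some (k : nat)] (M w) * \prod_(i < k) x i w +
  \1_(etail K) (M w) * \prod_(i < K) x i w : R) by [].
by apply: bmfD; [apply: bmf_sum => k|]; exact: bmfM.
Qed.

Section Transfer.
Context d (T : measurableType d) (P : probability T R).

Lemma bmf_indic_comp d' (U : measurableType d') (X : T -> U) (A : set U) :
  measurable_fun setT X -> measurable A -> bmf (fun w => \1_A (X w) : R).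
Proof.
move=> mX mA; split; first by apply: measurableT_comp => //; exact: measurable_indic.
by exists 1 => w; rewrite indicE; case: (_ \in _); rewrite ?normr1 ?normr0.
Qed.

Lemma Ex_cvg_eprod (Z : T -> R) (M : T -> enat) (x : nat -> T -> R) :
  bmf Z -> measurable_fun setT M -> (forall i, u01 (x i)) ->
  (\sum_(k < K) Ex P (fun w => Z w * (\1_[set Some (k : nat)] (M w) * \prod_(i < k) x i w)) +
   Ex P (fun w => Z w * (\1_(etail K) (M w) * \prod_(i < K) x i w))) @[K --> \oo]
  --> Ex P (fun w => Z w * eprod (M w) (fun i => x i w)).
Proof.
move=> [mZ [C ZC]] mM ux.
have bZ : bmf Z by split=> //; exists C.
have bM (B : set enat) : bmf (fun w => \1_B (M w) : R) by exact: bmf_indic_comp.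
have bp k : bmf (fun w => \prod_(i < k) x i w).
  by apply: bmf_prod => i; exact/u01_bmf.
have E K : \sum_(k < K) Ex P (fun w => Z w * (\1_[set Some (k : nat)] (M w) * \prod_(i < k) x i w)) +
   Ex P (fun w => Z w * (\1_(etail K) (M w) * \prod_(i < K) x i w)) =
   Ex P (fun w => Z w * \prod_(i < emin (M w) K) x i w).
  rewrite -Ex_sum; last by move=> k; apply: bmfM => //; exact: bmfM.
  rewrite -ExD; first last.
  - by apply: bmfM => //; exact: bmfM.
  - by apply: bmf_sum => k; apply: bmfM => //; exact: bmfM.
  by apply: eq_Ex => w; rewrite (prod_emin (M w) (x^~ w) K) mulrDr mulr_sumr.
under eq_cvg do rewrite E.
apply: (Ex_cvg P (M := C) _ _ _).2.
- move=> K.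
  suff [] : bmf (fun w => Z w * \prod_(i < emin (M w) K) x i w) by [].
  apply: bmfM => //. rewrite (funext (fun w => prod_emin (M w) (x^~ w) K)).
  by apply: bmfD; [apply: bmf_sum => k|]; exact: bmfM.
- move=> K w; rewrite normrM -[leRHS]mulr1 ler_pM//.
  have /andP[? ?] := prod_ge0_le1 (emin (M w) K) (fun i => (ux i).2 w).
  by rewrite ger0_norm.
- move=> w; apply: cvgMr; apply: cvg_eprod => i; exact: (ux i).2.
Qed.

End Transfer.

(** Both sides are limits of the finite combinations of [prod_emin], which involve only an event on
    the length times a product of fixed length. The two spaces may be different or the same; both
    uses occur. *)
Lemma Ex_transfer_eprod d1 (T1 : measurableType d1)
    (P1 : probability T1 R) d2 (T2 : measurableType d2) (P2 : probability T2 R)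
    (Z1 : T1 -> R) (Z2 : T2 -> R) (M1 : T1 -> enat) (M2 : T2 -> enat)
    (x1 : nat -> T1 -> R) (x2 : nat -> T2 -> R) :
  bmf Z1 -> bmf Z2 -> measurable_fun setT M1 -> measurable_fun setT M2 ->
  (forall i, u01 (x1 i)) -> (forall i, u01 (x2 i)) ->
  (forall B k, Ex P1 (fun w => Z1 w * (\1_B (M1 w) * \prod_(i < k) x1 i w)) =
    Ex P2 (fun w => Z2 w * (\1_B (M2 w) * \prod_(i < k) x2 i w))) ->
  Ex P1 (fun w => Z1 w * eprod (M1 w) (fun i => x1 i w)) =
  Ex P2 (fun w => Z2 w * eprod (M2 w) (fun i => x2 i w)).
Proof.
move=> bZ1 bZ2 mM1 mM2 ux1 ux2 H.
have := Ex_cvg_eprod (P := P1) bZ1 mM1 ux1; have := Ex_cvg_eprod (P := P2) bZ2 mM2 ux2.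
under [X in X -> _]eq_cvg => K do [under eq_bigr do rewrite -H; rewrite -H].
by move=> c2 c1; exact: (cvg_unique _ c1 c2).
Qed.

End InfiniteProducts.

Section Pgf.
Context d0 (S0 : measurableType d0) (R : realType) (P0 : probability S0 R).
Variable N : {RV P0 >-> enat}.

Lemma mRVN : measurable_fun setT N. Proof. exact: measurable_funPT. Qed.

Lemma u01_epow (s : R) : 0 <= s <= 1 -> u01 (fun w => epow s (N w)).
Proof.
move=> s01; under eq_fun do rewrite -eprod_cst//.
by apply: u01_eprod; [exact: mRVN | move=> i; exact: u01_cst].
Qed.

Lemma pgfE (s : R) : pgf N s = Ex P0 (fun w => epow s (N w)).
Proof. by rewrite /pgf unlock. Qed.

(** The comparison space is that of [N], with all factors equal to the constant [m]: there the
    product is [epow m (N w)], whose mean is H(m). *)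
Lemma Ex_eprod d (T : measurableType d) (P : probability T R)
    (Z : T -> R) (M : T -> enat) (x : nat -> T -> R) (z m : R) :
  bmf Z -> measurable_fun setT M -> (forall i, u01 (x i)) -> 0 <= m <= 1 ->
  (forall B k, Ex P (fun w => Z w * (\1_B (M w) * \prod_(i < k) x i w)) =
    z * (Ex P0 (fun w => \1_B (N w)) * m ^+ k)) ->
  Ex P (fun w => Z w * eprod (M w) (fun i => x i w)) = z * pgf N m.
Proof.
move=> bZ mM ux m01 H.
transitivity (Ex P0 (fun w => z * eprod (N w) (fun=> m))); last first.
  rewrite pgfE -ExZ; last by apply: u01_bmf; exact: u01_epow.
  by apply: eq_Ex => w; rewrite eprod_cst.
apply: (Ex_transfer_eprod (Z2 := fun=> z) (x2 := fun _ _ => m)) => //.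
- exact: bmf_cst.
- move=> B k; have bB : bmf (fun w => \1_B (N w) : R) by exact: bmf_indic_comp.
  rewrite H ExZ; last by apply: bmfM => //; apply: bmf_prod => i; exact: bmf_cst.
  congr (_ * _); rewrite mulrC -ExZ//.
  by apply: eq_Ex => w; rewrite prodr_const card_ord mulrC.
Qed.

End Pgf.

Lemma bigcap_seq_cons (T : Type) (I : eqType) i (s : seq I) (A : I -> set T) :
  \bigcap_(j in [set` i :: s]) A j = A i `&` \bigcap_(j in [set` s]) A j.
Proof.
apply/seteqP; split=> x /=.
  move=> H; split; first by apply: H; rewrite /= mem_head.
  by move=> j js; apply: H => /=; rewrite inE js orbT.
by move=> [Hi H] j /=; rewrite inE => /predU1P[->//|]; exact: H.
Qed.

Lemma prod_indic (R : realType) (T : Type) (I : eqType) (s : seq I) (A : I -> set T) w :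
  \prod_(i <- s) \1_(A i) w = \1_(\bigcap_(i in [set` s]) A i) w :> R.
Proof.
elim: s => [|i s IH].
  by rewrite big_nil indicE mem_set//.
by rewrite big_cons IH bigcap_seq_cons indicI.
Qed.

Lemma measurable_bigcap_seq d (T : measurableType d) (I : eqType) (s : seq I)
    (A : I -> set T) : (forall i, i \in s -> measurable (A i)) ->
  measurable (\bigcap_(i in [set` s]) A i).
Proof.
elim: s => [|i s IH] mA.
  by rewrite (_ : \bigcap_(i in _) A i = setT)//; apply/seteqP; split.
rewrite bigcap_seq_cons; apply: measurableI; first by apply: mA; exact: mem_head.
by apply: IH => j js; apply: mA; rewrite inE js orbT.
Qed.

Lemma Ex_prod_indic (R : realType) d (T : measurableType d) (Q : probability T R)
  (I : eqType) (s : seq I) (A : I -> set T) B : measurable B ->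
  (forall i, measurable (A i)) ->
  (Ex Q (fun w => \1_B w * \prod_(i <- s) \1_(A i) w))%:E =
  Q (B `&` \bigcap_(i in [set` s]) A i).
Proof.
move=> mB mA.
rewrite -Ex_indic; last by apply: measurableI => //; apply: measurable_bigcap_seq => i _.
congr EFin; apply: eq_Ex => w.
by rewrite prod_indic indicI.
Qed.

Section Moments.
Context d0 (S0 : measurableType d0) (R : realType) (P0 : probability S0 R).
Variable N : {RV P0 >-> enat}.

Section Iid.
Context d (T : measurableType d) (Q : probability T R).
Context d' (U : measurableType d') (nu : probability U R).
Variables (M : T -> enat) (X : nat -> T -> U).
Hypothesis mM : measurable_fun setT M.
Hypothesis mX : forall i, measurable_fun setT (X i).
Hypothesis indepMX : forall B l (A : nat -> set U), (forall i, measurable (A i)) ->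
  Ex Q (fun w => \1_B (M w) * \prod_(i < l) \1_(A i) (X i w)) =
  Ex P0 (fun w => \1_B (N w)) * \prod_(i < l) Ex nu (fun x => \1_(A i) x).

(** Induction on [j], converting indicators into [g] one at a time with [Ex_transfer_fun]. The
    trailing indicators are there to supply, at the next index, the arbitrary event which that
    conversion requires. *)
Lemma Ex_prod_iid (g : U -> R) B j l (A : nat -> set U) : u01 g ->
  (forall i, measurable (A i)) ->
  Ex Q (fun w => \1_B (M w) * \prod_(i < j) g (X i w) *
                 \prod_(i < l) \1_(A i) (X (j + i)%N w)) =
  Ex P0 (fun w => \1_B (N w)) * Ex nu g ^+ j * \prod_(i < l) Ex nu (fun x => \1_(A i) x).
Proof.
move=> ug; elim: j l A => [|j IH] l A mA.
  rewrite expr0 mulr1 -indepMX//; apply: eq_Ex => w.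
  by rewrite big_ord0 mulr1.
have bg i : bmf (fun w => g (X i w)).
  apply: u01_bmf; split; first by apply: measurableT_comp => //; exact: ug.1.
  by move=> w; exact: ug.2.
have bA i k B' : measurable B' -> bmf (fun w => \1_B' (X (i + k)%N w) : R).
  by move=> mB'; exact: bmf_indic_comp.
set z := Ex P0 (fun w => \1_B (N w)) * Ex nu g ^+ j * \prod_(i < l) Ex nu (fun x => \1_(A i) x).
transitivity (Ex nu (fun x => z * g x)); last first.
  by rewrite ExZ ?exprSr; [rewrite /z; ring | exact: u01_bmf].
rewrite -(Ex_transfer_fun (P1 := Q) (P2 := nu) (X1 := X j) (X2 := id) (g := g)
  (Z1 := fun w => \1_B (M w) * \prod_(i < j) g (X i w) *
                 \prod_(i < l) \1_(A i) (X (j + i).+1%N w)) (Z2 := fun=> z))//.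
- apply: eq_Ex => w; rewrite big_ord_recr/=.
  by rewrite -!mulrA; congr (_ * (_ * _)); rewrite mulrC.
- apply: bmfM; first apply: bmfM.
  + by apply: bmf_indic_comp.
  + by apply: bmf_prod => i; exact: bg.
  + by apply: bmf_prod => i; under eq_fun do rewrite -addnS; exact: bA.
- exact: bmf_cst.
- move=> A0 mA0.
  (* The tested set is put in front of the trailing ones, which is the induction hypothesis with one
     more indicator. *)
  pose A' i := if i is i'.+1 then A i' else A0.
  have mA' i : measurable (A' i) by case: i.
  have := IH l.+1 A' mA'; rewrite big_ord_recl/= => H.
  transitivity (z * Ex nu (fun x => \1_A0 x)); last by rewrite ExZ//; exact: bmf_indic.
  rewrite /z -mulrA [_ * Ex nu (fun x => \1_A0 x)]mulrC -H; apply: eq_Ex => w.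
  rewrite big_ord_recl/= addn0 -[LHS]mulrA; congr (_ * _); rewrite mulrC; congr (_ * _).
  by apply: eq_bigr => i _; rewrite /bump leq0n/= addnS.
Qed.

Lemma Ex_eprod_iid (g : U -> R) : u01 g ->
  Ex Q (fun w => eprod (M w) (fun i => g (X i w))) = pgf N (Ex nu g).
Proof.
move=> ug; have ugX i : u01 (fun w => g (X i w)).
  split; first by apply: measurableT_comp => //; exact: ug.1.
  by move=> w; exact: ug.2.
have := @Ex_eprod _ _ _ _ N _ _ Q (fun=> 1) M (fun i w => g (X i w)) 1 (Ex nu g)
  (bmf_cst _) mM ugX (Ex01 _ ug).
rewrite mul1r => <-; first by apply: eq_Ex => w; rewrite mul1r.
move=> B k; have := Ex_prod_iid B k 0 ug (fun=> measurableT).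
rewrite !big_ord0 !mulr1 mul1r => <-; apply: eq_Ex => w.
by rewrite big_ord0 mul1r mulr1.
Qed.

End Iid.

Lemma pushforward_Ex d (T : measurableType d) (Q : probability T R)
    d' (U : measurableType d') (nu : probability U R) (X : T -> U) (g : U -> R) :
  measurable_fun setT X -> (forall A, measurable A -> nu A = Q (X @^-1` A)) ->
  u01 g -> Ex nu g = Ex Q (fun w => g (X w)).
Proof.
move=> mX law ug.
have := @Ex_transfer_fun _ _ _ nu _ _ Q _ _ (fun=> 1) (fun=> 1) id X g
  (bmf_cst _) (bmf_cst _) (@measurable_id _ _ _) mX ug.
under eq_Ex do rewrite mul1r; under [in RHS]eq_Ex do rewrite mul1r; apply.
move=> A mA; under eq_Ex do rewrite mul1r; under [in RHS]eq_Ex do rewrite mul1r.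
apply: EFin_inj; rewrite Ex_indic// law// -Ex_indic//.
by rewrite -[X in measurable X]setTI; exact: mX.
Qed.

Section Image.
Variables (nu nu' : probability R R) (d : measure_display) (Om : measurableType d).
Variables (Q : probability Om R) (M : {RV Q >-> enat}) (X : nat -> {RV Q >-> R}).
Hypothesis lawM : same_law Q P0 M N.
Hypothesis lawX : forall i A, measurable A -> Q (X i @^-1` A) = nu A.
Hypothesis indepX : mutually_indep Q setT (fun i => X i : Om -> R).
Hypothesis indepMX : indep_systems Q (sigma_of [set: unit] (fun=> M : Om -> enat))
                    (sigma_of setT (fun i => X i : Om -> R)).

Lemma measurable_RV d1 (U : measurableType d1) (Y : {RV Q >-> U}) A :
  measurable A -> measurable (Y @^-1` A).
Proof. by move=> mA; rewrite -[X in measurable X]setTI; exact: measurable_funPT. Qed.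

Lemma image_indep B l (A : nat -> set R) : (forall i, measurable (A i)) ->
  Ex Q (fun w => \1_B (M w) * \prod_(i < l) \1_(A i) (X i w)) =
  Ex P0 (fun w => \1_B (N w)) * \prod_(i < l) Ex nu (fun x => \1_(A i) x).
Proof.
move=> mA; apply: EFin_inj.
have mB : measurable (M @^-1` B) by exact: measurable_RV.
have mXA i : measurable (X i @^-1` A i) by exact: measurable_RV.
transitivity (Ex Q (fun w => \1_(M @^-1` B) w * \prod_(i <- iota 0 l) \1_(X i @^-1` A i) w))%:E.
  congr EFin; apply: eq_Ex => w; rewrite -(big_mkord xpredT (fun i => \1_(A i) (X i w) : R)).
  by rewrite /index_iota subn0.
rewrite Ex_prod_indic// indepMX; first last.
- apply: (@measurable_bigcap_seq _ (g_sigma_algebraType (\bigcup_(i in setT)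
    preimage_set_system setT (X i : Om -> R) measurable))) => i _.
  by apply: sub_sigma_algebra; exists i => //; exists (A i) => //; rewrite setTI.
- by apply: sub_sigma_algebra; exists tt => //; exists B => //; rewrite setTI.
rewrite (indepX (A := A)) ?iota_uniq// EFinM lawM// -Ex_indic; last first.
  by rewrite -[X in measurable X]setTI; exact: measurable_funPT.
congr (_ * _)%E; rewrite -prodEFin -(big_mkord xpredT (fun i => (Ex nu (fun x => \1_(A i) x))%:E)).
rewrite /index_iota subn0; apply: eq_bigr => i _.
by rewrite lawX// Ex_indic.
Qed.

Lemma image_eprod (g : R -> R) : u01 g ->
  Ex Q (fun w => eprod (M w) (fun i => g (X i w))) = pgf N (Ex nu g).
Proof.
apply: Ex_eprod_iid; [exact: measurable_funPT | by move=> i; exact: measurable_funPT|].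
exact: image_indep.
Qed.

End Image.

End Moments.

(** * The uniform law and its binary digits *)

Section HalfLines.
Context (R : realType) d (T : measurableType d) (P : probability T R).

(** Both sides are finite measures in [A]. They agree on the rays []s, +oo[], obtained as
    complements, and these form an intersection-stable class generating the Borel sets. The event
    [C] makes this serve for independence as well as for laws. *)
Lemma halfline_indep (C : set T) (X : T -> R) (nu : probability R R) :
  measurable C -> measurable_fun setT X ->
  (forall s, P (C `&` X @^-1` `]-oo, s]%classic) = P C * nu `]-oo, s]%classic)%E ->
  forall A, measurable A -> (P (C `&` X @^-1` A) = P C * nu A)%E.
Proof.
move=> mC mX H A mA.
have PC0 : 0 <= fine (P C) by exact: fine_ge0.
have PCE : P C = (fine (P C))%:E by rewrite fineK// fin_num_measure.
pose m1' : {measure set R -> \bar R} := pushforward (mrestr P mC) X.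
pose m1 := m1' mX.
pose m2 : {measure set R -> \bar R} := mscale (NngNum PC0) nu.
suff : m1 A = m2 A by rewrite /m1 /m1' /m2 /= /pushforward /mrestr /mscale /= -PCE setIC.
apply: (@g_sigma_algebra_measure_unique _ R R (@RGenOInfty.G R) _
  (fun k => `]- k%:R, +oo[%classic)).
- by move=> _ [x ->]; exact: measurable_itv.
- by move=> k; exists (- k%:R).
- rewrite -subTset => x _; exists (Num.truncn (`|x|)).+1 => //=.
  rewrite in_itv/= andbT ltrNl (le_lt_trans (ler_norm _))// normrN.
  by rewrite truncnS_gt.
- move=> _ _ [x ->] [y ->]; exists (Num.max x y).
  by apply/seteqP; split => z /=; rewrite !in_itv/= !andbT gt_max; [move=> [-> ->]|move/andP].
- move=> _ [s ->]; rewrite /m1 /m1' /m2 /= /pushforward /mrestr /mscale /= -PCE -setCitvl.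
  have mXs : measurable (X @^-1` `]-oo, s]%classic).
    by rewrite -[X in measurable X]setTI; exact: (mX measurableT).
  rewrite (_ : X @^-1` (~` `]-oo, s]%classic) `&` C = C `\` X @^-1` `]-oo, s]%classic); last first.
    by rewrite setIC setDE.
  rewrite measureD//; last by rewrite -ge0_fin_numE// fin_num_measure.
  rewrite [X in (_ - X)%E](H s) probability_setC// muleBr//.
    by rewrite mule1.
  by rewrite fin_num_measure.
- move=> k; rewrite /m1 /m1' /= /pushforward /mrestr -ge0_fin_numE// fin_num_measure//.
  apply: measurableI => //; rewrite -[X in measurable X]setTI; exact: (mX measurableT).
- have := mA; rewrite /measurable/= /measurableR.
  by rewrite [X in X A -> _](RGenOInfty.measurableE R).
Qed.

Lemma halfline_law (X : T -> R) (nu : probability R R) : measurable_fun setT X ->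
  (forall s, P (X @^-1` `]-oo, s]%classic) = nu `]-oo, s]%classic)%E ->
  forall A, measurable A -> P (X @^-1` A) = nu A.
Proof.
move=> mX H A mA.
have := @halfline_indep setT X nu measurableT mX.
rewrite probability_setT => /(_ _ A mA); rewrite setTI mul1e; apply => s.
by rewrite setTI mul1e H.
Qed.

End HalfLines.

Section Uniform.
Context (R : realType).

(** Plays two parts: distribution function of the uniform law on [0, 1], and retraction of the line
    onto [0, 1], which turns the identity into a bounded test function. *)
Definition clip (x : R) : R := Num.max 0 (Num.min x 1).

Lemma clip01 x : 0 <= clip x <= 1.
Proof.
rewrite /clip le_max lexx/= ge_max ler01/=.
by rewrite ge_min lexx orbT.
Qed.

Lemma clip_id x : 0 <= x <= 1 -> clip x = x.
Proof. by move=> /andP[x0 x1]; rewrite /clip (min_idPl x1) (max_idPr x0). Qed.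

Lemma clip_le0 x : x <= 0 -> clip x = 0.
Proof. by move=> x0; rewrite /clip; apply/max_idPl; rewrite ge_min x0. Qed.

Lemma clip_ge1 x : 1 <= x -> clip x = 1.
Proof. by move=> x1; rewrite /clip (min_idPr x1); apply/max_idPr. Qed.

Lemma continuous_clip : continuous clip.
Proof.
suff : continuous ((cst 0 : R -> R) \max ((@idfun R) \min (cst 1))) by [].
apply: max_fun_continuous; first by move=> x; exact: cst_continuous.
by apply: min_fun_continuous => x; [exact: cvg_id | exact: cst_continuous].
Qed.

Lemma clip_nd : {homo clip : x y / x <= y}.
Proof.
move=> x y xy; rewrite /clip ge_max le_max lexx/= le_max; apply/orP; right.
by rewrite le_min !ge_min xy lexx !orbT.
Qed.

Let clip_rc : right_continuous clip.
Proof. by move=> x; apply: cvg_at_right_filter; exact: continuous_clip. Qed.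

#[local] HB.instance Definition _ :=
  isCumulative.Build R _ R clip clip_nd clip_rc.

Let clipNy : clip @ -oo --> (0 : R).
Proof.
apply: cvg_near_cst; near=> x; apply: clip_le0.
by near: x; exact: nbhs_ninfty_le.
Unshelve. all: by end_near. Qed.

Let clipy : clip @ +oo --> (1 : R).
Proof.
apply: cvg_near_cst; near=> x; apply: clip_ge1.
by near: x; exact: nbhs_pinfty_ge.
Unshelve. all: by end_near. Qed.

#[local] HB.instance Definition _ :=
  isCumulativeBounded.Build R 0 1 clip clipNy clipy.

Lemma exists_uniform : exists lam : probability R R,
  forall s, lam `]-oo, s]%classic = (clip s)%:E.
Proof.
pose idR : measurableTypeR R -> R := idfun.
have midR : measurable_fun setT idR by exact: (@measurable_id _ _ setT).
pose Y : {mfun measurableTypeR R >-> R} :=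
  HB.pack idR (isMeasurableFun.Build _ _ _ _ idR midR).
exists (distribution (lebesgue_stieltjes_measure clip) Y) => s.
exact: cdf_lebesgue_stieltjes_id.
Qed.

Definition bit (x : R) : R := ((1 / 2 : R) < x)%R%:R.
(** The doubling map, which drops the first binary digit. The digit of 1/2 is 0, so that the two
    halves are separated by a closed ray, in accordance with distribution functions. *)
Definition dbl (x : R) : R := 2 * x - bit x.

Lemma bitE x : bit x = \1_([set` `]1 / 2 : R, +oo[]) x.
Proof.
rewrite /bit indicE; congr (_%:R); congr nat_of_bool.
by apply/idP/idP; rewrite inE /= in_itv/= andbT.
Qed.

Lemma measurable_bit : measurable_fun setT bit.
Proof. by rewrite (funext bitE); exact: measurable_indic. Qed.

Lemma measurable_dbl : measurable_fun setT dbl.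
Proof.
apply: measurable_funB; last exact: measurable_bit.
by apply: measurable_funM => //; exact: measurable_cst.
Qed.

Section Split.
Variable lam : probability R R.
Hypothesis lamE : forall s, lam `]-oo, s]%classic = (clip s)%:E.

Lemma lam_preimage_le (X : R -> R) s : lam [set x | X x <= s] = lam (X @^-1` `]-oo, s]%classic).
Proof. by congr (lam _); apply/seteqP; split=> x /=; rewrite in_itv. Qed.

(** Where the first digit is 0, [dbl x <= s] means [x <= s / 2], so every ray gets half of its mass:
    the remaining digits are again uniform and independent of the first. *)
Lemma lam_bit0 A : measurable A ->
  lam ([set x | x <= 1 / 2] `&` dbl @^-1` A) = ((1 / 2)%:E * lam A)%E.
Proof.
have lam_half : lam [set x | x <= 1 / 2] = (1 / 2)%:E.
  by rewrite lam_preimage_le lamE clip_id//; lra.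
move=> mA; rewrite -lam_half; apply: halfline_indep => //.
- by rewrite (_ : [set _ | _] = `]-oo, 1 / 2]%classic)//; apply/seteqP; split=> x /=; rewrite in_itv.
- exact: measurable_dbl.
move=> s; rewrite lam_half lamE {lam_half}.
rewrite (_ : _ `&` _ = `]-oo, Num.min (1 / 2) (s / 2)]%classic); last first.
  apply/seteqP; split=> x /=; rewrite !in_itv/= le_min /dbl /bit.
    by move=> [x2]; rewrite ltNge x2/= subr0 => ?; lra.
  by move=> /andP[x2 xs]; split=> //; rewrite ltNge x2/= subr0; lra.
rewrite lamE -EFinM; congr EFin.
have [s0|s0] := leP s 0.
  by rewrite !clip_le0 ?mulr0// ge_min; apply/orP; right; lra.
have [s1|s1] := leP s 1.
  by rewrite (min_idPr _) ?clip_id//; lra.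
by rewrite (min_idPl _) ?(@clip_ge1 s) ?clip_id//; lra.
Qed.

Lemma lam_bit1 A : measurable A ->
  lam ([set x | 1 / 2 < x] `&` dbl @^-1` A) = ((1 / 2)%:E * lam A)%E.
Proof.
have E : [set x | (1 / 2 : R) < x] = ~` `]-oo, 1 / 2]%classic.
  by apply/seteqP; split=> x /=; rewrite in_itv/= ltNge => /negP.
have lam_half : lam [set x | 1 / 2 < x] = (1 / 2)%:E.
  rewrite E probability_setC// lamE clip_id; last by lra.
  by rewrite -EFinB; congr EFin; lra.
move=> mA; rewrite -lam_half; apply: halfline_indep => //.
- by rewrite E; exact: measurableC.
- exact: measurable_dbl.
move=> s {E}; rewrite lam_half lamE {lam_half}.
rewrite (_ : _ `&` _ = `]-oo, (s + 1) / 2]%classic `\` `]-oo, 1 / 2]%classic); last first.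
  apply/seteqP; split=> x /=; rewrite !in_itv/= /dbl /bit.
    by move=> [x2]; rewrite x2/= => ?; split; [lra|apply/negP; rewrite -ltNge].
  by move=> [xs /negP]; rewrite -ltNge => x2; rewrite x2/=; split=> //; lra.
have [s0|s0] := leP s 0.
  rewrite (clip_le0 s0) mule0 (_ : _ `\` _ = set0) ?measure0//.
  by apply/seteqP; split=> x //=; rewrite !in_itv/= => -[] ? /negP; rewrite -ltNge => ?; lra.
rewrite measureD//; last by rewrite -ge0_fin_numE// fin_num_measure.
rewrite setIidr; last by move=> x /=; rewrite !in_itv/= => ?; lra.
rewrite [X in (X - _)%E](lamE ((s + 1) / 2)) [X in (_ - X)%E](lamE (1 / 2)).
rewrite -EFinB -EFinM; congr EFin; rewrite [clip (1/2)]clip_id; last by lra.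
have [s1|s1] := leP s 1; first by rewrite !clip_id//; lra.
by rewrite !clip_ge1//; lra.
Qed.

Lemma measurable_half : measurable [set x : R | x <= 1 / 2].
Proof.
by rewrite (_ : [set _ | _] = `]-oo, 1 / 2]%classic)//;
  apply/seteqP; split=> x /=; rewrite in_itv.
Qed.

Lemma lam_halves B : measurable B -> (lam B =
  lam ([set x | x <= 1 / 2]%R `&` B) + lam ([set x | 1 / 2 < x]%R `&` B))%E.
Proof.
move=> mB.
have E : [set x | (1 / 2 : R) < x] = ~` [set x | x <= 1 / 2].
  by apply/seteqP; split=> x /=; rewrite ltNge => /negP.
have mh := measurable_half.
rewrite -measureU//.
- by rewrite -setIUl E setUv setTI.
- exact: measurableI.
- by apply: measurableI => //; rewrite E; exact: measurableC.
- by apply/seteqP; split=> x //= -[[x1 _] [x2 _]]; rewrite leNgt x2 in x1.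
Qed.

Lemma measurable_preimage d1 d2 (T1 : measurableType d1) (T2 : measurableType d2)
    (f : T1 -> T2) A : measurable_fun setT f -> measurable A -> measurable (f @^-1` A).
Proof. by move=> mf mA; rewrite -[X in measurable X]setTI; exact: mf. Qed.

Lemma lam_dbl A : measurable A -> lam (dbl @^-1` A) = lam A.
Proof.
move=> mA; rewrite lam_halves; last exact: measurable_preimage measurable_dbl mA.
have h0 : (0 <= (1 / 2 : R)%:E)%E by rewrite lee_fin; lra.
rewrite lam_bit0// lam_bit1// -ge0_muleDl//.
by rewrite -EFinD -splitr mul1e.
Qed.

Fixpoint evens_approx (n : nat) (x : R) : R :=
  if n is n'.+1 then (bit x + evens_approx n' (dbl (dbl x))) / 2 else 0.

Lemma bit01 x : 0 <= bit x <= 1.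
Proof. by rewrite /bit; case: (_ < _); rewrite /= ?ler01 ?lexx. Qed.

Lemma evens_approx01 n x : 0 <= evens_approx n x <= 1.
Proof.
elim: n x => [|n IH] x /=; first by rewrite lexx ler01.
by have := bit01 x; have := IH (dbl (dbl x)); lra.
Qed.

Lemma evens_approx_nd x : nondecreasing_seq (evens_approx^~ x).
Proof.
apply/nondecreasing_seqP => n; elim: n x => [|n IH] x.
  by have /andP[] := evens_approx01 1 x.
by have := IH (dbl (dbl x)) => /=; lra.
Qed.

(* [evens x] (resp. [odds x]) collects the binary digits of [x] of even
   (resp. odd) rank. *)
Definition evens (x : R) : R := limn (evens_approx^~ x).
Definition odds (x : R) : R := evens (dbl x).

Lemma cvg_evens x : evens_approx n x @[n --> \oo] --> evens x.
Proof.
apply: nondecreasing_is_cvgn; first exact: evens_approx_nd.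
by exists 1 => _ [n _ <-]; have /andP[] := evens_approx01 n x.
Qed.

Lemma evens01 x : 0 <= evens x <= 1.
Proof.
apply/andP; split.
  by apply: (cvgr_to_ge (@cvg_evens x)); apply: nearW => n; have /andP[] := evens_approx01 n x.
by apply: (cvgr_to_le (@cvg_evens x)); apply: nearW => n; have /andP[] := evens_approx01 n x.
Qed.

Lemma evensE x : evens x = (bit x + odds (dbl x)) / 2.
Proof.
have := @cvg_evens x; rewrite -cvg_shiftS /= => /cvg_unique; apply => //.
by apply: cvgMl; apply: cvgD; [exact: cvg_cst | exact: cvg_evens].
Qed.

Lemma measurable_evens : measurable_fun setT evens.
Proof.
apply: (measurable_fun_cvg (h := evens_approx)) => [n|x _]; last exact: cvg_evens.
elim: n => [|n IH] /=; first exact: measurable_cst.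
apply: measurable_funM; last exact: measurable_cst.
apply: measurable_funD; first exact: measurable_bit.
apply: (@measurableT_comp _ _ _ _ _ _ (evens_approx n) _ (dbl \o dbl)) => //.
by apply: measurableT_comp; exact: measurable_dbl.
Qed.

Lemma measurable_odds : measurable_fun setT odds.
Proof. by apply: measurableT_comp; [exact: measurable_evens | exact: measurable_dbl]. Qed.

(** Joint distribution function of the two digit streams; the aim is the product form
    [clip s * clip t]. *)
Let F s t := fine (lam (evens @^-1` `]-oo, s]%classic `&` odds @^-1` `]-oo, t]%classic)).

Let mF s t : measurable (evens @^-1` `]-oo, s]%classic `&` odds @^-1` `]-oo, t]%classic).
Proof.
by apply: measurableI; apply: measurable_preimage => //;
  [exact: measurable_evens | exact: measurable_odds].
Qed.

Let FE s t : (F s t)%:E =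
  lam (evens @^-1` `]-oo, s]%classic `&` odds @^-1` `]-oo, t]%classic).
Proof. by apply: fineK; rewrite fin_num_measure. Qed.

Let F01 s t : 0 <= F s t <= 1.
Proof.
by apply/andP; split; rewrite -lee_fin FE; [exact: measure_ge0 | exact: probability_le1].
Qed.

(** Conditioning on the first digit: with [y = dbl x], [evens x] is half the sum of that digit and
    [odds y], while [odds x] is [evens y]. Hence the exchange of the two arguments. *)
Let F_rec s t : F s t = (F t (2 * s) + F t (2 * s - 1)) / 2.
Proof.
have lam12 B : measurable B -> ((1 / 2)%:E * lam B = ((1 / 2) * fine (lam B))%:E)%E.
  by move=> mB; rewrite [RHS]EFinM fineK// fin_num_measure.
have E0 : [set x | x <= 1 / 2] `&` (evens @^-1` `]-oo, s]%classic `&` odds @^-1` `]-oo, t]%classic) =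
    [set x | x <= 1 / 2] `&`
   dbl @^-1` (evens @^-1` `]-oo, t]%classic `&` odds @^-1` `]-oo, 2 * s]%classic).
  apply/seteqP; split=> x /=; rewrite !in_itv/= -/(odds x) evensE /bit.
    by move=> -[x2 [+ ?]]; rewrite ltNge x2/= => ?; split=> //; split=> //; lra.
  by move=> -[x2 [? +]]; rewrite ltNge x2/= => ?; split=> //; split=> //; lra.
have E1 : [set x | 1 / 2 < x] `&` (evens @^-1` `]-oo, s]%classic `&` odds @^-1` `]-oo, t]%classic) =
    [set x | 1 / 2 < x] `&`
   dbl @^-1` (evens @^-1` `]-oo, t]%classic `&` odds @^-1` `]-oo, 2 * s - 1]%classic).
  apply/seteqP; split=> x /=; rewrite !in_itv/= -/(odds x) evensE /bit.
    by move=> -[x2 [+ ?]]; rewrite x2/= => ?; split=> //; split=> //; lra.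
  by move=> -[x2 [? +]]; rewrite x2/= => ?; split=> //; split=> //; lra.
apply: EFin_inj; rewrite FE lam_halves// E0 E1.
by rewrite lam_bit0// lam_bit1// !lam12// -EFinD; congr EFin; rewrite /F; lra.
Qed.

Let F_lt0l s t : s < 0 -> F s t = 0.
Proof.
move=> s0; rewrite /F (_ : _ `&` _ = set0) ?measure0//.
apply/seteqP; split=> x //=; rewrite !in_itv/= => -[xs _].
by have /andP[] := evens01 x; rewrite leNgt (le_lt_trans xs s0).
Qed.

Let F_lt0r s t : t < 0 -> F s t = 0.
Proof.
move=> t0; rewrite /F (_ : _ `&` _ = set0) ?measure0//.
apply/seteqP; split=> x //=; rewrite !in_itv/= => -[_ xt].
by have /andP[] := evens01 (dbl x); rewrite leNgt (le_lt_trans xt t0).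
Qed.

Let F_ge1r s t : 1 <= t -> F s t = F s 1.
Proof.
move=> t1; congr (fine (lam (_ `&` _))); apply/seteqP; split=> x /=; rewrite !in_itv/= => _.
  by have /andP[] := evens01 (dbl x).
by have /andP[_] := evens01 (dbl x) => /le_trans; apply.
Qed.

Let F_ge1l s t : 1 <= s -> F s t = F 1 t.
Proof.
move=> t1; congr (fine (lam (_ `&` _))); apply/seteqP; split=> x /=; rewrite !in_itv/= => _.
  by have /andP[] := evens01 x.
by have /andP[_] := evens01 x => /le_trans; apply.
Qed.

Let F1E s : (F s 1)%:E = lam (evens @^-1` `]-oo, s]%classic).
Proof.
rewrite FE; congr (lam _); apply/seteqP; split=> x /=; rewrite !in_itv/=; first by case.
by move=> ?; split=> //; have /andP[] := evens01 (dbl x).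
Qed.

Let F_swap1 s : F 1 s = F s 1.
Proof.
apply: EFin_inj; rewrite F1E -lam_dbl; last exact: measurable_preimage measurable_evens _.
rewrite FE; congr (lam _); apply/seteqP; split=> x /=; rewrite !in_itv/=; first by case.
by move=> ?; split=> //; have /andP[] := evens01 x.
Qed.

Let F11 : F 1 1 = 1.
Proof.
apply: EFin_inj; rewrite F1E -(probability_setT lam); congr (lam _).
by apply/seteqP; split=> x //= _; rewrite in_itv/=; have /andP[] := evens01 x.
Qed.

Let clip_double s : clip s = (clip (2 * s) + clip (2 * s - 1)) / 2.
Proof.
have [s0|s0] := ltP s 0; first by rewrite !clip_le0; lra.
have [s1|s1] := ltP s 1; last by rewrite !clip_ge1; lra.
have [s2|s2] := ltP (2 * s) 1.
  by rewrite (@clip_le0 (2 * s - 1)) ?clip_id; lra.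
by rewrite (@clip_ge1 (2 * s)) ?clip_id; lra.
Qed.

Let le_half_exp0 (x : R) : (forall n, `|x| <= (1 / 2) ^+ n) -> x = 0.
Proof.
move=> H; apply/eqP; rewrite -normr_le0.
have h : `|1 / 2 : R| < 1 by rewrite ger0_norm; lra.
by apply: (cvgr_to_ge (cvg_expr h)); exact: nearW.
Qed.

(** Both sides obey the same halving recursion, and for [s] in [0, 1[ one of the two terms on its
    right is 0 for both, or 1 for both. So the distance between the two functions is at most half of
    itself. *)
Let F1_clip s : F s 1 = clip s.
Proof.
apply/eqP; rewrite -subr_eq0; apply/eqP; apply: le_half_exp0 => n.
elim: n s => [|n IH] s.
  by rewrite expr0 ler_norml; have := F01 s 1; have := clip01 s; lra.
have [s0|s0] := ltP s 0.
  by rewrite F_lt0l// clip_le0 ?subr0 ?normr0 ?exprn_ge0//; lra.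
have [s1|s1] := ltP s 1; last first.
  by rewrite F_ge1l// F11 clip_ge1// subrr normr0 exprn_ge0//; lra.
rewrite F_rec !F_swap1 clip_double exprS.
have [s2|s2] := ltP (2 * s) 1.
  rewrite (@F_lt0l (2 * s - 1)) ?(@clip_le0 (2 * s - 1)); try lra.
  have := IH (2 * s); rewrite !ler_norml; lra.
rewrite (@F_ge1l (2 * s)) ?F11 ?(@clip_ge1 (2 * s)); try lra.
by have := IH (2 * s - 1); rewrite !ler_norml; lra.
Qed.

(** The same contraction in two variables: of the two terms of the recursion one is 0 or the margin
    [F t 1] just computed, and the error of the other is halved. *)
Let F_clip s t : F s t = clip s * clip t.
Proof.
apply/eqP; rewrite -subr_eq0; apply/eqP; apply: le_half_exp0 => n.
elim: n s t => [|n IH] s t.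
  rewrite expr0 ler_norml; have := F01 s t; have /andP[s0 s1] := clip01 s.
  have /andP[t0 t1] := clip01 t; have := mulr_ge0 s0 t0; have := mulr_ile1 s0 t0 s1 t1; lra.
have [s0|s0] := ltP s 0.
  by rewrite F_lt0l// (@clip_le0 s) ?mul0r ?subr0 ?normr0 ?exprn_ge0//; lra.
rewrite F_rec (clip_double s) exprS.
have [s2|s2] := ltP (2 * s) 1.
  rewrite (@F_lt0r t (2 * s - 1)) ?(@clip_le0 (2 * s - 1)); try lra.
  have := IH t (2 * s); rewrite !ler_norml; lra.
rewrite (@F_ge1r t (2 * s)) ?F1_clip ?(@clip_ge1 (2 * s)); try lra.
by have := IH t (2 * s - 1); rewrite !ler_norml; lra.
Qed.

Lemma lam_evens A : measurable A -> lam (evens @^-1` A) = lam A.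
Proof.
by apply: halfline_law; [exact: measurable_evens | move=> s; rewrite -F1E F1_clip lamE].
Qed.

Lemma lam_odds A : measurable A -> lam (odds @^-1` A) = lam A.
Proof.
move=> mA; rewrite -(lam_evens mA).
by rewrite -[RHS]lam_dbl//; exact: measurable_preimage measurable_evens mA.
Qed.

(** The product form on pairs of rays is extended to Borel sets one coordinate at a time, by
    [halfline_indep] with the event on the other coordinate held fixed. *)
Lemma lam_split A B : measurable A -> measurable B ->
  lam (evens @^-1` A `&` odds @^-1` B) = (lam A * lam B)%E.
Proof.
move=> mA mB.
have H t : lam (odds @^-1` `]-oo, t]%classic `&` evens @^-1` A) =
    (lam (odds @^-1` `]-oo, t]%classic) * lam A)%E.
  apply: halfline_indep => //; first exact: measurable_preimage measurable_odds _.
    exact: measurable_evens.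
  by move=> s; rewrite setIC -FE F_clip lam_odds// !lamE -EFinM mulrC.
rewrite (@halfline_indep _ _ _ lam (evens @^-1` A) odds lam) ?lam_evens//.
- exact: measurable_preimage measurable_evens mA.
- exact: measurable_odds.
- by move=> s; rewrite setIC H lam_odds// muleC.
Qed.

End Split.

End Uniform.

(** * Quantile functions *)

Definition mkmfun d1 (T1 : measurableType d1) d2 (T2 : measurableType d2)
    (f : T1 -> T2) (mf : measurable_fun setT f) : {mfun T1 >-> T2} :=
  HB.pack f (isMeasurableFun.Build _ _ _ _ f mf).

Section Quantile.
Context (R : realType).

Section OneLaw.
Variable nu : probability R R.
Hypothesis nu01 : on01 nu.

Let F (t : R) : \bar R := nu `]-oo, t]%classic.

Let F_nd (s t : R) : s <= t -> (F s <= F t)%E.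
Proof. by move=> st; apply: le_measure; rewrite ?inE//; exact: subset_itvl. Qed.

Let F1 : F 1 = 1%E.
Proof.
apply/eqP; rewrite eq_le probability_le1//= -[X in (X <= _)%E]nu01.
by apply: le_measure; rewrite ?inE//; apply: subset_itvr.
Qed.

Let F_lt0 t : t < 0 -> F t = 0%E.
Proof.
move=> t0; apply/eqP; rewrite eq_le measure_ge0 andbT.
have <- : nu (~` `[0, 1]%classic) = 0%E by rewrite probability_setC// nu01 subee.
apply: le_measure; rewrite ?inE//; first exact: measurableC.
by move=> x /=; rewrite !in_itv/= => xt /andP[x0 _]; lra.
Qed.

(** The bound [0 <= t] and the cap of [u] at 1 give the infimum a value in [0, 1] for every real
    [u], not only for those in the unit interval. *)
Let S (u : R) : set R := [set t | 0 <= t /\ ((Num.min u 1)%:E <= F t)%E].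

Definition quantile (u : R) : R := inf (S u).

Let S1 u : S u 1.
Proof. by split=> //; rewrite F1 lee_fin ge_min lexx orbT. Qed.

Let hinfS u : has_inf (S u).
Proof. by split; [exists 1 | exists 0 => t []]. Qed.

Lemma quantile01 u : 0 <= quantile u <= 1.
Proof.
apply/andP; split; first by apply: lb_le_inf; [exists 1 | move=> t []].
by apply: ge_inf => //; case: (hinfS u).
Qed.

(** The infimum is attained by right continuity: if [F s] were too small, so would be [F r] for some
    [r > s], although [S u] has a point below [r]. *)
Lemma quantile_le u s : 0 <= s -> (quantile u <= s) = ((Num.min u 1)%:E <= F s)%E.
Proof.
move=> s0; apply/idP/idP => [qs|]; last by move=> H; apply: ge_inf; [case: (hinfS u)|].
rewrite leNgt; apply/negP => Fs.
have rc := @cdf_right_continuous _ _ _ nu (mkmfun (@measurable_id _ R setT)) s.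
have {}rc : fine (F r) @[r --> s^'+] --> fine (F s).
  by apply: fine_cvg; rewrite fineK ?fin_num_measure//; exact: rc.
have vs : fine (F s) < Num.min u 1 by rewrite -lte_fin fineK// fin_num_measure.
have [r [sr Fr]] := filter_ex (filterI (nbhs_right_gt s) (cvgr_lt _ rc _ vs)).
have [t [t0 Ht] tr] := inf_lt (hinfS u).1 (le_lt_trans qs sr).
have : (Num.min u 1 <= fine (F r)).
  by rewrite -lee_fin fineK ?fin_num_measure// (le_trans Ht)// F_nd// ltW.
by rewrite leNgt Fr.
Qed.

Lemma measurable_quantile : measurable_fun setT quantile.
Proof.
apply: nondecreasing_measurable => // u v uv.
have /andP[q0 _] := quantile01 v.
have := lexx (quantile v); rewrite !quantile_le//; apply: le_trans.
by rewrite lee_fin le_min !ge_min uv lexx/= orbT.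
Qed.

Lemma quantile_law (lam : probability R R) :
  (forall s, lam `]-oo, s]%classic = (clip s)%:E) ->
  forall A, measurable A -> lam (quantile @^-1` A) = nu A.
Proof.
move=> lamE; apply: halfline_law; first exact: measurable_quantile.
move=> s; have [s0|s0] := ltP s 0.
  rewrite [RHS]F_lt0// (_ : _ @^-1` _ = set0) ?measure0//.
  apply/seteqP; split=> x //=; rewrite in_itv/= leNgt => /negP; apply.
  by rewrite (lt_le_trans s0)//; have /andP[] := quantile01 x.
have FsE : F s = (fine (F s))%:E by rewrite fineK// fin_num_measure.
have Fs1 : 0 <= fine (F s) <= 1.
  by rewrite -!lee_fin -FsE measure_ge0 probability_le1.
(* When [F s] is 1, the cap makes the condition of [quantile_le] hold for all [u], including those
   above 1. *)
have [Fs_eq1|Fs_neq1] := eqVneq (fine (F s)) 1.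
  rewrite -/(F s) FsE Fs_eq1 -(probability_setT lam); congr (lam _).
  apply/seteqP; split=> x //= _; rewrite in_itv/= quantile_le// FsE Fs_eq1 lee_fin.
  by rewrite ge_min lexx orbT.
rewrite -/(F s) FsE -[in RHS](clip_id Fs1) -lamE; congr (lam _).
apply/seteqP; split=> x /=; rewrite !in_itv/= quantile_le// FsE lee_fin ge_min; last by move=> ->.
by move=> /orP[//|] h; move: Fs_neq1; rewrite eq_le h andbT; case/andP: Fs1 => _ ->.
Qed.

End OneLaw.

End Quantile.

(** * The recursion on functions of a uniform variable *)

Section EncodeEnat.
Context (R : realType).

(* An injection of the values of [N] into [0, 1], so that [N] can be simulated by
   the quantile function of a law on [0, 1]. *)
Definition enc (n : enat) : R := if n is Some k then k.+1%:R^-1 else 0.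

Lemma enc_inj : injective enc.
Proof.
have pos k : (k.+1%:R^-1 : R) != 0 by rewrite invr_eq0 pnatr_eq0.
move=> [j|] [k|] //= => [|/eqP|/esym/eqP].
- by move=> /invr_inj /eqP; rewrite eqr_nat => /eqP [->].
- by rewrite (negbTE (pos j)).
- by rewrite (negbTE (pos k)).
Qed.

Lemma enc01 n : 0 <= enc n <= 1.
Proof.
case: n => [k|] /=; last by rewrite lexx ler01.
by rewrite invr_ge0 ler0n/= invf_le1 ?ltr0n// ler1n.
Qed.

Definition dec (x : R) : enat :=
  if pselect (exists n, x = enc n) is left h then projT1 (cid h) else None.

Lemma encK : cancel enc dec.
Proof.
move=> n; rewrite /dec; case: pselect => [h|[]]; last by exists n.
by apply: enc_inj; rewrite -(projT2 (cid h)).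
Qed.

(** The range of [enc] is countable and reals off it are sent to [None]: the preimage of [B] is
    countable if [None] is not in [B], and has countable complement otherwise. *)
Lemma measurable_dec : measurable_fun setT dec.
Proof.
move=> _ B _; rewrite setTI.
have mD (D : set enat) : measurable (enc @` D).
  apply: countable_measurable; first by move=> x; exact: measurable_set1.
  by apply: (sub_countable (card_image_le _ _)); exact: countableP.
have [BN|BN] := pselect (B None); last first.
  rewrite (_ : _ @^-1` _ = enc @` B)//; apply/seteqP; split=> x /=.
    rewrite /dec; case: pselect => // h; exists (projT1 (cid h)) => //.
    by rewrite -(projT2 (cid h)).
  by move=> [n Bn <-]; rewrite encK.
rewrite (_ : _ @^-1` _ = ~` (enc @` ~` B)); first exact: measurableC.
apply/seteqP; split=> x /=.
  by move=> Bx [n Bn xn]; apply: Bn; rewrite -(encK n) xn.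
move=> nB; rewrite /dec; case: pselect => // h; apply: contrapT => Bx; apply: nB.
by exists (projT1 (cid h)) => //; rewrite -(projT2 (cid h)).
Qed.

End EncodeEnat.

Section Iid.
Context (R : realType) (lam : probability R R).
Hypothesis lamE : forall s, lam `]-oo, s]%classic = (clip s)%:E.

(* Under [lam], the functions [unif i] are i.i.d. with law [lam]. *)
Definition unif (i : nat) (x : R) : R := evens (iter i (@odds R) x).

Lemma measurable_unif i : measurable_fun setT (unif i).
Proof.
apply: measurableT_comp; first exact: measurable_evens.
elim: i => [|i IH] /=; first exact: measurable_id.
by apply: measurableT_comp => //; exact: measurable_odds.
Qed.

Lemma Ex_split (A B : set R) : measurable A -> measurable B ->
  Ex lam (fun x => \1_A (evens x) * \1_B (odds x)) =
  Ex lam (fun x => \1_A x) * Ex lam (fun x => \1_B x).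
Proof.
move=> mA mB; apply: EFin_inj; rewrite EFinM !Ex_indic// -(lam_split lamE)//.
have mI : measurable (@evens R @^-1` A `&` @odds R @^-1` B).
  by apply: measurableI; [exact: measurable_preimage (@measurable_evens R) _ |
    exact: measurable_preimage (@measurable_odds R) _].
by rewrite -(Ex_indic lam mI); congr EFin; apply: eq_Ex => x; rewrite indicI.
Qed.

Lemma prod_indic_unif l (A : nat -> set R) x :
  \prod_(i < l) \1_(A i) (unif i x) =
  \1_(\bigcap_(i in [set` iota 0 l]) (unif i @^-1` A i)) x :> R.
Proof.
rewrite -prod_indic -(big_mkord xpredT (fun i => \1_(A i) (unif i x) : R)).
by rewrite /index_iota subn0.
Qed.

Lemma Ex_split_unif l B (A : nat -> set R) : measurable B -> (forall i, measurable (A i)) ->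
  Ex lam (fun x => \1_B (evens x) * \prod_(i < l) \1_(A i) (unif i (odds x))) =
  Ex lam (fun x => \1_B x) * \prod_(i < l) Ex lam (fun x => \1_(A i) x).
Proof.
move=> mB mA; have mH (A' : nat -> set R) l' : (forall i, measurable (A' i)) ->
    measurable (\bigcap_(i in [set` iota 0 l']) (unif i @^-1` A' i)).
  by move=> mA'; apply: measurable_bigcap_seq => i _; exact: measurable_preimage (@measurable_unif i) _.
under eq_Ex do rewrite prod_indic_unif.
rewrite Ex_split//; last exact: mH.
congr (_ * _); elim: l A mA => [|l IH] A mA.
  rewrite big_ord0 -[RHS](Ex_cst lam); apply: eq_Ex => x.
  by rewrite -prod_indic_unif big_ord0.
rewrite big_ord_recl -(IH (fun i => A i.+1))// -Ex_split//; last exact: mH.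
apply: eq_Ex => x; rewrite -!prod_indic_unif big_ord_recl; congr (_ * _).
by apply: eq_bigr => i _; rewrite /unif -iterSr.
Qed.

Context d0 (S0 : measurableType d0) (P0 : probability S0 R) (N : {RV P0 >-> enat}).

Let menc : measurable_fun setT (fun w => @enc R (N w)).
Proof. by apply: measurableT_comp => //; exact: measurable_funPT. Qed.

Let nuN : probability R R := distribution P0 (mkmfun menc).

Let nuN01 : on01 nuN.
Proof.
rewrite /on01 /nuN /distribution /= /pushforward -(probability_setT P0); congr (P0 _).
by apply/seteqP; split=> w //= _; rewrite in_itv/= enc01.
Qed.

(** Spends one of the two digit streams on N and leaves the other, [odds x], for the variables of
    the daughters. *)
Definition Ngen (x : R) : enat := dec (quantile nuN (evens x)).

Lemma measurable_Ngen : measurable_fun setT Ngen.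
Proof.
apply: measurableT_comp; first exact: measurable_dec.
by apply: measurableT_comp; [exact: measurable_quantile nuN01 | exact: measurable_evens].
Qed.

Lemma indep_Ngen B l (A : nat -> set R) : (forall i, measurable (A i)) ->
  Ex lam (fun x => \1_B (Ngen x) * \prod_(i < l) \1_(A i) (unif i (odds x))) =
  Ex P0 (fun w => \1_B (N w)) * \prod_(i < l) Ex lam (fun x => \1_(A i) x).
Proof.
move=> mA.
have mq : measurable_fun setT (fun u => dec (quantile nuN u)).
  by apply: measurableT_comp; [exact: measurable_dec | exact: measurable_quantile nuN01].
have mB : measurable ((fun u => dec (quantile nuN u)) @^-1` B).
  exact: measurable_preimage mq _.
rewrite [LHS](Ex_split_unif l mB mA); congr (_ * _); apply: EFin_inj.
have mBR : measurable (@dec R @^-1` B) by exact: measurable_preimage (@measurable_dec R) _.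
have mBN : measurable (N @^-1` B) by exact: measurable_preimage (measurable_funPT N) _.
rewrite Ex_indic// [LHS](quantile_law nuN01 lamE mBR).
transitivity (P0 (N @^-1` B)); last by rewrite -(Ex_indic P0 mBN).
rewrite /nuN /distribution /= /pushforward; congr (P0 _).
by apply/seteqP; split=> w /=; rewrite encK.
Qed.

(* If [a] has law [nu] under [lam], then [recfun a] has law [mapT nu]. Applied to
   two functions [a] and [b], it couples their images: the same [Ngen x] and
   [unif i (odds x)] serve for both. *)
Definition recfun (a : R -> R) (x : R) : R :=
  1 - eprod (Ngen x) (fun i => a (unif i (odds x))).

Let ua_unif (a : R -> R) i : u01 a -> u01 (fun x => a (unif i (odds x))).
Proof.
move=> ua; split; last by move=> x; exact: ua.2.
apply: measurableT_comp; first exact: ua.1.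
by apply: measurableT_comp; [exact: measurable_unif | exact: measurable_odds].
Qed.

Lemma u01_recfun (a : R -> R) : u01 a -> u01 (recfun a).
Proof.
move=> ua; apply: u01_onem; apply: u01_eprod; first exact: measurable_Ngen.
by move=> i; exact: ua_unif.
Qed.

Lemma Ex_eprod_unif (g : R -> R) : u01 g ->
  Ex lam (fun x => eprod (Ngen x) (fun i => g (unif i (odds x)))) = pgf N (Ex lam g).
Proof.
apply: Ex_eprod_iid; [exact: measurable_Ngen | | exact: indep_Ngen].
by move=> i; apply: measurableT_comp; [exact: measurable_unif | exact: measurable_odds].
Qed.

Lemma Ex_recfun (a : R -> R) : u01 a -> Ex lam (recfun a) = 1 - pgf N (Ex lam a).
Proof.
move=> ua; rewrite -Ex_eprod_unif// ExB ?Ex_cst//; first exact: bmf_cst.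
by apply: u01_bmf; apply: u01_eprod; [exact: measurable_Ngen | move=> i; exact: ua_unif].
Qed.

Lemma Ex_recfunM (a b : R -> R) : u01 a -> u01 b -> Ex lam (fun x => recfun a x * recfun b x) =
  1 - pgf N (Ex lam a) - pgf N (Ex lam b) + pgf N (Ex lam (fun x => a x * b x)).
Proof.
move=> ua ub; rewrite -!Ex_eprod_unif//; last exact: u01M.
have bE (c : R -> R) : u01 c -> bmf (fun x => eprod (Ngen x) (fun i => c (unif i (odds x)))).
  by move=> uc; apply: u01_bmf; apply: u01_eprod; [exact: measurable_Ngen | move=> i; exact: ua_unif].
rewrite -[in RHS](Ex_cst lam 1) -!ExB//; try exact: bmf_cst; try exact: bE.
  rewrite -ExD; [|by apply: bmfB; [apply: bmfB; [exact: bmf_cst|]|]; exact: bE | exact: (bE _ (u01M ua ub))].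
  apply: eq_Ex => x; rewrite /recfun eprodM; first by ring.
    by move=> i; exact: ua.2.
  by move=> i; exact: ub.2.
by apply: bmfB; [exact: bmf_cst | exact: bE].
Qed.

Lemma lam_unif_odds i (A : set R) : measurable A ->
  lam ((fun x => unif i (odds x)) @^-1` A) = lam A.
Proof.
move=> mA; have mu := measurable_preimage (@measurable_unif i) mA.
rewrite -[LHS]/(lam (@odds R @^-1` (unif i @^-1` A))) lam_odds//.
elim: i {mu} => [|i IH]; first by rewrite -[RHS](lam_evens lamE mA).
have mu := measurable_preimage (@measurable_unif i) mA.
rewrite -IH -[RHS](lam_odds lamE mu); congr (lam _).
by apply/seteqP; split=> x /=; rewrite /unif -iterSr.
Qed.

Lemma prod_nat_seq (s : seq nat) (g : nat -> R) : uniq s ->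
  \prod_(i < (\max_(i <- s) i).+1) (if (i : nat) \in s then g i else 1) =
  \prod_(i <- s) g i.
Proof.
move=> us; rewrite -(big_mkord xpredT (fun i => if i \in s then g i else 1)).
rewrite -big_mkcond -big_filter; apply: perm_big; apply: uniq_perm => //.
  by rewrite filter_uniq// iota_uniq.
move=> i; rewrite mem_filter mem_index_iota/= ltnS.
by case: (boolP (i \in s)) => //= si; exact: leq_bigmax_seq.
Qed.

Lemma mutually_indep_unif (a : R -> R) : measurable_fun setT a ->
  mutually_indep lam setT (fun i x => a (unif i (odds x))).
Proof.
move=> ma s A us _ mA.
have mX i B : measurable B -> measurable ((fun x => a (unif i (odds x))) @^-1` B).
  move=> mB; apply: measurable_preimage mB; apply: measurableT_comp => //.
  by apply: measurableT_comp; [exact: measurable_unif | exact: measurable_odds].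
(* Indices outside [s] get the full set, so that the formula for initial segments, [Ex_split_unif],
   covers an arbitrary finite set of indices. *)
pose A' i := if i \in s then a @^-1` A i else setT.
have mA' i : measurable (A' i).
  by rewrite /A'; case: ifP => // _; exact: measurable_preimage ma _.
have := Ex_split_unif (\max_(i <- s) i).+1 measurableT mA'.
rewrite [X in _ = X * _](_ : _ = 1); last first.
  by rewrite -[RHS](Ex_cst lam); apply: eq_Ex => x; rewrite indicT.
rewrite mul1r => H.
have X1 i x : \1_(A' i) (unif i (odds x)) =
    if i \in s then \1_((fun x => a (unif i (odds x))) @^-1` A i) x else 1 :> R.
  by rewrite /A'; case: ifP => // _; rewrite indicT.
have XE i : Ex lam (fun x => \1_(A' i) x) = if i \in s then
    Ex lam (fun x => \1_((fun x => a (unif i (odds x))) @^-1` A i) x) else 1.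
  rewrite /A'; case: ifP => // _; last first.
    by rewrite -[RHS](Ex_cst lam); apply: eq_Ex => x; rewrite indicT.
  have maA : measurable (a @^-1` A i) by exact: measurable_preimage ma _.
  apply: EFin_inj; rewrite !Ex_indic//; last exact: mX.
  by rewrite -[LHS](lam_unif_odds i maA).
have {}XE : \prod_(i < (\max_(i <- s) i).+1) Ex lam (fun x => \1_(A' i) x) =
    \prod_(i <- s) Ex lam (fun x => \1_((fun x => a (unif i (odds x))) @^-1` A i) x).
  by rewrite -prod_nat_seq//; apply: eq_bigr => i _; exact: XE.
transitivity (\prod_(i <- s) Ex lam (fun x => \1_((fun x => a (unif i (odds x))) @^-1` A i) x))%:E.
  rewrite -XE -H -[X in lam X]setTI.
  rewrite -(Ex_prod_indic lam s measurableT (fun i => mX i _ (mA i))).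
  congr EFin; apply: eq_Ex => x; rewrite !indicT; congr (_ * _).
  by rewrite -prod_nat_seq//; apply: eq_bigr => i _; rewrite X1.
by rewrite -prodEFin; apply: eq_bigr => i _; rewrite Ex_indic//; exact: mX.
Qed.

Lemma sigma_of_sub d1 (T1 : measurableType d1) d2 (T2 : measurableType d2) d3 (T3 : measurableType d3)
    (I : Type) (J : set I) (X : I -> T1 -> T2) (f : T1 -> T3) :
  (forall i, J i -> exists g : T3 -> T2, measurable_fun setT g /\ X i = g \o f) ->
  forall A, sigma_of J X A -> exists2 B, measurable B & A = f @^-1` B.
Proof.
move=> H A; suff : sigma_of J X `<=` preimage_set_system setT f measurable.
  by move=> /[apply] -[B mB <-]; exists B => //; rewrite setTI.
apply: smallest_sub; first by apply: sigma_algebra_preimage; exact: sigma_algebra_measurable.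
move=> B [i Ji [C mC <-]]; have [g [mg ->]] := H i Ji.
by exists (g @^-1` C); [exact: measurable_preimage mg _ | rewrite !setTI].
Qed.

(** Supplies the witness that keeps [xget] in [mapT] from its default value. The copy of N is a
    function of [evens x] and the X_i are functions of [odds x], so their independence is
    [lam_split]. *)
Lemma is_image_recfun (a : R -> R) (nu nu' : probability R R) : u01 a ->
  (forall A, measurable A -> nu A = lam (a @^-1` A)) ->
  (forall A, measurable A -> nu' A = lam (recfun a @^-1` A)) ->
  is_image N nu nu'.
Proof.
move=> ua lawa lawa'.
have mX i : measurable_fun setT (fun x => a (unif i (odds x))) by exact: (ua_unif i ua).1.
exists _, R, lam, (mkmfun measurable_Ngen), (fun i => mkmfun (mX i)); split.
  move=> B mB; have := indep_Ngen B 0 (fun=> measurableT).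
  rewrite !big_ord0 mulr1 => H.
  have mNB : measurable (N @^-1` B) by exact: measurable_preimage (measurable_funPT N) _.
  have mGB : measurable (Ngen @^-1` B) by exact: measurable_preimage measurable_Ngen _.
  rewrite -(Ex_indic P0 mNB) -[LHS](Ex_indic lam mGB); congr EFin.
  by rewrite -H; apply: eq_Ex => x; rewrite big_ord0 mulr1.
split; first by move=> i w; exact: ua.2.
split.
  move=> i A mA; have maA : measurable (a @^-1` A) by exact: measurable_preimage ua.1 _.
  by rewrite lawa// -(lam_unif_odds i maA).
split; first exact: mutually_indep_unif ua.1.
split; last by [].
move=> A B SA SB.
have [A1 mA1 ->] : exists2 D, measurable D & A = @evens R @^-1` D.
  apply: sigma_of_sub SA => i _; exists (fun u => dec (quantile nuN u)); split=> //.
  by apply: measurableT_comp; [exact: measurable_dec | exact: measurable_quantile nuN01].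
have [B1 mB1 ->] : exists2 D, measurable D & B = @odds R @^-1` D.
  apply: sigma_of_sub SB => i _; exists (fun u => a (unif i u)); split=> //.
  by apply: measurableT_comp; [exact: ua.1 | exact: measurable_unif].
by rewrite lam_split// lam_evens// lam_odds.
Qed.

End Iid.

(** * Moments *)

Section Bernstein.
Context (R : realType).

(** The Bernstein sum of C(n, k) x^k (1 - x)^(n - k) h(k), computed by conditioning on the first of
    [n] trials with success probability [x]; monotonicity and moments then follow by induction,
    without binomial sums. *)
Fixpoint bern (n : nat) (h : nat -> R) (x : R) : R :=
  if n is n'.+1 then x * bern n' (fun k => h k.+1) x + (1 - x) * bern n' h x
  else h 0%N.

Lemma bern_affine n h a b x : bern n (fun k => a + b * h k) x = a + b * bern n h x.
Proof. by elim: n h => [|n IH] h //=; rewrite !IH; ring. Qed.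

Lemma le_bern n h h' x : 0 <= x <= 1 -> (forall k, h k <= h' k) ->
  bern n h x <= bern n h' x.
Proof.
move=> /andP[x0 x1]; elim: n h h' => [|n IH] h h' hh' //=.
by apply: lerD; apply: ler_wpM2l; rewrite ?subr_ge0//; apply: IH.
Qed.

(** Variance of the binomial law plus squared bias. The centre [c] is arbitrary because a first
    success shifts it to [c - 1]. *)
Lemma bern_sqr n c x :
  bern n (fun k => (k%:R - c) ^+ 2) x = n%:R * x * (1 - x) + (n%:R * x - c) ^+ 2.
Proof.
elim: n c => [|n IH] c /=; first by ring.
rewrite IH (_ : (fun k => _) = (fun k => (k%:R - (c - 1)) ^+ 2)) ?IH.
  by rewrite -natr1; ring.
by apply/funext => k; rewrite -natr1; congr (_ ^+ 2); ring.
Qed.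

Lemma norm_bern n h x M : 0 <= x <= 1 -> (forall k, `|h k| <= M) -> `|bern n h x| <= M.
Proof.
move=> x01 hM; have c a : bern n (fun=> a) x = a.
  by elim: n => //= n IH; rewrite IH; ring.
rewrite ler_norml -{1}(c (- M)) -{2}(c M); apply/andP; split; apply: le_bern => // k;
  by have := hM k; rewrite ler_norml => /andP[].
Qed.

Lemma cvg_bern (g : R -> R) (M : R) x : 0 <= x <= 1 -> {for x, continuous g} ->
  (forall y, `|g y| <= M) ->
  bern n.+1 (fun k => g (k%:R / n.+1%:R)) x @[n --> \oo] --> g x.
Proof.
move=> x01 cg gM; apply/cvgrPdist_le => e e0.
have e2 : 0 < e / 2 by rewrite divr_gt0.
have := cg => /cvgrPdist_le /(_ _ e2) /nbhs_ballP[d /= d0 dg].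
have M0 : 0 <= M by apply: le_trans (gM 0).
(* Beyond distance [d] the crude bound [2 * M] is dominated by [K * (y - x) ^+ 2]; a quadratic bound
   is what the binomial variance can average. *)
pose K := 2 * M / d ^+ 2.
have K0 : 0 <= K by apply: divr_ge0; [exact: mulr_ge0 | exact: sqr_ge0].
have gK y : `|g x - g y| <= e / 2 + K * (y - x) ^+ 2.
  have [xy|xy] := ltP `|x - y| d.
    by apply: (le_trans (dg y xy)); rewrite lerDl mulr_ge0// sqr_ge0.
  have : `|g x - g y| <= 2 * M.
    by rewrite (le_trans (ler_normB _ _))// mulr2n mulrDl mul1r lerD.
  move/le_trans; apply; apply: ler_wpDl; first exact: ltW.
  rewrite /K -mulrA ler_peMr ?mulr_ge0// ler_pdivlMl ?exprn_gt0// mulr1.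
  by rewrite -[leRHS]real_normK ?num_real// distrC lerXn2r ?nnegrE// ltW.
near=> n.
have nE : bern n.+1 (fun k => (k%:R / n.+1%:R - x) ^+ 2) x = x * (1 - x) / n.+1%:R.
  have n0 : n.+1%:R != 0 :> R by rewrite pnatr_eq0.
  rewrite (_ : (fun k => _) = fun k => 0 + (n.+1%:R ^+ 2)^-1 * (k%:R - n.+1%:R * x) ^+ 2).
    by rewrite bern_affine bern_sqr; field.
  by apply/funext => k; field.
have x1x : x * (1 - x) <= 1 by have := sqr_ge0 x; nra.
have small : K / n.+1%:R <= e / 2.
  rewrite ler_pdivrMr ?ltr0n// -ler_pdivrMl// mulrC.
  near: n; apply: filterS (nbhs_infty_ger (K / (e / 2))) => n /le_trans; apply.
  by rewrite ler_nat.
have B c : bern n.+1 (fun k => g x + c * (e / 2 + K * (k%:R / n.+1%:R - x) ^+ 2)) x =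
    g x + c * (e / 2 + K * (x * (1 - x) / n.+1%:R)).
  by rewrite bern_affine bern_affine nE.
have bnd : e / 2 + K * (x * (1 - x) / n.+1%:R) <= e.
  have : K * (x * (1 - x) / n.+1%:R) <= K / n.+1%:R.
    by rewrite mulrA [K * _]mulrC -mulrA ler_piMl// divr_ge0.
  by move=> /le_trans/(_ small) h; rewrite [leRHS](splitr e) lerD2l.
move: (K * (x * (1 - x) / n.+1%:R)) B bnd => V B bnd.
rewrite ler_norml; apply/andP; split.
  rewrite lerNl opprB lerBlDl.
  apply: (@le_trans _ _ (g x + 1 * (e / 2 + V))); last by lra.
  rewrite -B; apply: (@le_bern n.+1 (fun k => g (k%:R / n.+1%:R)) _ x) => // k.
  by have := gK (k%:R / n.+1%:R); move: (K * (k%:R / n.+1%:R - x) ^+ 2) => V'; rewrite ler_norml; lra.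
rewrite lerBlDl -lerBlDr.
apply: (@le_trans _ _ (g x + (-1) * (e / 2 + V))); first by lra.
rewrite -B; apply: (@le_bern n.+1 _ (fun k => g (k%:R / n.+1%:R)) x) => // k.
by have := gK (k%:R / n.+1%:R); move: (K * (k%:R / n.+1%:R - x) ^+ 2) => V'; rewrite ler_norml; lra.
Unshelve. all: by end_near. Qed.

End Bernstein.

(* Hausdorff: the moments of a [0, 1]-valued variable determine its law. *)
Lemma Ex_moments (R : realType) d1 (T1 : measurableType d1) (P1 : probability T1 R)
    d2 (T2 : measurableType d2) (P2 : probability T2 R) (x1 : T1 -> R) (x2 : T2 -> R)
    (g : R -> R) :
  u01 x1 -> u01 x2 ->
  (forall k, Ex P1 (fun w => x1 w ^+ k) = Ex P2 (fun w => x2 w ^+ k)) ->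
  continuous g -> (exists M, forall x, `|g x| <= M) ->
  Ex P1 (fun w => g (x1 w)) = Ex P2 (fun w => g (x2 w)).
Proof.
move=> u1 u2 mom cg [M gM].
have bb d (T : measurableType d) (x : T -> R) n h : u01 x -> bmf (fun w => bern n h (x w)).
  move=> ux; elim: n h => [|n IH] h /=; first exact: bmf_cst.
  apply: bmfD; apply: bmfM => //; first exact: u01_bmf.
  by apply: bmfB; [exact: bmf_cst | exact: u01_bmf].
(* The factor [x ^+ i] absorbs the factor [x] produced by each step of the Bernstein recursion, so
   that only monomials remain at the base. *)
have E n h i : Ex P1 (fun w => x1 w ^+ i * bern n h (x1 w)) =
               Ex P2 (fun w => x2 w ^+ i * bern n h (x2 w)).
  elim: n h i => [|n IH] h i /=.
    under eq_Ex do rewrite mulrC; under [RHS]eq_Ex do rewrite mulrC.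
    by rewrite !ExZ ?mom//; apply: bmfX; exact: u01_bmf.
  have S d (T : measurableType d) (P : probability T R) (x : T -> R) : u01 x ->
    Ex P (fun w => x w ^+ i * (x w * bern n (fun k => h k.+1) (x w) +
      (1 - x w) * bern n h (x w))) =
    Ex P (fun w => x w ^+ i.+1 * bern n (fun k => h k.+1) (x w)) +
    (Ex P (fun w => x w ^+ i * bern n h (x w)) - Ex P (fun w => x w ^+ i.+1 * bern n h (x w))).
    move=> ux; have bp j h' : bmf (fun w => x w ^+ j * bern n h' (x w)).
      by apply: bmfM; [apply: bmfX; exact: u01_bmf | exact: bb].
    rewrite -ExB// -ExD//; last exact: bmfB.
    by apply: eq_Ex => w; rewrite exprS; ring.
  by rewrite !S// !IH.
have cv d (T : measurableType d) (P : probability T R) (x : T -> R) : u01 x ->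
    Ex P (fun w => bern n.+1 (fun k => g (k%:R / n.+1%:R)) (x w)) @[n --> \oo] -->
    Ex P (fun w => g (x w)).
  move=> ux; apply: (Ex_cvg P (M := M) _ _ _).2.
  - by move=> n; exact: (bb _ _ _ _ _ ux).1.
  - by move=> n w; apply: norm_bern => //; exact: ux.2.
  - by move=> w; apply: (cvg_bern (M := M)) => //; [exact: ux.2 | exact: cg].
have := cv _ _ P1 _ u1; under eq_cvg => n.
  rewrite (_ : Ex _ _ = Ex P2 (fun w => bern n.+1 (fun k => g (k%:R / n.+1%:R)) (x2 w))).
  over.
  have := E n.+1 (fun k => g (k%:R / n.+1%:R)) 0%N.
  by under eq_Ex do rewrite expr0 mul1r; under [in RHS]eq_Ex do rewrite expr0 mul1r.
by move=> c1; exact: (cvg_unique _ c1 (cv _ _ P2 _ u2)).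
Qed.

Section MomentMap.
Context (R : realType).

Lemma Ex_expand d (T : measurableType d) (P : probability T R) (Z E : T -> R) k :
  bmf Z -> bmf E ->
  Ex P (fun w => Z w * (1 - E w) ^+ k) =
  \sum_(j < k.+1) ((-1) ^+ j * 'C(k, j)%:R) * Ex P (fun w => Z w * E w ^+ j).
Proof.
move=> bZ bE.
have bj j : bmf (fun w => Z w * E w ^+ j) by apply: bmfM => //; exact: bmfX.
transitivity (\sum_(j < k.+1) Ex P (fun w => ((-1) ^+ j * 'C(k, j)%:R) * (Z w * E w ^+ j))).
  rewrite -Ex_sum; last by move=> j; apply: bmfM => //; exact: bmf_cst.
  apply: eq_Ex => w; rewrite exprBn mulr_sumr; apply: eq_bigr => j _.
  by rewrite expr1n mulr1 -mulr_natr; ring.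
by apply: eq_bigr => j _; rewrite ExZ.
Qed.

Context d0 (S0 : measurableType d0) (P0 : probability S0 R) (N : {RV P0 >-> enat}).

(* The action of T on moment sequences: expand (1 - prod_i X_i) ^ k and use
   E[prod_i X_i ^ j] = H(E[X ^ j]). *)
Definition mommap (m : nat -> R) (k : nat) : R :=
  \sum_(j < k.+1) ((-1) ^+ j * 'C(k, j)%:R) * pgf N (m j).

(** [clip] keeps the integrand bounded on the line; for laws carried by [0, 1] these are the usual
    moments. *)
Definition mom (nu : probability R R) (k : nat) : R := Ex nu (fun x => clip x ^+ k).

Lemma u01_clip : u01 (@clip R).
Proof.
by split; [apply: continuous_measurable_fun; exact: continuous_clip | exact: clip01].
Qed.

Lemma image_on01 (nu nu' : probability R R) : is_image N nu nu' -> on01 nu'.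
Proof.
move=> [d [Om [Q [M [X [_ [X01 [_ [_ [_ law']]]]]]]]]].
rewrite /on01 law'// -(probability_setT Q); congr (Q _).
apply/seteqP; split=> w //= _; rewrite in_itv/=.
by have := eprod01 (M w) (X01^~ w); lra.
Qed.

Lemma image_mom (nu nu' : probability R R) k : is_image N nu nu' ->
  mom nu' k = mommap (mom nu) k.
Proof.
move=> [d [Om [Q [M [X [lawM [X01 [lawX [indX [indMX law']]]]]]]]]].
have uX i : u01 (X i) by split; [exact: measurable_funPT | move=> w; exact: X01].
have uE : u01 (fun w => eprod (M w) (fun i => X i w)).
  by apply: u01_eprod => //; exact: measurable_funPT.
rewrite /mom (pushforward_Ex (Q := Q) _ law'); first last.
- exact: u01X u01_clip.
- exact: (u01_onem uE).1.
transitivity (Ex Q (fun w => 1 * (1 - eprod (M w) (fun i => X i w)) ^+ k)).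
  by apply: eq_Ex => w; rewrite mul1r clip_id//; exact: (u01_onem uE).2.
rewrite Ex_expand; [|exact: bmf_cst|exact: u01_bmf].
apply: eq_bigr => j _; congr (_ * _).
rewrite -(image_eprod lawM lawX indX indMX (u01X j u01_clip)); apply: eq_Ex => w.
rewrite mul1r -eprodX => [|i]; last exact: X01.
by congr eprod; apply/funext => i; rewrite clip_id.
Qed.

Section Lam.
Variable lam : probability R R.
Hypothesis lamE : forall s, lam `]-oo, s]%classic = (clip s)%:E.

Let rf := @recfun R _ _ P0 N.

Lemma recfun_mom (a : R -> R) k : u01 a ->
  Ex lam (fun x => rf a x ^+ k) = mommap (fun j => Ex lam (fun x => a x ^+ j)) k.
Proof.
move=> ua; have ua_unif i : u01 (fun x => a (unif i (odds x))).
  split; last by move=> x; exact: ua.2.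
  apply: measurableT_comp; first exact: ua.1.
  by apply: measurableT_comp; [exact: measurable_unif | exact: measurable_odds].
have uE : u01 (fun x => eprod (Ngen N x) (fun i => a (unif i (odds x)))).
  by apply: u01_eprod => //; exact: measurable_Ngen.
transitivity (Ex lam (fun x => 1 * rf a x ^+ k)).
  by apply: eq_Ex => x; rewrite mul1r.
rewrite Ex_expand; [|exact: bmf_cst|exact: u01_bmf].
apply: eq_bigr => j _; congr (_ * _).
rewrite -(Ex_eprod_unif lamE N (u01X j ua)); apply: eq_Ex => x.
by rewrite mul1r eprodX// => i; exact: ua.2.
Qed.

Lemma u01_quantile (nu : probability R R) : on01 nu -> u01 (quantile nu).
Proof. by move=> nu01; split; [exact: measurable_quantile | exact: quantile01]. Qed.

Lemma mapT_image (nu : probability R R) : on01 nu -> is_image N nu (mapT N nu).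
Proof.
move=> nu01; have ua := u01_quantile nu01.
have mrf : measurable_fun setT (rf (quantile nu)) by exact: (u01_recfun N ua).1.
rewrite /mapT; apply: (@xgetPex _ nu [set nu' | is_image N nu nu']).
exists (distribution lam (mkmfun mrf) : probability R R).
apply: (is_image_recfun lamE ua) => // A mA.
by rewrite (quantile_law nu01 lamE).
Qed.

Lemma u01_iter_recfun n (a : R -> R) : u01 a -> u01 (iter n rf a).
Proof. by move=> ua; elim: n => //= n IH; exact: u01_recfun. Qed.

(** Only [is_image] is known of the law selected at each step. Its moments are forced all the same,
    since they and those of the [recfun] iterates evolve under [mommap]. The property [on01] is
    carried along because the next selection relies on it. *)
Lemma iter_mapT n (nu : probability R R) : on01 nu -> on01 (iter n (mapT N) nu) /\
  forall k, mom (iter n (mapT N) nu) k =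
    Ex lam (fun x => iter n rf (quantile nu) x ^+ k).
Proof.
move=> nu01; have ua := u01_quantile nu01.
elim: n => [|n [IH1 IH2]].
  split=> // k; rewrite /= /mom (pushforward_Ex (Q := lam) (X := quantile nu)).
  - by apply: eq_Ex => x; rewrite clip_id//; exact: ua.2.
  - exact: ua.1.
  - by move=> A mA; rewrite (quantile_law nu01 lamE).
  - exact: u01X u01_clip.
have im := mapT_image IH1; split=> [|k] /=; first exact: image_on01 im.
rewrite (image_mom _ im) recfun_mom; last exact: u01_iter_recfun.
by congr mommap; apply/funext => j; exact: IH2.
Qed.

Lemma Ex_on01_clip (nu : probability R R) (g : R -> R) : on01 nu -> continuous g ->
  (exists M, forall x, `|g x| <= M) -> Ex nu g = Ex nu (fun x => g (clip x)).
Proof.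
move=> nu01 cg gM; apply: Ex_ae.
- by split=> //; exact: continuous_measurable_fun.
- split; last by case: gM => M gM; exists M.
  by apply: measurableT_comp; [exact: continuous_measurable_fun | exact: u01_clip.1].
exists (~` `[0, 1]%classic); split; first exact: measurableC.
  by rewrite probability_setC// nu01 subee.
move=> x /=; apply: contra_not => x01; rewrite clip_id//.
Qed.

Lemma iter_mapT2 n (nu : probability R R) (g : R -> R) : on01 nu -> continuous g ->
  (exists M, forall x, `|g x| <= M) ->
  (\int[iter n (mapT N \o mapT N) nu]_x (g x)%:E =
   (Ex lam (fun x => g (iter n.*2 rf (quantile nu) x)))%:E)%E.
Proof.
move=> nu01 cg gM.
have -> : iter n (mapT N \o mapT N) nu = iter n.*2 (mapT N) nu by elim: n => //= n ->.
have [l01 lmom] := iter_mapT n.*2 nu01.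
rewrite ExE; last by split=> //; exact: continuous_measurable_fun.
rewrite Ex_on01_clip//; congr EFin; apply: Ex_moments => //; first exact: u01_clip.
by apply: u01_iter_recfun; exact: u01_quantile.
Qed.

End Lam.

End MomentMap.

(** * Generating functions *)

Section GeneratingFunction.
Context (R : realType).

(** Derivative of [epow] with respect to its base on [0, 1[, whence 0 for an infinite exponent. *)
Definition depow (x : R) (n : enat) : R := if n is Some k then k%:R * x ^+ k.-1 else 0.

Lemma depowS (x : R) k : depow x (Some k.+1) = x * depow x (Some k) + x ^+ k.
Proof.
case: k => [|k] /=; first by rewrite expr0; ring.
by rewrite exprS -[k.+2%:R]natr1; ring.
Qed.

Lemma depow_ge0 (x : R) n : 0 <= x -> 0 <= depow x n.
Proof. by case: n => [k|] //= x0; rewrite mulr_ge0// exprn_ge0. Qed.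

(** The recursion [depowS] is dominated by d -> q d + 1, whose fixed point is 1 / (1 - q).
    Uniformity in [n] is what allows differentiation under the expectation. *)
Lemma depow_le (x q : R) n : 0 <= x -> x <= q -> q < 1 -> depow x n <= (1 - q)^-1.
Proof.
move=> x0 xq q1; have q1' : 0 < 1 - q by rewrite subr_gt0.
case: n => [k|] /=; last by rewrite invr_ge0 ltW.
rewrite -[leLHS]/(depow x (Some k)); elim: k => [|k IH].
  by rewrite /= mul0r invr_ge0 ltW.
rewrite depowS.
have xk : x ^+ k <= 1 by rewrite exprn_ile1//; lra.
have d0 := depow_ge0 (Some k) x0.
have : x * depow x (Some k) <= q * (1 - q)^-1 by rewrite ler_pM.
have : (1 - q) * (1 - q)^-1 = 1 by rewrite divff// gt_eqF.
lra.
Qed.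

Definition taylor (x y : R) (n : enat) : R :=
  epow y n - epow x n - depow x n * (y - x).

Lemma taylorS (x y : R) k : taylor x y (Some k.+1) =
  y * taylor x y (Some k) + depow x (Some k) * (y - x) ^+ 2.
Proof.
rewrite /taylor depowS /epow !exprS.
case: k => [|k] /=; first by rewrite !expr0; ring.
by rewrite !exprS; ring.
Qed.

Lemma taylor_ge0 (x y : R) n : 0 <= x -> x < 1 -> 0 <= y -> 0 <= taylor x y n.
Proof.
move=> x0 x1 y0; case: n => [k|]; last first.
  by rewrite /taylor /= (lt_eqF x1) mul0r !subr0 ler0n.
elim: k => [|k IH]; first by rewrite /taylor /= !expr0; lra.
by rewrite taylorS addr_ge0// mulr_ge0// ?sqr_ge0//; exact: depow_ge0.
Qed.

(** By [taylorS] the constant has to be stable under c -> q c + 1 / (1 - q), which gives (1 -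
    q)^-2. *)
Lemma taylor_le (x y q : R) n : 0 <= x -> x <= q -> 0 <= y -> y <= q -> q < 1 ->
  taylor x y n <= (1 - q) ^- 2 * (y - x) ^+ 2.
Proof.
move=> x0 xq y0 yq q1; have q1' : 0 < 1 - q by rewrite subr_gt0.
have K0 : 0 <= (1 - q) ^- 2 * (y - x) ^+ 2.
  by rewrite mulr_ge0 ?sqr_ge0// invr_ge0 sqr_ge0.
case: n => [k|]; last first.
  by rewrite /taylor /= (@lt_eqF _ _ x 1) ?(@lt_eqF _ _ y 1)//; lra.
elim: k => [|k IH]; first by rewrite {1}/taylor /= !expr0 subrr mulr0n !mul0r subr0.
rewrite taylorS.
have h1 : depow x (Some k) * (y - x) ^+ 2 <= (1 - q)^-1 * (y - x) ^+ 2.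
  by rewrite ler_wpM2r ?sqr_ge0//; exact: depow_le.
have h2 : y * taylor x y (Some k) <= q * ((1 - q) ^- 2 * (y - x) ^+ 2).
  by apply: ler_pM => //; apply: taylor_ge0; lra.
apply: (le_trans (lerD h2 h1)); rewrite -subr_ge0.
rewrite (_ : _ - _ = 0)//.
have : 1 - q != 0 by rewrite gt_eqF.
by move=> ?; field.
Qed.

Context d0 (S0 : measurableType d0) (P0 : probability S0 R) (N : {RV P0 >-> enat}).
Hypothesis N_gt0 : forall w, N w <> Some 0%N.

Local Notation H := (pgf N).

Definition dpgf (x : R) : R := Ex P0 (fun w => depow x (N w)).

Lemma bmf_depow (x : R) : 0 <= x -> x < 1 -> bmf (fun w => depow x (N w)).
Proof.
move=> x0 x1; split.
  by apply: (@measurableT_comp _ _ _ _ _ _ (depow x)) => //; exact: measurable_funPT.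
exists (1 - x)^-1 => w; rewrite ger0_norm; [exact: depow_le | exact: depow_ge0].
Qed.

Lemma bmf_epow (x : R) : 0 <= x <= 1 -> bmf (fun w => epow x (N w)).
Proof. by move=> x01; apply: u01_bmf; exact: u01_epow. Qed.

Lemma Ex_taylor (x y : R) : 0 <= x -> x < 1 -> 0 <= y <= 1 ->
  Ex P0 (fun w => taylor x y (N w)) = H y - H x - dpgf x * (y - x).
Proof.
move=> x0 x1 y01; rewrite !pgfE /dpgf mulrC.
have bx := bmf_epow (x := x); have by_ := bmf_epow y01; have bd := bmf_depow x0 x1.
have {}bx : bmf (fun w => epow x (N w)) by apply: bx; lra.
rewrite -ExZ// -!ExB//; try exact: bmfB; last by apply: bmfM => //; exact: bmf_cst.
by apply: eq_Ex => w; rewrite /taylor mulrC.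
Qed.

Lemma bmf_taylor (x y : R) : 0 <= x -> x < 1 -> 0 <= y <= 1 ->
  bmf (fun w => taylor x y (N w)).
Proof.
move=> x0 x1 y01; apply: bmfB; first by apply: bmfB; apply: bmf_epow => //; lra.
by apply: bmfM; [exact: bmf_depow | exact: bmf_cst].
Qed.

Lemma dpgf_ge0 (x : R) : 0 <= x -> x < 1 -> 0 <= dpgf x.
Proof. by move=> x0 x1; apply: Ex_ge0; [exact: bmf_depow | move=> w; exact: depow_ge0]. Qed.

Lemma dpgf_le (x q : R) : 0 <= x -> x <= q -> q < 1 -> dpgf x <= (1 - q)^-1.
Proof.
move=> x0 xq q1; apply: Ex_le_cst; first by apply: bmf_depow => //; lra.
by move=> w; exact: depow_le.
Qed.

Lemma pgf_tangent (x y : R) : 0 <= x -> x < 1 -> 0 <= y <= 1 ->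
  H x + dpgf x * (y - x) <= H y.
Proof.
move=> x0 x1 y01; rewrite -subr_ge0 opprD addrA -Ex_taylor//.
apply: Ex_ge0; first exact: bmf_taylor.
by move=> w; apply: taylor_ge0 => //; case/andP: y01.
Qed.

Lemma pgf_taylor (x y q : R) : 0 <= x -> x <= q -> 0 <= y -> y <= q -> q < 1 ->
  `|H y - H x - dpgf x * (y - x)| <= (1 - q) ^- 2 * (y - x) ^+ 2.
Proof.
move=> x0 xq y0 yq q1; have x1 : x < 1 by lra. have y01 : 0 <= y <= 1 by lra.
have bt := bmf_taylor x0 x1 y01.
rewrite -Ex_taylor// ger0_norm.
  by apply: Ex_le_cst => // w; exact: taylor_le.
by apply: Ex_ge0 => // w; exact: taylor_ge0.
Qed.

Lemma pgf01 (s : R) : 0 <= s <= 1 -> 0 <= H s <= 1.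
Proof. by move=> s01; rewrite pgfE; apply: Ex01; exact: u01_epow. Qed.

Lemma pgf0 : H 0 = 0.
Proof.
rewrite pgfE -[RHS](Ex_cst P0); apply: eq_Ex => w.
by have := N_gt0 (w := w); case: (N w) => [[|k]|] //= _; rewrite ?expr0n// eq_sym oner_eq0.
Qed.

Lemma pgf1 : H 1 = 1.
Proof.
rewrite pgfE -[RHS](Ex_cst P0); apply: eq_Ex => w.
by case: (N w) => [k|] /=; rewrite ?expr1n// eqxx.
Qed.

Lemma le_pgf (s t : R) : 0 <= s -> s <= t -> t <= 1 -> H s <= H t.
Proof.
move=> s0 st t1; have [s1|s1] := ltP s 1; last by rewrite (_ : s = t)//; lra.
have := @pgf_tangent s t s0 s1; have := dpgf_ge0 s0 s1.
by have := mulr_ge0 (dpgf_ge0 s0 s1) (_ : 0 <= t - s); lra.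
Qed.

(** The restriction to [0, 1] is invisible near an interior point. Below the midpoint [q] of [x] and
    1 the remainder of H is quadratic in [y - x], so it vanishes after division. *)
Lemma slope01_pgf (x : R) : 0 < x -> x < 1 -> slope01 H x = (dpgf x)%:E.
Proof.
move=> x0 x1; rewrite /slope01.
have A01 : \forall y \near x^', `[0, 1]%classic y.
  have : \forall y \near x, 0 < y < 1 by apply: near_in_itvoo; rewrite in_itv/= x0.
  by move/nbhs_dnbhs; apply: filterS => y /andP[? ?]; rewrite /= in_itv/= !ltW.
have -> : within `[0, 1]%classic (x^') = x^'.
  apply/seteqP; split=> B; rewrite /within /=.
    by move=> AB; apply: filterS2 A01 AB => y Ay; apply.
  by apply: filterS => y By _.
apply/cvg_lim => //; apply: cvg_EFin; first exact: nearW.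
pose q := (1 + x) / 2.
have q1 : q < 1 by rewrite /q; lra.
have xq : x < q by rewrite /q; lra.
apply/cvgrPdist_le => e e0.
have q1' : 0 < 1 - q by rewrite subr_gt0.
have K0 : 0 < (1 - q) ^- 2 by rewrite invr_gt0 exprn_gt0.
near=> y.
have yx : y != x by near: y; exact: nbhs_dnbhs_neq.
have y0 : 0 < y by near: y; apply: nbhs_dnbhs; exact: lt_nbhsr.
have yq : y < q by near: y; apply: nbhs_dnbhs; exact: lt_nbhsl.
have ye : `|y - x| <= e / (1 - q) ^- 2.
  near: y; apply: nbhs_dnbhs; apply: filterS (nbhsx_ballx x _ (divr_gt0 e0 K0)) => z.
  by rewrite /ball/= distrC => /ltW.
have yx0 : y - x != 0 by rewrite subr_eq0.
have := pgf_taylor (ltW x0) (ltW xq) (ltW y0) (ltW yq) q1.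
rewrite (_ : _ - _ - _ = - ((dpgf x - (H y - H x) / (y - x)) * (y - x))); last by field.
rewrite normrN normrM -(real_normK (num_real (y - x))) expr2 mulrA.
rewrite ler_pM2r ?normr_gt0//; move/le_trans; apply.
by rewrite mulrC -ler_pdivlMr.
Unshelve. all: by end_near. Qed.

End GeneratingFunction.

(** Decrements of at least [c] cannot go on forever above [eps], so the sequence enters the region
    below [eps], and it never leaves it. *)
Lemma eventually_below (R : realType) (e : nat -> R) (eps c : R) n0 : 0 < c ->
  (forall n, (n0 <= n)%N -> eps <= e n -> e n.+1 <= e n - c) ->
  (forall n, (n0 <= n)%N -> e n < eps -> e n.+1 < eps) ->
  \forall n \near \oo, e n < eps.
Proof.
move=> c0 dec stay.
have [n1 n01 en1] : exists2 n1, (n0 <= n1)%N & e n1 < eps.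
  apply: contrapT => H; have {}H n : (n0 <= n)%N -> eps <= e n.
    by move=> n0n; rewrite leNgt; apply/negP => ?; apply: H; exists n.
  have D k : e (n0 + k)%N <= e n0 - k%:R * c.
    elim: k => [|k IH]; first by rewrite addn0 mul0r subr0.
    rewrite addnS (le_trans (dec _ _ _))//; [exact: leq_addr | by apply: H; exact: leq_addr |].
    by rewrite -natr1; lra.
  pose k := (Num.truncn ((e n0 - eps) / c)).+1.
  have := H (n0 + k)%N (leq_addr _ _); rewrite leNgt => /negP; apply.
  apply: (le_lt_trans (D k)); rewrite ltrBlDr -ltrBlDl -ltr_pdivrMr//.
  exact: truncnS_gt.
exists n1 => // n /= n1n; rewrite -(subnKC n1n); elim: (n - n1)%N => [|k IH].
  by rewrite addn0.
by rewrite addnS; apply: stay => //; rewrite (leq_trans n01)// leq_addr.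
Qed.

Section StrictlyConvex.
Context (R : realType) d0 (S0 : measurableType d0) (P0 : probability S0 R).
Variable N : {RV P0 >-> enat}.
Hypothesis N_gt0 : forall w, N w <> Some 0%N.
Hypothesis convH : strictly_convex01 (pgf N).

Local Notation H := (pgf N).
Local Notation D := (dpgf N).

(** Strict convexity at the midpoint of 0 and [t], with H(0) = 0, gives 0 <= H(t/2) < H(t)/2. *)
Lemma pgf_gt0 (t : R) : 0 < t -> t <= 1 -> 0 < H t.
Proof.
move=> t0 t1; have := @convH t 0 (1 / 2).
rewrite mulr0 addr0 pgf0// mulr0 addr0 lexx ler01 => h.
have /andP[h0 _] : 0 <= H (1 / 2 * t) <= 1 by apply: pgf01; lra.
have : H (1 / 2 * t) < 1 / 2 * H t by apply: h => //; [lra| by rewrite gt_eqF | lra].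
lra.
Qed.

Lemma lt_pgf (s t : R) : 0 <= s -> s < t -> t <= 1 -> H s < H t.
Proof.
move=> s0 st t1; have t0 : 0 < t by lra.
have Ht := pgf_gt0 t0 t1.
have [s_gt0|] := ltP 0 s; last by move=> ?; rewrite (_ : s = 0) ?pgf0//; lra.
have := @convH t 0 (s / t); rewrite mulr0 addr0 pgf0// mulr0 addr0 divfK ?gt_eqF//.
have st1 : s / t < 1 by rewrite ltr_pdivrMr// mul1r.
have st0 : 0 < s / t by rewrite divr_gt0.
have : s / t * H t <= H t by rewrite ler_piMl// ltW.
move=> h1 h2; apply: lt_le_trans h1; apply: h2; rewrite ?st0 ?st1 ?lexx ?ler01 ?gt_eqF//.
by rewrite t1 ltW.
Qed.

(** The weak tangent bound at the midpoint of [x] and [y], combined with strict convexity there,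
    becomes a strict bound at [y]. *)
Lemma pgf_strict_tangent (x y : R) : 0 <= x -> x < 1 -> 0 <= y <= 1 -> y != x ->
  H x + D x * (y - x) < H y.
Proof.
move=> x0 x1 y01 yx.
have := @convH x y (1 / 2); have := pgf_tangent N x0 x1 (y := 1 / 2 * x + (1 - 1 / 2) * y).
have mid : 0 <= 1 / 2 * x + (1 - 1 / 2) * y <= 1 by lra.
move=> /(_ mid) h1 h2.
have {}h2 := h2 (_ : 0 <= x <= 1) y01 _ _.
have : H (1 / 2 * x + (1 - 1 / 2) * y) < 1 / 2 * H x + (1 - 1 / 2) * H y.
  by apply: h2; rewrite 1?eq_sym//; lra.
lra.
Qed.

Lemma dpgf_gt0 (x : R) : 0 < x -> x < 1 -> 0 < D x.
Proof.
move=> x0 x1; have := @pgf_strict_tangent x 0 (ltW x0) x1.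
rewrite pgf0// lexx ler01 (lt_eqF x0) => /(_ isT isT).
have := pgf_gt0 x0 (ltW x1); rewrite sub0r mulrN => h1 h2.
by rewrite -(pmulr_lgt0 _ x0); lra.
Qed.

Lemma continuous_pgf (x : R) : 0 < x -> x < 1 -> {for x, continuous H}.
Proof.
move=> x0 x1; pose q := (1 + x) / 2.
have q1 : q < 1 by rewrite /q; lra.
have xq : x < q by rewrite /q; lra.
have q1' : 0 < 1 - q by rewrite subr_gt0.
pose K := (1 - q)^-1 + (1 - q) ^- 2.
have K0 : 0 < K by rewrite addr_gt0// invr_gt0// exprn_gt0.
apply/cvgrPdist_le => e e0; near=> y.
have y0 : 0 < y by near: y; exact: lt_nbhsr.
have yq : y < q by near: y; exact: lt_nbhsl.
have ye : `|y - x| <= e / K.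
  near: y; apply: filterS (nbhsx_ballx x _ (divr_gt0 e0 K0)) => z.
  by rewrite /ball/= distrC => /ltW.
have y1 : `|y - x| <= 1 by rewrite ler_norml; lra.
have := pgf_taylor N (ltW x0) (ltW xq) (ltW y0) (ltW yq) q1.
have := dpgf_le N (ltW x0) (ltW xq) q1; have := dpgf_ge0 N (ltW x0) x1.
move=> D0 Dq T; rewrite distrC.
have : `|H y - H x| <= K * `|y - x|.
  rewrite (_ : H y - H x = (H y - H x - D x * (y - x)) + D x * (y - x)); last by ring.
  rewrite (le_trans (ler_normD _ _))// /K mulrDl addrC; apply: lerD.
    by rewrite normrM (ger0_norm D0) ler_wpM2r.
  apply: (le_trans T); rewrite ler_wpM2l ?invr_ge0 ?sqr_ge0//.
  by rewrite -(real_normK (num_real (y - x))) expr2 ler_piMl.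
move/le_trans; apply; rewrite mulrC -ler_pdivlMr//.
Unshelve. all: by end_near. Qed.

Lemma cvg_slope (x : R) (u : nat -> R) : 0 < x -> x < 1 -> u n @[n --> \oo] --> x ->
  (forall n, u n != x) -> (H (u n) - H x) / (u n - x) @[n --> \oo] --> D x.
Proof.
move=> x0 x1 ux une; pose q := (1 + x) / 2.
have q1 : q < 1 by rewrite /q; lra.
have xq : x < q by rewrite /q; lra.
have q1' : 0 < 1 - q by rewrite subr_gt0.
have K0 : 0 < (1 - q) ^- 2 by rewrite invr_gt0 exprn_gt0.
apply/cvgrPdist_le => e e0; near=> n.
have y0 : 0 < u n by near: n; exact: (cvgr_gt _ ux).
have yq : u n < q by near: n; exact: (cvgr_lt _ ux).
have ye : `|u n - x| <= e / (1 - q) ^- 2.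
  rewrite distrC; near: n; move/cvgrPdist_le : ux; apply; exact: divr_gt0.
have yx0 : u n - x != 0 by rewrite subr_eq0.
have := pgf_taylor N (ltW x0) (ltW xq) (ltW y0) (ltW yq) q1.
rewrite (_ : _ - _ - _ = - ((D x - (H (u n) - H x) / (u n - x)) * (u n - x))); last by field.
rewrite normrN normrM -(real_normK (num_real (u n - x))) expr2 mulrA.
rewrite ler_pM2r ?normr_gt0//; move/le_trans; apply.
by rewrite mulrC -ler_pdivlMr.
Unshelve. all: by end_near. Qed.

End StrictlyConvex.

(** * Iteration of first and second moments *)

Section Dichotomy.
Context (R : realType) d0 (S0 : measurableType d0) (P0 : probability S0 R).
Variable N : {RV P0 >-> enat}.
Hypothesis N_gt0 : forall w, N w <> Some 0%N.
Hypothesis convH : strictly_convex01 (pgf N).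

Local Notation H := (pgf N).
Local Notation D := (dpgf N).

Variables a b : R.
Hypothesis a01 : 0 < a < 1.
Hypothesis Ha : H a = 1 - b.
Hypothesis Hb : H b = 1 - a.

Let a0 : 0 < a. Proof. by case/andP: a01. Qed.
Let a1 : a < 1. Proof. by case/andP: a01. Qed.

Lemma b01 : 0 < b < 1.
Proof.
have := pgf_gt0 N_gt0 convH a0 (ltW a1); have := lt_pgf N_gt0 convH (ltW a0) a1 (lexx 1).
by rewrite pgf1 Ha; lra.
Qed.

Let b0 : 0 < b. Proof. by case/andP: b01. Qed.
Let b1 : b < 1. Proof. by case/andP: b01. Qed.

Lemma cvg_pgf (u : nat -> R) (x : R) : 0 < x -> x < 1 -> u n @[n --> \oo] --> x ->
  H (u n) @[n --> \oo] --> H x.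
Proof.
move=> x0 x1 ux.
exact: (cvg_comp _ _ ux (continuous_pgf (N := N) x0 x1)).
Qed.

(** Here [t] stands for E[X_n Y_n] of a coupled pair with means [m] and [m']. The tangent at b
    bounds the second of two steps, so the new value of the deficit e = a - t is at most D(b) (H(a)
    - H(a - e)) plus an error due to the means. As D(a) D(b) <= 1, strict concavity puts that map
    strictly below the identity, and [eventually_below] applies. On the other side [t <= m] bounds
    the deficit. *)
Lemma second_moment_attracts (m m' t : nat -> R) : D a * D b <= 1 ->
  (forall n, 0 <= t n <= 1) ->
  (forall n, 0 <= m n <= 1) -> (forall n, 0 <= m' n <= 1) ->
  (forall n, t n <= m n) ->
  (forall n, m n.+1 = 1 - H (m n)) -> (forall n, m' n.+1 = 1 - H (m' n)) ->
  (forall n, t n.+1 = 1 - H (m n) - H (m' n) + H (t n)) ->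
  m n.*2 @[n --> \oo] --> a -> m' n.*2 @[n --> \oo] --> a ->
  t n.*2 @[n --> \oo] --> a.
Proof.
move=> DD t01 m01 m'01 tm mS m'S tS ma m'a.
move: (a0) (a1) (b0) (b1) => pa0 pa1 pb0 pb1.
have mb : m n.*2.+1 @[n --> \oo] --> b.
  under eq_cvg do rewrite mS; rewrite (_ : b = 1 - H a); last by rewrite Ha; ring.
  by apply: cvgB; [exact: cvg_cst | exact: cvg_pgf].
have m'b : m' n.*2.+1 @[n --> \oo] --> b.
  under eq_cvg do rewrite m'S; rewrite (_ : b = 1 - H a); last by rewrite Ha; ring.
  by apply: cvgB; [exact: cvg_cst | exact: cvg_pgf].
have cDb : 0 < D b by exact: dpgf_gt0.
(* The error from means that have not reached a and b yet; it tends to 0. *)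
pose sg n := D b * (2 * H a - H (m n.*2) - H (m' n.*2)) +
             (2 * H b - H (m n.*2.+1) - H (m' n.*2.+1)).
have sg0 : sg n @[n --> \oo] --> 0.
  rewrite (_ : 0 = D b * (2 * H a - H a - H a) + (2 * H b - H b - H b)); last by ring.
  apply: cvgD; first apply: cvgMr.
    by apply: cvgB; [apply: cvgB; [exact: cvg_cst|]|]; exact: cvg_pgf.
  by apply: cvgB; [apply: cvgB; [exact: cvg_cst|]|]; exact: cvg_pgf.
pose e n := a - t n.*2.
have eS n : e n.+1 <= D b * (H a - H (a - e n)) - sg n.
  rewrite /e doubleS /sg subKr.
  have := pgf_tangent N (ltW b0) b1 (t01 n.*2.+1).
  rewrite (tS n.*2.+1) (tS n.*2) => h.
  have E1 : 1 - H (m n.*2) - H (m' n.*2) + H (t n.*2) - b =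
    (2 * H a - H (m n.*2) - H (m' n.*2)) - (H a - H (t n.*2)) by rewrite Ha; ring.
  rewrite E1 mulrBr in h; rewrite Hb in h *; lra.
apply/cvgrPdist_lt => eps0 eps0_gt0.
(* The tolerance is reduced to at most a, so that [a - eps] stays in [0, 1]. *)
have [eps [eps_gt0 eps_a eps_eps0]] : exists eps, [/\ 0 < eps, eps <= a & eps <= eps0].
  exists (Num.min eps0 a); split; first by rewrite lt_min eps0_gt0.
    by rewrite ge_min lexx orbT.
  by rewrite ge_min lexx.
pose phi (x : R) := H a - H (a - x).
(* Strict even when the slope is exactly 1, as H lies strictly above its tangent at a. *)
have phi_eps : D b * phi eps < eps.
  have := @pgf_strict_tangent _ _ _ _ N convH a (a - eps) (ltW a0) a1.
  rewrite (_ : a - eps - a = - eps); last by ring.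
  move=> h; have {}h : H a + D a * - eps < H (a - eps).
    by apply: h; rewrite ?lt_eqF//; lra.
  have h2 : phi eps < D a * eps by rewrite /phi; lra.
  have h3 : D b * phi eps < D b * (D a * eps) by rewrite ltr_pM2l.
  have h4 : D b * (D a * eps) <= eps by rewrite mulrA ler_piMl 1?mulrC// ltW.
  exact: lt_le_trans h4.
pose c := eps - D b * phi eps.
have c_gt0 : 0 < c by rewrite subr_gt0.
(* Half of the gap [c] absorbs the error [sg], the other half is left as decrement. *)
have c2 : 0 < c / 2 by rewrite divr_gt0.
have /cvgrPdist_lt /(_ _ c2) [n0 _ sgn] := sg0.
have ea n : e n <= a by rewrite /e; have := t01 n.*2; lra.
have below : \forall n \near \oo, e n < eps.
  have sgc n : (n0 <= n)%N -> - (c / 2) < sg n.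
    by move=> n0n; have := sgn n n0n; rewrite sub0r normrN ltr_norml => /andP[].
  apply: (@eventually_below _ e eps (c / 2) n0) => // n /sgc sg1 en.
    apply: le_trans (eS n) _; rewrite -/(phi (e n)).
    have e0 : 0 < e n by exact: lt_le_trans en.
    (* [phi x / x] decreases, as [phi] is concave and vanishes at 0; so beyond [eps] the gap grows
       at least in proportion to [e n]. *)
    have conc : eps / e n * phi (e n) <= phi eps.
      have [ene|ene] := eqVneq eps (e n); first by rewrite -ene divff ?mul1r// gt_eqF.
      have := @convH (a - e n) a (eps / e n).
      have te : eps / e n < 1 by rewrite ltr_pdivrMr// mul1r lt_neqAle ene.
      have te0 : 0 < eps / e n by rewrite divr_gt0.
      have -> : eps / e n * (a - e n) + (1 - eps / e n) * a = a - eps.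
        by field; rewrite gt_eqF.
      have aea : a - e n != a by rewrite lt_eqF//; lra.
      have := ea n; have := t01 n.*2 => t01n ean h.
      have {}h : H (a - eps) < eps / e n * H (a - e n) + (1 - eps / e n) * H a.
        by apply: h => //; rewrite ?te0 ?te//; lra.
      by rewrite /phi; lra.
    have conc2 : D b * phi (e n) <= (e n / eps) * (D b * phi eps).
      rewrite mulrCA ler_pM2l// -ler_pdivrMl ?divr_gt0//.
      by rewrite invf_div.
    have r1 : 1 <= e n / eps by rewrite ler_pdivlMr// mul1r.
    have h1 : c <= (e n / eps) * c by rewrite ler_peMl// ltW.
    have h2 : (e n / eps) * eps = e n by rewrite divfK// gt_eqF.
    by rewrite {2}/c mulrBr in h1; lra.
  apply: le_lt_trans (eS n) _; rewrite -/(phi (e n)).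
  have mono : H (a - eps) <= H (a - e n).
    apply: le_pgf; [lra|lra|]; rewrite /e subKr.
    by have := t01 n.*2; lra.
  have : D b * phi (e n) <= D b * phi eps by rewrite ler_pM2l// /phi; lra.
  by rewrite /c in sg1 c2 *; lra.
have above : \forall n \near \oo, m n.*2 < a + eps0.
  by apply: (cvgr_lt _ ma); lra.
near=> n; have : e n < eps by near: n.
have : m n.*2 < a + eps0 by near: n.
by have := tm n.*2; rewrite /e ltr_norml; lra.
Unshelve. all: by end_near. Qed.

End Dichotomy.

(** * Slope greater than one: repelled means and merging deficits *)

Section Supercritical.
Context (R : realType) d0 (S0 : measurableType d0) (P0 : probability S0 R).
Variable N : {RV P0 >-> enat}.
Hypothesis N_gt0 : forall w, N w <> Some 0%N.
Hypothesis convH : strictly_convex01 (pgf N).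

Local Notation H := (pgf N).
Local Notation D := (dpgf N).

(* With c the mean of X, x = c - E[X ^ 2] is sent by T to [drop_pgf c x]. *)
Definition drop_pgf (c x : R) : R := H c - H (c - x).

Lemma drop_pgf_gt0 (c x : R) : c <= 1 -> 0 < x -> x <= c -> 0 < drop_pgf c x.
Proof.
by move=> c1 x0 xc; rewrite /drop_pgf subr_gt0; apply: lt_pgf => //; lra.
Qed.

Lemma lt_drop_pgf (c x y : R) : c <= 1 -> 0 <= x -> x < y -> y <= c ->
  drop_pgf c x < drop_pgf c y.
Proof.
move=> c1 x0 xy yc; rewrite /drop_pgf ltrD2l ltrN2.
by apply: lt_pgf => //; lra.
Qed.

Lemma le_drop_pgf (c x y : R) : c <= 1 -> 0 <= x -> x <= y -> y <= c ->
  drop_pgf c x <= drop_pgf c y.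
Proof.
move=> c1 x0; rewrite [x <= y]le_eqVlt => /predU1P[->//|xy yc].
by apply/ltW/lt_drop_pgf.
Qed.

Lemma drop_pgf_concave (c s x : R) : c <= 1 -> 0 < s -> s < 1 -> 0 < x -> x <= c ->
  s * drop_pgf c x < drop_pgf c (s * x).
Proof.
move=> c1 s0 s1 x0 xc; have := @convH (c - x) c s.
rewrite (_ : s * (c - x) + (1 - s) * c = c - s * x); last by ring.
move=> h; have {}h : H (c - s * x) < s * H (c - x) + (1 - s) * H c.
  apply: h; [lra|lra|by rewrite lt_eqF//; lra|lra].
by rewrite /drop_pgf; lra.
Qed.

Lemma cvg_drop_pgf (c z : R) (u : nat -> R) : c < 1 -> 0 <= z -> z < c ->
  u n @[n --> \oo] --> z -> drop_pgf c (u n) @[n --> \oo] --> drop_pgf c z.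
Proof.
move=> c1 z0 zc uz; apply: cvgB; first exact: cvg_cst.
by apply: cvg_pgf; [lra | lra | apply: cvgB => //; exact: cvg_cst].
Qed.

Variables a b : R.
Hypothesis a01 : 0 < a < 1.
Hypothesis Ha : H a = 1 - b.
Hypothesis Hb : H b = 1 - a.
Hypothesis DD : 1 < D a * D b.

(** Two steps multiply a displacement by a product of two secant slopes. This estimate serves for
    the means, and again to keep the limit of the deficits away from 0. *)
Lemma slopes_gt1 (u v : nat -> R) : u n @[n --> \oo] --> a -> (forall n, u n != a) ->
  v n @[n --> \oo] --> b -> (forall n, v n != b) ->
  \forall n \near \oo, 1 < (H (u n) - H a) / (u n - a) * ((H (v n) - H b) / (v n - b)).
Proof.
move=> ua una vb vnb; have /andP[b0 b1] := b01 N_gt0 convH a01 Ha.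
have /andP[a0 a1] := a01.
have c : (H (u n) - H a) / (u n - a) * ((H (v n) - H b) / (v n - b)) @[n --> \oo] --> D a * D b.
  by apply: cvgM; exact: cvg_slope.
exact: (cvgr_gt _ c).
Qed.

(** Injectivity of H propagates [m 0 != a] to all later terms, so that the secant slopes are
    meaningful. Once their product exceeds 1, the distance to a can no longer decrease, which
    contradicts convergence. *)
Lemma mean_repels (m : nat -> R) : (forall n, 0 <= m n <= 1) ->
  (forall n, m n.+1 = 1 - H (m n)) -> m n.*2 @[n --> \oo] --> a -> m 0 = a.
Proof.
move=> m01 mS ma; have /andP[b0 b1] := b01 N_gt0 convH a01 Ha.
have /andP[a0 a1] := a01.
have inj x c : 0 <= x <= 1 -> 0 <= c <= 1 -> x != c -> H x != H c.
  move=> /andP[x0 x1] /andP[c0 c1]; rewrite neq_lt => /orP[xc|cx].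
    by rewrite lt_eqF//; exact: lt_pgf.
  by rewrite gt_eqF//; exact: lt_pgf.
apply/eqP; apply: contraT => m0a.
have mna n : (m n.*2 != a) && (m n.*2.+1 != b).
  have odd k : m k.*2 != a -> m k.*2.+1 != b.
    move=> h; rewrite mS; have := inj _ a (m01 k.*2) _ h; rewrite Ha => h'.
    by apply: contra (h' _) => [/eqP <-|]; [apply/eqP; ring | lra].
  elim: n => [|n /andP[_ IH]]; first by rewrite m0a odd.
  suff h : m n.+1.*2 != a by rewrite h odd.
  rewrite doubleS mS; have := inj _ b (m01 n.*2.+1) _ IH; rewrite Hb => h'.
  by apply: contra (h' _) => [/eqP <-|]; [apply/eqP; ring | lra].
have mb : m n.*2.+1 @[n --> \oo] --> b.
  under eq_cvg do rewrite mS; rewrite (_ : b = 1 - H a); last by rewrite Ha; ring.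
  by apply: cvgB; [exact: cvg_cst | exact: cvg_pgf].
have [n0 _ far] := slopes_gt1 ma (fun n => (andP (mna n)).1) mb (fun n => (andP (mna n)).2).
have grow n : (n0 <= n)%N -> `|m n.*2 - a| <= `|m n.+1.*2 - a|.
  move=> /far; rewrite doubleS (mS n.*2.+1) => r1.
  have /andP[una vnb] := mna n.
  have u0 : m n.*2 - a != 0 by rewrite subr_eq0.
  have v0 : m n.*2.+1 - b != 0 by rewrite subr_eq0.
  have e1 : H (m n.*2) - H a = - (m n.*2.+1 - b) by rewrite mS Ha; ring.
  have e2 : 1 - H (m n.*2.+1) - a = - (H (m n.*2.+1) - H b) by rewrite Hb; ring.
  have r2 : 1 < - ((H (m n.*2.+1) - H b) / (m n.*2 - a)).
    move: r1; rewrite e1.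
    by rewrite (_ : - _ / _ * _ = - ((H (m n.*2.+1) - H b) / (m n.*2 - a)))//; field; rewrite u0.
  have := le_trans (ltW r2) (ler_norm _); rewrite normrN normrM normfV.
  by rewrite ler_pdivlMr ?normr_gt0// mul1r e2 normrN.
have d0' : 0 < `|m n0.*2 - a| by rewrite normr_gt0 subr_eq0; have /andP[] := mna n0.
have far2 k : `|m n0.*2 - a| <= `|m (n0 + k).*2 - a|.
  elim: k => [|k IH]; first by rewrite addn0.
  by rewrite addnS; apply: (le_trans IH); apply: grow; exact: leq_addr.
have /cvgrPdist_lt /(_ _ d0') [n1 _ near1] := ma.
have := near1 (n0 + n1)%N (leq_addl _ _).
by rewrite distrC ltNge far2.
Qed.

Section Deficits.
Variable x : nat -> R.
Hypothesis x0a : forall n, 0 <= x n.*2 <= a.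
Hypothesis x0b : forall n, 0 <= x n.*2.+1 <= b.
Hypothesis xodd : forall n, x n.*2.+1 = drop_pgf a (x n.*2).
Hypothesis xeven : forall n, x n.+1.*2 = drop_pgf b (x n.*2.+1).

Lemma deficit_gt0 n : 0 < x 0 -> 0 < x n.*2 /\ 0 < x n.*2.+1.
Proof.
have /andP[b0 b1] := b01 N_gt0 convH a01 Ha; have /andP[a0 a1] := a01.
have odd k : 0 < x k.*2 -> 0 < x k.*2.+1.
  by move=> xk; rewrite xodd; apply: drop_pgf_gt0 => //; [lra | case/andP: (x0a k)].
move=> x00; suff : 0 < x n.*2 by move=> h; split=> //; exact: odd.
elim: n => // n /odd IH; rewrite xeven; apply: drop_pgf_gt0 => //; first lra.
by case/andP: (x0b n).
Qed.

(** The strict inequalities at the first two terms keep both limits below a and b, so the arguments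
    of H stay in ]0, 1[, where it is continuous and the recursion passes to the limit. *)
Lemma cvg_deficit (z : R) : x 0 < a -> x 1%N < b ->
  (forall n, x n.*2 <= x 0) -> (forall n, x n.*2.+1 <= x 1%N) ->
  x n.*2 @[n --> \oo] --> z ->
  [/\ 0 <= z, z < a, 0 <= drop_pgf a z, drop_pgf a z < b & z = drop_pgf b (drop_pgf a z)].
Proof.
have /andP[b0 b1] := b01 N_gt0 convH a01 Ha; have /andP[a0 a1] := a01.
move=> xa xb xe xo xz.
have z0 : 0 <= z by apply: (cvgr_to_ge xz); apply: nearW => n; case/andP: (x0a n).
have za : z < a.
  by apply: le_lt_trans xa; apply: (cvgr_to_le xz); exact: nearW.
have xw : x n.*2.+1 @[n --> \oo] --> drop_pgf a z.
  by under eq_cvg do rewrite xodd; exact: cvg_drop_pgf.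
have w0 : 0 <= drop_pgf a z.
  by apply: (cvgr_to_ge xw); apply: nearW => n; case/andP: (x0b n).
have wb : drop_pgf a z < b.
  by apply: le_lt_trans xb; apply: (cvgr_to_le xw); exact: nearW.
split=> //; have := cvg_drop_pgf b1 w0 wb xw.
under eq_cvg do rewrite -xeven.
have xz' : x n.+1.*2 @[n --> \oo] --> z by move: xz; rewrite -cvg_shiftS.
by move=> h; exact: (cvg_unique _ xz' h).
Qed.

End Deficits.

(** [y] is meant for the deficits of the point mass at a, which start as large as possible: they
    decrease and dominate [x]. Their limit is positive because near 0 two steps would enlarge them.
    Concavity makes the ratio x / y increase, and a limit ratio below 1 would yield two distinct
    positive fixed points of a strictly concave map vanishing at 0. *)
Lemma deficits_merge (x y : nat -> R) :
  (forall n, 0 <= x n.*2 <= a) -> (forall n, 0 <= x n.*2.+1 <= b) ->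
  (forall n, 0 <= y n.*2 <= a) -> (forall n, 0 <= y n.*2.+1 <= b) ->
  (forall n, x n.*2.+1 = drop_pgf a (x n.*2)) ->
  (forall n, x n.+1.*2 = drop_pgf b (x n.*2.+1)) ->
  (forall n, y n.*2.+1 = drop_pgf a (y n.*2)) ->
  (forall n, y n.+1.*2 = drop_pgf b (y n.*2.+1)) ->
  0 < x 0 -> x 0 <= y 0 -> y 2%N <= y 0 -> y 0 < a -> y 1%N < b ->
  (exists2 l : R, 0 < l & y n.*2 @[n --> \oo] --> l) /\
  x n.*2 - y n.*2 @[n --> \oo] --> 0.
Proof.
move=> x0a x0b y0a y0b xo xe yo ye x00 xy0 y20 y0_a y1_b.
have /andP[b0 b1] := b01 N_gt0 convH a01 Ha; have /andP[a0 a1] := a01.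
have xpos n := deficit_gt0 x0a x0b xo xe n x00.
have ypos n := deficit_gt0 y0a y0b yo ye n (lt_le_trans x00 xy0).
have ydec n : y n.+1.*2 <= y n.*2.
  elim: n => [//|n IH]; rewrite (ye n.+1) (ye n); apply: le_drop_pgf; [lra | | | ].
  - by apply/ltW; have [] := ypos n.+1.
  - rewrite !yo; apply: le_drop_pgf => //; [lra | by apply/ltW; have [] := ypos n.+1 |].
    by case/andP: (y0a n).
  - by case/andP: (y0b n).
have yle n : y n.*2 <= y 0 by elim: n => [//|n IH]; exact: le_trans (ydec n) IH.
have yo0 : y 1%N = drop_pgf a (y 0) := yo 0%N.
have y1le n : y n.*2.+1 <= y 1%N.
  rewrite yo yo0; apply: le_drop_pgf => //; [lra | by case/andP: (y0a n) | lra].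
have xley n : x n.*2 <= y n.*2 /\ x n.*2.+1 <= y n.*2.+1.
  have odd k : x k.*2 <= y k.*2 -> x k.*2.+1 <= y k.*2.+1.
    move=> h; rewrite xo yo; apply: le_drop_pgf => //; [lra | |].
      by case/andP: (x0a k).
    by case/andP: (y0a k).
  suff : x n.*2 <= y n.*2 by move=> h; split=> //; exact: odd.
  elim: n => // n /odd IH; rewrite xe ye; apply: le_drop_pgf => //; first lra.
    by case/andP: (x0b n).
  by case/andP: (y0b n).
have [yl ycv] : exists l : R, y n.*2 @[n --> \oo] --> l.
  exists (inf (range (fun n => y n.*2))).
  apply: nonincreasing_cvgn; first exact/nonincreasing_seqP.
  by exists 0 => _ [n _ <-]; case/andP: (y0a n).
have [yl0 yla pl0 plb yfix] := cvg_deficit y0a y0b yo ye y0_a y1_b yle y1le ycv.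
have ylpos : 0 < yl.
  rewrite lt_neqAle yl0 andbT; apply/negP => /eqP yl_eq0.
  have ua : a - y n.*2 @[n --> \oo] --> a.
    by rewrite -[X in _ --> X]subr0 yl_eq0; apply: cvgB => //; exact: cvg_cst.
  have yw : y n.*2.+1 @[n --> \oo] --> 0.
    rewrite (_ : 0 = drop_pgf a yl); last by rewrite -yl_eq0 /drop_pgf subr0 subrr.
    by under eq_cvg do rewrite yo; exact: cvg_drop_pgf.
  have vb : b - y n.*2.+1 @[n --> \oo] --> b.
    by rewrite -[X in _ --> X]subr0; apply: cvgB => //; exact: cvg_cst.
  have una n : a - y n.*2 != a by rewrite lt_eqF//; have [] := ypos n; lra.
  have vnb n : b - y n.*2.+1 != b by rewrite lt_eqF//; have [] := ypos n; lra.
  have [n _ /(_ n (leqnn n))] := slopes_gt1 ua una vb vnb.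
  have [p0 p1] := ypos n.
  (* The two secant slopes telescope to the two-step growth ratio, which [ydec] bounds by 1. *)
  rewrite (_ : _ * _ = y n.+1.*2 / y n.*2).
    by rewrite ltr_pdivlMr// mul1r ltNge ydec.
  have e1 : H (a - y n.*2) = H a - y n.*2.+1 by rewrite yo /drop_pgf; ring.
  have e2 : H (b - y n.*2.+1) = H b - y n.+1.*2 by rewrite ye /drop_pgf; ring.
  rewrite e1 e2.
  have -> : H a - y n.*2.+1 - H a = - y n.*2.+1 by ring.
  have -> : H b - y n.+1.*2 - H b = - y n.+1.*2 by ring.
  have -> : a - y n.*2 - a = - y n.*2 by ring.
  have -> : b - y n.*2.+1 - b = - y n.*2.+1 by ring.
  by field; rewrite !gt_eqF.
split; first by exists yl.
pose r n := x n.*2 / y n.*2.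
have r1 n : r n <= 1 by rewrite ler_pdivrMr ?mul1r; have [] := xley n; have [] := ypos n.
have r0 n : 0 < r n by rewrite divr_gt0//; [have [] := xpos n | have [] := ypos n].
have xr n : x n.*2 = r n * y n.*2 by rewrite divfK// gt_eqF//; have [] := ypos n.
have concave (c s z : R) : c <= 1 -> 0 < s -> s <= 1 -> 0 < z -> z <= c ->
    s * drop_pgf c z <= drop_pgf c (s * z).
  move=> c1 s0 s1 z0 zc; have [->|s_neq1] := eqVneq s 1; first by rewrite !mul1r.
  by apply/ltW/drop_pgf_concave => //; rewrite lt_neqAle s_neq1.
have rinc n : r n <= r n.+1.
  have [ye0 yo0'] := ypos n; have [ye1 _] := ypos n.+1.
  rewrite {2}/r ler_pdivlMr// xe ye.
  have le1 : r n * y n.*2.+1 <= x n.*2.+1.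
    rewrite xo yo (xr n); apply: concave => //; first lra.
    by case/andP: (y0a n).
  apply: (@le_trans _ _ (drop_pgf b (r n * y n.*2.+1))).
    by apply: concave => //; [lra | case/andP: (y0b n)].
  apply: le_drop_pgf => //; [lra | by apply: mulr_ge0; exact: ltW |].
  by case/andP: (x0b n).
have [rl rcv] : exists l : R, r n @[n --> \oo] --> l.
  exists (sup (range r)); apply: nondecreasing_cvgn; first exact/nondecreasing_seqP.
  by exists 1 => _ [n _ <-].
have rl0 : 0 < rl.
  apply: (lt_le_trans (r0 0%N)); apply: (cvgr_to_ge rcv); apply: nearW => n.
  by elim: n => // n IH; exact: le_trans (rinc n).
have rl1 : rl <= 1 by apply: (cvgr_to_le rcv); exact: nearW.
have xcv : x n.*2 @[n --> \oo] --> rl * yl.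
  by under eq_cvg do rewrite xr; exact: cvgM.
have rlE : rl = 1.
  apply/eqP; rewrite eq_le rl1/= leNgt; apply/negP => rl_lt1.
  have zle : rl * yl <= yl by rewrite ler_piMl.
  have z0 : 0 <= rl * yl by rewrite mulr_ge0// ltW.
  have xw : x n.*2.+1 @[n --> \oo] --> drop_pgf a (rl * yl).
    by under eq_cvg do rewrite xo; apply: cvg_drop_pgf => //; lra.
  have w1 : drop_pgf a (rl * yl) <= drop_pgf a yl by apply: le_drop_pgf => //; lra.
  have w0 : 0 <= drop_pgf a (rl * yl).
    by apply: (cvgr_to_ge xw); apply: nearW => n; case/andP: (x0b n).
  have xz' : x n.+1.*2 @[n --> \oo] --> rl * yl by move: xcv; rewrite -cvg_shiftS.
  have xz : x n.+1.*2 @[n --> \oo] --> drop_pgf b (drop_pgf a (rl * yl)).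
    by under eq_cvg do rewrite xe; apply: cvg_drop_pgf => //; lra.
  have fixz : rl * yl = drop_pgf b (drop_pgf a (rl * yl)) by exact: (cvg_unique _ xz' xz).
  have pl_gt0 : 0 < drop_pgf a yl by apply: drop_pgf_gt0 => //; lra.
  (* Strictness at one of the two half-steps suffices to exclude that [yl] and [rl * yl] are both
     fixed. *)
  have s1 : rl * drop_pgf a yl < drop_pgf a (rl * yl) by apply: drop_pgf_concave => //; lra.
  have s2 : rl * drop_pgf b (drop_pgf a yl) <= drop_pgf b (rl * drop_pgf a yl).
    by apply: concave => //; lra.
  have s3 : drop_pgf b (rl * drop_pgf a yl) < drop_pgf b (drop_pgf a (rl * yl)).
    by apply: lt_drop_pgf => //; [lra | by rewrite mulr_ge0// ltW | lra].
  by have := le_lt_trans s2 s3; rewrite -yfix -fixz ltxx.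
rewrite rlE mul1r in xcv.
by rewrite -(subrr yl); exact: cvgB.
Qed.

End Supercritical.

(** * The tree-indexed solution *)

Section Tree.
Context d0 (S0 : measurableType d0) d (Om : measurableType d) (R : realType).
Variables (P0 : probability S0 R) (N : {RV P0 >-> enat}) (P : probability Om R).
Variable Nu : seq nat -> {RV P >-> enat}.
Hypothesis iidNu : iid_copies N Nu.

(** Runs [s] steps of the recursion of T from the values of [X] at depth [size v + s] up to [v]. The
    steps are single, so that one induction covers odd depths too; two of them make the iterated
    equation. *)
Fixpoint tval (X : seq nat -> Om -> R) (s : nat) (v : seq nat) (w : Om) : R :=
  if s is s'.+1 then 1 - eprod (Nu v w) (fun i => tval X s' (rcons v i) w) else X v w.

Lemma u01_tval X s v : (forall u, size u = (size v + s)%N -> u01 (X u)) -> u01 (tval X s v).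
Proof.
elim: s v => [|s IH] v uX /=; first by apply: uX; rewrite addn0.
apply: u01_onem; apply: u01_eprod => // i; apply: IH => u us; apply: uX.
by rewrite us size_rcons addSnnS.
Qed.

Lemma Ex_prod_Nu (U : seq (seq nat)) (B : seq nat -> set enat) : uniq U ->
  Ex P (fun w => \prod_(u <- U) \1_(B u) (Nu u w)) =
  \prod_(u <- U) Ex P0 (fun w => \1_(B u) (N w)).
Proof.
move=> uU; have [lawNu indNu] := iidNu.
have mB u : measurable (Nu u @^-1` B u) by exact: measurable_preimage (measurable_funPT _) _.
have mB0 u : measurable (N @^-1` B u) by exact: measurable_preimage (measurable_funPT _) _.
apply: EFin_inj; rewrite -prodEFin.
transitivity (Ex P (fun w => \1_setT w * \prod_(u <- U) \1_(Nu u @^-1` B u) w))%:E.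
  by congr EFin; apply: eq_Ex => w; rewrite indicT mul1r.
rewrite Ex_prod_indic// setTI indNu//; apply: eq_bigr => u _.
by rewrite lawNu// -(Ex_indic P0 (mB0 u)).
Qed.

Variable mu : R.
Hypothesis mu01 : 0 <= mu <= 1.

(* Its law is T^s(delta_mu); for [v] and [s] even it is the conditional expectation
   of the solution at [v] given the [N_u] of the [s] generations from [v] on. *)
Definition cval : nat -> seq nat -> Om -> R := tval (fun _ _ => mu).
Definition cmom (s : nat) : nat -> R := iter s (mommap N) (fun k => mu ^+ k).

Lemma u01_cval s v : u01 (cval s v).
Proof. by apply: u01_tval => u _; exact: u01_cst. Qed.

Lemma bmf_Nu (B : set enat) u : bmf (fun w => \1_B (Nu u w) : R).
Proof. exact: bmf_indic_comp. Qed.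

(* The product over [U] keeps track of the generations above [l] in the induction
   on [s]. *)
Definition cval_factors (s : nat) : Prop :=
  forall l (U : seq (seq nat)) (B : seq nat -> set enat) (V : seq (seq nat * nat)),
  uniq U -> uniq (map fst V) ->
  (forall u, u \in U -> (size u < l)%N) -> (forall p, p \in V -> size p.1 = l) ->
  Ex P (fun w => \prod_(u <- U) \1_(B u) (Nu u w) * \prod_(p <- V) cval s p.1 w ^+ p.2) =
  \prod_(u <- U) Ex P0 (fun w => \1_(B u) (N w)) * \prod_(p <- V) cmom s p.2.

Lemma cval_factors_mom s k : cval_factors s -> Ex P (fun w => cval s [::] w ^+ k) = cmom s k.
Proof.
move=> /(_ 0%N [::] (fun=> setT) [:: ([::], k)]) H; transitivity (
  Ex P (fun w => \prod_(u <- [::]) \1_setT (Nu u w) * \prod_(p <- [:: ([::] : seq nat, k)]) cval s p.1 w ^+ p.2)).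
  by apply: eq_Ex => w; rewrite big_nil big_seq1 mul1r.
rewrite H//; first by rewrite big_nil big_seq1 mul1r.
by move=> p; rewrite inE => /eqP ->.
Qed.

(** The factors at level [l] are opened in turn. Expanding (1 - Q)^k leaves powers of the product Q
    over the daughters; truncating that product moves a constraint on [Nu v] into [U] and powers of
    the daughters to level [l.+1]. Distinct vertices keep the factors independent. *)
Lemma cval_factorsS s : cval_factors s -> cval_factors s.+1.
Proof.
move=> IH.
have bc s' (V : seq (seq nat * nat)) : bmf (fun w => \prod_(p <- V) cval s' p.1 w ^+ p.2).
  by apply: bmf_prod => p; apply: bmfX; apply: u01_bmf; exact: u01_cval.
have bU (U : seq (seq nat)) (B : seq nat -> set enat) :
    bmf (fun w => \prod_(u <- U) \1_(B u) (Nu u w) : R).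
  by apply: bmf_prod => u; exact: bmf_Nu.
have cm01 j : 0 <= cmom s j <= 1.
  by rewrite -cval_factors_mom//; apply: Ex01; apply: u01X; exact: u01_cval.
(* [V] holds the vertices still to be opened and [W] the daughters already exposed; [W] contains no
   daughter of a vertex in [V], so that no vertex ever occurs twice. *)
suff gen l (V W : seq (seq nat * nat)) (U : seq (seq nat)) (B : seq nat -> set enat) :
    uniq U -> uniq (map fst V) -> uniq (map fst W) ->
    (forall u, u \in U -> (size u <= l)%N) ->
    (forall p, p \in V -> size p.1 = l /\ p.1 \notin U) ->
    (forall q, q \in W -> size q.1 = l.+1 /\
       forall p i, p \in V -> q.1 != rcons p.1 i) ->
    Ex P (fun w => \prod_(u <- U) \1_(B u) (Nu u w) *
      \prod_(p <- W) cval s p.1 w ^+ p.2 * \prod_(p <- V) cval s.+1 p.1 w ^+ p.2) =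
    \prod_(u <- U) Ex P0 (fun w => \1_(B u) (N w)) *
      \prod_(p <- W) cmom s p.2 * \prod_(p <- V) cmom s.+1 p.2.
  move=> l U B V uU uV Ul Vl.
  have := gen l V [::] U B uU uV isT; rewrite big_nil mulr1 => <-.
  - by apply: eq_Ex => w; rewrite big_nil mulr1.
  - by move=> u /Ul; exact: ltnW.
  - move=> p pV; split; first exact: Vl.
    by apply/negP => /Ul; rewrite Vl// ltnn.
  - by [].
elim: V W U B => [|[v k] V IHV] W U B uU uV uW Ul Vl Wl.
  rewrite big_nil mulr1 -(IH l.+1)//.
  - by apply: eq_Ex => w; rewrite big_nil mulr1.
  - by move=> q /Wl[].
have [vl vU] := Vl _ (mem_head _ _).
move: uV => /= /andP[vV uV].
pose Z w := \prod_(u <- U) \1_(B u) (Nu u w) *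
      \prod_(p <- W) cval s p.1 w ^+ p.2 * \prod_(p <- V) cval s.+1 p.1 w ^+ p.2.
have bZ : bmf Z by apply: bmfM => //; exact: bmfM.
pose Q w := eprod (Nu v w) (fun i => cval s (rcons v i) w).
have uQ : u01 Q by apply: u01_eprod => // i; exact: u01_cval.
transitivity (Ex P (fun w => Z w * (1 - Q w) ^+ k)).
  by apply: eq_Ex => w; rewrite big_cons /= /Z /Q; ring.
rewrite (Ex_expand P k bZ (u01_bmf uQ)).
rewrite [in RHS]big_cons /= /mommap mulrCA mulr_suml; apply: eq_bigr => j _.
rewrite -[RHS]mulrA; congr (_ * _); rewrite [RHS]mulrC.
transitivity (Ex P (fun w => Z w * eprod (Nu v w) (fun i => cval s (rcons v i) w ^+ j))).
  by apply: eq_Ex => w; rewrite eprodX// => i; exact: (u01_cval _ _).2.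
apply: Ex_eprod => //; first by move=> i; apply: u01X; exact: u01_cval.
move=> B0 K.
pose B' u := if u == v then B0 else B u.
pose W' := [seq (rcons v i, j : nat) | i <- iota 0 K] ++ W.
have B'U u : u \in U -> B' u = B u.
  by move=> uU'; rewrite /B'; case: eqP => // uv; rewrite -uv uU' in vU.
have W'v q : q \in [seq (rcons v i, j : nat) | i <- iota 0 K] -> exists i, q = (rcons v i, j : nat).
  by move=> /mapP[i _ ->]; exists i.
have B'v : B' v = B0 by rewrite /B' eqxx.
transitivity (Ex P (fun w => \prod_(u <- v :: U) \1_(B' u) (Nu u w) *
      \prod_(p <- W') cval s p.1 w ^+ p.2 * \prod_(p <- V) cval s.+1 p.1 w ^+ p.2)).
  apply: eq_Ex => w; rewrite big_cons B'v /W' big_cat big_map/=.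
  rewrite (eq_big_seq (fun u => \1_(B u) (Nu u w))); last by move=> u /B'U ->.
  by rewrite -(big_mkord xpredT (fun i => cval s (rcons v i) w ^+ j)) /index_iota subn0 /Z; ring.
rewrite IHV //=.
- rewrite big_cons B'v /W' big_cat big_map/= big_const_seq count_predT size_iota.
  rewrite (eq_big_seq (fun u => Ex P0 (fun w => \1_(B u) (N w)))); last by move=> u /B'U ->.
  by rewrite iter_mulr_1; ring.
- by rewrite vU.
- rewrite /W' map_cat cat_uniq uW andbT -map_comp map_inj_uniq ?iota_uniq/=; last first.
    by move=> i i' /= /rcons_inj [].
  apply/hasPn => x /mapP[q qW ->]; apply/mapP => -[i _ /= qi].
  have [_ /(_ (v, k) i (mem_head _ _))] := Wl q qW.
  by rewrite qi eqxx.
- by move=> u; rewrite inE => /predU1P[->|/Ul//]; rewrite vl.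
- move=> p pV; have [pl pU] := Vl p (mem_behead (s := (v, k) :: V) pV); split=> //.
  rewrite inE negb_or pU andbT; apply: contra vV => /eqP <-.
  exact: map_f.
- move=> q; rewrite mem_cat => /orP[/W'v[i ->]|qW] /=.
    split; first by rewrite size_rcons vl.
    move=> p i' pV; apply: contra vV => /eqP /rcons_inj[-> _]; exact: map_f.
  have [ql H] := Wl q qW; split=> // p i pV; apply: H.
  by rewrite inE pV orbT.
Qed.

Lemma cval_factorsP s : cval_factors s.
Proof.
elim: s => [|s IH]; last exact: cval_factorsS.
move=> l U B V uU uV Ul Vl; rewrite -(Ex_prod_Nu B uU) mulrC -ExZ; last first.
  by apply: bmf_prod => u; exact: bmf_Nu.
by apply: eq_Ex => w; rewrite mulrC.
Qed.

Lemma Ex_cval s k : Ex P (fun w => cval s [::] w ^+ k) = cmom s k.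
Proof. by apply: cval_factors_mom; exact: cval_factorsP. Qed.

End Tree.

(** * Conditioning the zero-one solution on finitely many generations *)

Section Conditional.
Context d0 (S0 : measurableType d0) d (Om : measurableType d) (R : realType).
Variables (P0 : probability S0 R) (N : {RV P0 >-> enat}) (P : probability Om R).
Variable Nu : seq nat -> {RV P >-> enat}.
Variable S : seq nat -> {RV P >-> R}.
Variable mu : R.
Hypothesis mu01 : 0 <= mu <= 1.
Hypothesis solS : zero_one_solution Nu S mu.

Definition below (n : nat) : set (set Om) :=
  sigma_of [set v : seq nat | (size v < n)%N] (fun v => Nu v : Om -> enat).

Lemma sigma_of_measurable (J : set (seq nat)) A :
  sigma_of J (fun v => Nu v : Om -> enat) A -> measurable A.
Proof.
move=> H; apply: (smallest_sub (@sigma_algebra_measurable _ Om)) H => B [v _ [C _ <-]].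
by rewrite setTI; exact: measurable_preimage (measurable_funPT _) _.
Qed.

Lemma belowI n A B : below n A -> below n B -> below n (A `&` B).
Proof.
move=> nA nB; exact: (@measurableI _ (g_sigma_algebraType _) A B nA nB).
Qed.

Lemma below_Nu n v B : (size v < n)%N -> below n (Nu v @^-1` B).
Proof.
by move=> vn; apply: sub_sigma_algebra; exists v => //; exists B => //; rewrite setTI.
Qed.

Let S01 u : ~~ odd (size u) -> u01 (S u).
Proof.
move=> ou; split; first exact: measurable_funPT.
by move=> w; have [_ H _] := solS; case: (H u w ou) => ->; rewrite ?lexx ?ler01.
Qed.

Let S_indic u w : ~~ odd (size u) -> S u w = \1_(S u @^-1` [set 1]) w.
Proof.
move=> ou; have [_ H _] := solS; rewrite indicE; case: (H u w ou) => Suw.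
  by rewrite Suw memNset//= Suw => /eqP; rewrite eq_sym oner_eq0.
by rewrite Suw mem_set.
Qed.

Lemma Ex_leaves n A (V : seq (seq nat)) : below n.*2 A -> uniq V ->
  (forall v, v \in V -> size v = n.*2) ->
  Ex P (fun w => \1_A w * \prod_(v <- V) S v w) = Ex P (fun w => \1_A w * \prod_(v <- V) mu).
Proof.
move=> nA uV Vn; have mA := sigma_of_measurable nA.
have [[_ [_ [ind _]]] _ PS] := solS; have [indS indNu] := ind n.
have mS v : measurable (S v @^-1` [set 1]).
  by apply: measurable_preimage (measurable_funPT _) _; exact: measurable_set1.
transitivity (Ex P (fun w => \1_A w * \prod_(v <- V) \1_(S v @^-1` [set 1]) w)).
  apply: eq_Ex => w; congr (_ * _); apply: eq_big_seq => v /Vn vn.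
  by rewrite S_indic// vn odd_double.
have FV : sigma_of [set u | size u = n.*2] (fun u => S u : Om -> R)
    (\bigcap_(v in [set` V]) S v @^-1` [set 1]).
  apply: (@measurable_bigcap_seq _ (g_sigma_algebraType (\bigcup_(v in [set u | size u = n.*2])
    preimage_set_system setT (S v : Om -> R) measurable))) => v vV.
  apply: sub_sigma_algebra; exists v; first exact: Vn.
  by exists [set 1]; [exact: measurable_set1 | rewrite setTI].
have VV : [set` V] `<=` [set u | size u = n.*2] by move=> v /Vn.
apply: EFin_inj; rewrite Ex_prod_indic// setIC indNu//.
rewrite (indS V (fun=> [set 1]) uV VV (fun=> measurable_set1 _)).
have -> : (\prod_(v <- V) P (S v @^-1` [set 1%R]) = (\prod_(v <- V) mu)%:E)%E.
  by rewrite -prodEFin; apply: eq_big_seq => v /Vn vn; rewrite PS// vn odd_double.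
rewrite -Ex_indic// -EFinM -ExZ; last exact: bmf_indic.
by congr EFin; apply: eq_Ex => w; rewrite mulrC.
Qed.

(** Expresses [cval] as a conditional expectation given the generations below [n.*2], in a form
    stable under induction: products over distinct vertices, tested against events of these
    generations. The equation on [l + s] places the leaves at an even depth, where the independence
    of [S] is available. *)
Definition splits (n s : nat) : Prop := forall l A (V : seq (seq nat)),
  (l + s = n.*2)%N -> below n.*2 A -> uniq V -> (forall v, v \in V -> size v = l) ->
  Ex P (fun w => \1_A w * \prod_(v <- V) tval Nu (fun u => S u : Om -> R) s v w) =
  Ex P (fun w => \1_A w * \prod_(v <- V) cval Nu mu s v w).

(** Vertices are opened as for [cval_factorsS], but both sides now live on the same space. The event
    on [Nu v] is absorbed into [A], which remains an event of depth [n.*2] because [v] lies strictly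
    above the leaves. *)
Lemma splitsS n s : splits n s -> splits n s.+1.
Proof.
move=> IH l A V ls nA uV Vl.
have u1 s' v : (size v + s' = n.*2)%N -> u01 (tval Nu (fun u => S u : Om -> R) s' v).
  by move=> vs; apply: u01_tval => u us; apply: S01; rewrite us vs odd_double.
pose T s' v := tval Nu (fun u => S u : Om -> R) s' v.
suff gen (W : seq (seq nat)) :
    uniq W -> (forall q, q \in W -> size q = l.+1 /\ forall p i, p \in V -> q != rcons p i) ->
    Ex P (fun w => \1_A w * \prod_(q <- W) T s q w * \prod_(v <- V) T s.+1 v w) =
    Ex P (fun w => \1_A w * \prod_(q <- W) cval Nu mu s q w * \prod_(v <- V) cval Nu mu s.+1 v w).
  transitivity (Ex P (fun w => \1_A w * \prod_(q <- [::]) T s q w * \prod_(v <- V) T s.+1 v w)).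
    by apply: eq_Ex => w; rewrite big_nil mulr1.
  by rewrite gen//; apply: eq_Ex => w; rewrite big_nil mulr1.
elim: V uV Vl A nA W => [|v V IHV] uV Vl A nA W uW Wl.
  transitivity (Ex P (fun w => \1_A w * \prod_(q <- W) T s q w)).
    by apply: eq_Ex => w; rewrite big_nil mulr1.
  rewrite (IH l.+1)//; last by move=> q /Wl[].
    by apply: eq_Ex => w; rewrite big_nil mulr1.
  by rewrite addSnnS.
move: uV => /= /andP[vV uV]; have vl := Vl v (mem_head _ _).
have VlV p : p \in V -> size p = l by move=> pV; apply: Vl; rewrite inE pV orbT.
have WlV q : q \in W -> size q = l.+1 /\ forall p i, p \in V -> q != rcons p i.
  by move=> /Wl[ql h]; split=> // p i pV; apply: h; rewrite inE pV orbT.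
have mA := sigma_of_measurable nA.
have bT s' l' (V' : seq (seq nat)) : (l' + s' = n.*2)%N -> (forall v, v \in V' -> size v = l') ->
    bmf (fun w => \prod_(v <- V') T s' v w).
  move=> ls'; elim: V' => [|v' V' IHV'] Vl'.
    by under eq_fun do rewrite big_nil; exact: bmf_cst.
  under eq_fun do rewrite big_cons; apply: bmfM.
    by apply: u01_bmf; apply: u1; rewrite (Vl' v') ?mem_head.
  by apply: IHV' => v'' v''V; apply: Vl'; rewrite inE v''V orbT.
have bc s' (V' : seq (seq nat)) : bmf (fun w => \prod_(v <- V') cval Nu mu s' v w).
  by apply: bmf_prod => p; apply: u01_bmf; exact: u01_cval.
pose Z1 w := \1_A w * \prod_(q <- W) T s q w * \prod_(v <- V) T s.+1 v w.
pose Z2 w := \1_A w * \prod_(q <- W) cval Nu mu s q w * \prod_(v <- V) cval Nu mu s.+1 v w.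
have ls1 : (l.+1 + s = n.*2)%N by rewrite addSnnS.
have b1 : bmf Z1.
  apply: bmfM; first apply: bmfM; first exact: bmf_indic.
    by apply: (bT _ l.+1) => // q /Wl[].
  exact: bT ls VlV.
have b2 : bmf Z2 by apply: bmfM => //; apply: bmfM => //; exact: bmf_indic.
have uTv i : u01 (T s (rcons v i)) by apply: u1; rewrite size_rcons vl.
have ucv i : u01 (cval Nu mu s (rcons v i)) by exact: u01_cval.
have uE1 : u01 (fun w => eprod (Nu v w) (fun i => T s (rcons v i) w)) by exact: u01_eprod.
have uE2 : u01 (fun w => eprod (Nu v w) (fun i => cval Nu mu s (rcons v i) w)) by exact: u01_eprod.
transitivity (Ex P Z1 - Ex P (fun w => Z1 w * eprod (Nu v w) (fun i => T s (rcons v i) w))).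
  rewrite -ExB//; last by apply: bmfM => //; exact: u01_bmf.
  by apply: eq_Ex => w; rewrite big_cons /Z1 /T /=; ring.
transitivity (Ex P Z2 - Ex P (fun w => Z2 w * eprod (Nu v w) (fun i => cval Nu mu s (rcons v i) w))); last first.
  rewrite -ExB//; last by apply: bmfM => //; exact: u01_bmf.
  by apply: eq_Ex => w; rewrite big_cons /Z2 /cval /=; ring.
congr (_ - _); first exact: IHV.
apply: Ex_transfer_eprod => // B K.
have nAB : below n.*2 (A `&` Nu v @^-1` B).
  by apply: belowI => //; apply: below_Nu; rewrite vl -ls addnS ltnS leq_addr.
pose W' := [seq rcons v i | i <- iota 0 K] ++ W.
have uW' : uniq W'.
  rewrite cat_uniq uW andbT map_inj_uniq ?iota_uniq/=; last by move=> i i' /rcons_inj [].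
  apply/hasPn => q qW; apply/mapP => -[i _ qi].
  by have [_ /(_ v i (mem_head _ _))] := Wl q qW; rewrite qi eqxx.
have Wl' q : q \in W' -> size q = l.+1 /\ forall p i, p \in V -> q != rcons p i.
  rewrite mem_cat => /orP[/mapP[i _ ->]|/WlV//]; split; first by rewrite size_rcons vl.
  by move=> p i' pV; apply: contra vV => /eqP /rcons_inj[-> _].
have := IHV uV VlV _ nAB W' uW' Wl'.
have E (X : nat -> seq nat -> Om -> R) w : \1_A w * \prod_(q <- W) X s q w * \prod_(v <- V) X s.+1 v w *
    (\1_B (Nu v w) * \prod_(i < K) X s (rcons v i) w) =
    \1_(A `&` Nu v @^-1` B) w * \prod_(q <- W') X s q w * \prod_(v <- V) X s.+1 v w.
  rewrite indicI /W' big_cat big_map/=.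
  by rewrite -(big_mkord xpredT (fun i => X s (rcons v i) w)) /index_iota subn0; ring.
by move=> H; transitivity (Ex P (fun w => \1_(A `&` Nu v @^-1` B) w * \prod_(q <- W') T s q w *
   \prod_(v <- V) T s.+1 v w)); [apply: eq_Ex => w; exact: E | rewrite H; apply: eq_Ex => w; rewrite -E].
Qed.

Lemma splitsP n s : splits n s.
Proof.
elim: s => [|s]; last exact: splitsS.
move=> l A V; rewrite addn0 => ->; exact: Ex_leaves.
Qed.

Lemma Ex_cval_below n A : below n.*2 A ->
  Ex P (fun w => \1_A w * tval Nu (fun u => S u : Om -> R) n.*2 [::] w) =
  Ex P (fun w => \1_A w * cval Nu mu n.*2 [::] w).
Proof.
move=> nA; have := @splitsP n n.*2 0%N A [:: [::]] (add0n _) nA isT.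
move=> H; transitivity (Ex P (fun w => \1_A w * \prod_(v <- [:: [::]])
  tval Nu (fun u => S u : Om -> R) n.*2 v w)).
  by apply: eq_Ex => w; rewrite big_seq1.
rewrite H; first by apply: eq_Ex => w; rewrite big_seq1.
by move=> v; rewrite inE => /eqP ->.
Qed.

(** The recursion holds almost surely at each vertex, and each of the [n] double steps unites the
    null sets of only countably many grandchildren. *)
Lemma tval_root n u : ~~ odd (size u) ->
  {ae P, forall w, S u w = tval Nu (fun u => S u : Om -> R) n.*2 u w}.
Proof.
elim: n u => [|n IH] u ou; first exact: aeW.
have [[_ [_ [_ rec]]] _ _] := solS.
have IHij i j : {ae P, forall w, S (rcons (rcons u i) j) w =
    tval Nu (fun u => S u : Om -> R) n.*2 (rcons (rcons u i) j) w}.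
  by apply: IH; rewrite !size_rcons/= negbK.
have all_ij : {ae P, forall w, forall i j, S (rcons (rcons u i) j) w =
    tval Nu (fun u => S u : Om -> R) n.*2 (rcons (rcons u i) j) w}.
  by apply: ae_foralln => i; apply: ae_foralln => j; exact: IHij.
apply: filterS2 all_ij (rec u ou) => w ij ->.
rewrite doubleS /=; congr (1 - eprod _ _); apply/funext => i; congr (1 - eprod _ _).
by apply/funext => j.
Qed.

Lemma Ex_below n A : below n.*2 A ->
  Ex P (fun w => \1_A w * S [::] w) = Ex P (fun w => \1_A w * cval Nu mu n.*2 [::] w).
Proof.
move=> nA; have mA := sigma_of_measurable nA.
rewrite -Ex_cval_below//; apply: Ex_ae.
- by apply: bmfM; [exact: bmf_indic | apply: u01_bmf; exact: S01].
- apply: bmfM; [exact: bmf_indic | apply: u01_bmf; apply: u01_tval => u us].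
  by apply: S01; rewrite us odd_double.
- by apply: filterS (@tval_root n [::] isT) => w ->.
Qed.

End Conditional.

(** * Density of the first generations and convergence to the conditional probability *)

Lemma ae_not_in (R : realType) d (T : measurableType d) (P : probability T R)
    (A : set T) (f : T -> R) : measurable A -> P.-integrable A (EFin \o f) ->
  (forall w, A w -> 0 < f w) -> (\int[P]_(w in A) (f w)%:E <= 0)%E ->
  {ae P, forall w, ~ A w}.
Proof.
move=> mA intf f0 If.
have mf : measurable_fun A (EFin \o f) by exact: measurable_int intf.
have I0 : (\int[P]_(w in A) `|(f w)%:E| = 0)%E.
  apply/eqP; rewrite eq_le integral_ge0// andbT (eq_integral (fun w => (f w)%:E))//.
  by move=> w; rewrite inE => /f0 fw; rewrite gee0_abs// lee_fin ltW.
have := (ae_eq_integral_abs P mA mf).1 I0.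
apply: filterS => w fw Aw; have [] := fw Aw => fw0.
by have := f0 _ Aw; rewrite fw0 ltxx.
Qed.

Section Density.
Context d0 (S0 : measurableType d0) d (Om : measurableType d) (R : realType).
Variables (P0 : probability S0 R) (N : {RV P0 >-> enat}) (P : probability Om R).
Variable Nu : seq nat -> {RV P >-> enat}.

Local Notation below := (below Nu).
Local Notation full := (sigma_of setT (fun v => Nu v : Om -> enat)).

Lemma le_below m n A : (m <= n)%N -> below m A -> below n A.
Proof.
move=> mn; apply: sub_sigma_algebra2 => B [v vm BE]; exists v => //.
exact: leq_trans vm mn.
Qed.

(** Approximation in mean by events of finitely many generations. Such sets form a sigma-algebra
    containing the events of each [Nu v], hence those of the whole tree. Only even depths are used,
    since [cval] is compared with [S] there. *)
Definition approx (A : set Om) : Prop := measurable A /\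
  forall e : R, 0 < e -> exists n, exists2 B, below n.*2 B &
    Ex P (fun w => `|\1_A w - \1_B w|) <= e.

Let bd (A B : set Om) : measurable A -> measurable B ->
  bmf (fun w => `|\1_A w - \1_B w| : R).
Proof. by move=> mA mB; apply: bmf_norm; apply: bmfB; exact: bmf_indic. Qed.

Lemma approxC A : approx A -> approx (setT `\` A).
Proof.
move=> [mA H]; split; first exact: measurableD.
move=> e /H[n [B nB AB]]; exists n; exists (~` B).
  exact: (@measurableC _ (g_sigma_algebraType _) B nB).
apply: le_trans AB; rewrite setTD; have mB := sigma_of_measurable nB.
apply: le_Ex; [apply: bd; exact: measurableC | exact: bd | move=> w].
rewrite !indicC !indicE; do 2 case: (_ \in _); rewrite /= ?subrr ?subr0 ?sub0r ?normrN//.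
Qed.

Lemma approxU A A' : approx A -> approx A' -> approx (A `|` A').
Proof.
move=> [mA H] [mA' H']; split; first exact: measurableU.
move=> e e0; have e2 : 0 < e / 2 by rewrite divr_gt0.
have [n [B nB AB]] := H _ e2; have [n' [B' nB' AB']] := H' _ e2.
have mB := sigma_of_measurable nB; have mB' := sigma_of_measurable nB'.
exists (maxn n n'); exists (B `|` B').
  apply: (@measurableU _ (g_sigma_algebraType _)).
    by apply: le_below nB; rewrite leq_double leq_maxl.
  by apply: le_below nB'; rewrite leq_double leq_maxr.
rewrite [e](splitr e); apply: le_trans (lerD AB AB'); rewrite -ExD; try exact: bd.
apply: le_Ex; [by apply: bd; exact: measurableU | by apply: bmfD; exact: bd | move=> w].
rewrite !indicE !in_setU; do 4 case: (_ \in _);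
  rewrite /= ?subrr ?subr0 ?sub0r ?normrN ?normr0 ?normr1 ?addr0 ?add0r ?ler01 ?lexx//; lra.
Qed.

(** Bounded convergence replaces the countable union by a finite one, at the cost of half of the
    tolerance. *)
Lemma approx_bigcup (A : nat -> set Om) : (forall k, approx (A k)) -> approx (\bigcup_k A k).
Proof.
move=> H; have mA k : measurable (A k) by case: (H k).
have mU : measurable (\bigcup_k A k) by exact: bigcupT_measurable.
split=> // e e0; have e2 : 0 < e / 2 by rewrite divr_gt0.
pose U K := \big[setU/set0]_(i < K) A i.
have aU K : approx (U K).
  elim: K => [|K IH].
    rewrite /U big_ord0; split=> // e' e'0; exists 0%N; exists set0.
      exact: (@measurable0 _ (g_sigma_algebraType _)).
    rewrite (_ : (fun w => _) = fun=> 0) ?Ex_cst ?ltW//.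
    by apply/funext => w; rewrite subrr normr0.
  by rewrite /U big_ord_recr/=; exact: approxU.
have mUK K : measurable (U K) by case: (aU K).
have cvU : Ex P (fun w => `|\1_(\bigcup_k A k) w - \1_(U K) w|) @[K --> \oo] --> Ex P (fun=> 0).
  apply: (Ex_cvg P (M := 1) _ _ _).2.
  - by move=> K; exact: (bd mU (mUK K)).1.
  - move=> K w; rewrite normr_id !indicE; do 2 case: (_ \in _);
      by rewrite /= ?subrr ?subr0 ?sub0r ?normrN ?normr0 ?normr1 ?ler01 ?lexx.
  - move=> w; apply: cvg_near_cst.
    have [[k _ Ak]|nA] := pselect ((\bigcup_k A k) w).
      exists k.+1 => // K /= kK; rewrite !indicE mem_set; last by exists k.
      by rewrite mem_set ?subrr ?normr0// /U -bigcup_mkord; exists k.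
    apply: nearW => K; rewrite !indicE memNset// memNset ?subrr ?normr0//.
    by rewrite /U -bigcup_mkord => -[k _ Ak]; apply: nA; exists k.
rewrite Ex_cst in cvU.
have /cvgrPdist_le /(_ _ e2) [K _ /(_ K (leqnn K))] := cvU.
rewrite /= sub0r normrN ger0_norm; last by apply: Ex_ge0; [exact: bd | ].
move=> UK; have [n [B nB UB]] := (aU K).2 _ e2; exists n; exists B => //.
have mB := sigma_of_measurable nB.
rewrite [e](splitr e); apply: le_trans (lerD UK UB); rewrite -ExD; try exact: bd.
apply: le_Ex; [exact: bd | by apply: bmfD; exact: bd | move=> w].
by rewrite (le_trans _ (ler_normD _ _))// addrA subrK.
Qed.

Lemma full_approx A : full A -> approx A.
Proof.
apply: smallest_sub; first split.
- split=> // e e0; exists 0%N; exists set0; first exact: (@measurable0 _ (g_sigma_algebraType _)).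
  rewrite (_ : (fun w => _) = fun=> 0) ?Ex_cst ?ltW//.
  by apply/funext => w; rewrite subrr normr0.
- exact: approxC.
- exact: approx_bigcup.
move=> B [v _ [D _ <-]]; rewrite setTI.
have mB : measurable (Nu v @^-1` D) by exact: measurable_preimage (measurable_funPT _) _.
split=> // e e0; exists (size v).+1; exists (Nu v @^-1` D).
  by apply: below_Nu; rewrite doubleS -addnn ltnS leqW// leq_addr.
rewrite (_ : (fun w => _) = fun=> 0) ?Ex_cst ?ltW//.
by apply/funext => w; rewrite subrr normr0.
Qed.

(** The sample space with the sigma-algebra of the first [n] generations, so that measurability with
    respect to these is ordinary measurability. *)
Definition belowT n := g_sigma_algebraType (\bigcup_(v in [set v : seq nat | (size v < n)%N])
  preimage_set_system setT (Nu v : Om -> enat) measurable).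

(** [g] is quantized into [k] levels, each level set is replaced by an event of finite depth, and
    the largest of these depths is kept. Half of the tolerance pays for the quantization, half for
    the events. *)
Lemma u01_full_approx (g : Om -> R) (e : R) : u01 g ->
  (forall B, measurable B -> full (g @^-1` B)) -> 0 < e ->
  exists n, exists Y : belowT n.*2 -> R, [/\ bmf Y, bmf (Y : Om -> R) &
    Ex P (fun w => `|g w - Y w|) <= e].
Proof.
move=> ug gfull e0; have e2 : 0 < e / 2 by rewrite divr_gt0.
pose k := (Num.truncn (e / 2)^-1).+1.
have kR : (0 : R) < k%:R by rewrite ltr0n.
have ke : k%:R^-1 <= e / 2.
  by rewrite -[leRHS]invrK lef_pV2 ?posrE ?invr_gt0// ltW// truncnS_gt.
have lf i : full (level g k i).
  rewrite (_ : level g k i = g @^-1` `[i.+1%:R / k%:R, +oo[%classic); first by apply: gfull; exact: measurable_itv.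
  by apply/seteqP; split=> w /=; rewrite in_itv/= andbT.
have ml i : measurable (level g k i) by exact: measurable_level ug.1.
have /choice[f hf] i : exists p : nat * set Om, below p.1.*2 p.2 /\
    Ex P (fun w => `|\1_(level g k i) w - \1_(p.2) w|) <= e / 2.
  by have [_ /(_ _ e2)[n [B nB iB]]] := full_approx (lf i); exists (n, B).
pose n := \max_(i < k) (f i).1.
have nf (i : 'I_k) : below n.*2 (f i).2.
  by apply: le_below (hf i).1; rewrite leq_double /n (leq_bigmax i).
pose B i : set Om := if (i < k)%N then (f i).2 else set0.
have nB i : below n.*2 (B i).
  rewrite /B; case: ifP => ik; first exact: (nf (Ordinal ik)).
  exact: (@measurable0 _ (g_sigma_algebraType _)).
have mB i : measurable (B i) by exact: sigma_of_measurable (nB i).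
pose Y (w : Om) : R := k%:R^-1 * \sum_(i < k) \1_(B i) w.
exists n, Y; split.
- apply: bmfM; first exact: bmf_cst.
  by apply: bmf_sum => i; apply: bmf_indic; exact: nB.
- apply: bmfM; first exact: bmf_cst.
  by apply: bmf_sum => i; exact: bmf_indic.
have bY : bmf Y.
  apply: bmfM; first exact: bmf_cst.
  by apply: bmf_sum => i; exact: bmf_indic.
have bs := bmf_step k ug.1.
have bg := u01_bmf ug.
have bi i : bmf (fun w => `|\1_(level g k i) w - \1_(B i) w| : R) by exact: bd.
apply: (@le_trans _ _ (Ex P (fun w => k%:R^-1 + k%:R^-1 * \sum_(i < k)
    `|\1_(level g k i) w - \1_(B i) w|))).
  apply: le_Ex; first by apply: bmf_norm; exact: bmfB.
    apply: bmfD; first exact: bmf_cst.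
    by apply: bmfM; [exact: bmf_cst | exact: bmf_sum].
  move=> w; rewrite -[g w - Y w](subrKA (step g k w)) (le_trans (ler_normD _ _))// lerD//.
    by apply: step_dist => //; exact: ug.2.
  rewrite /step /Y -mulrBr normrM ger0_norm ?invr_ge0// ler_wpM2l ?invr_ge0//.
  by rewrite -sumrB ler_norm_sum.
rewrite ExD; [|exact: bmf_cst|by apply: bmfM; [exact: bmf_cst | exact: bmf_sum]].
rewrite Ex_cst ExZ; last exact: bmf_sum.
rewrite Ex_sum// [e](splitr e) lerD//.
rewrite ler_pdivrMl// mulr_natl -[k in _ *+ k]card_ord -sumr_const.
apply: ler_sum => i _; rewrite (_ : B i = (f i).2); first by case: (hf i).
by rewrite /B ltn_ord.
Qed.

(** Conditional expectation contracts the mean distance to [Y]: the sign of [h - Y] is given by an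
    event of the first [n] generations, so the distance of [h] is a signed integral in which [h] may
    be exchanged for [g]. The copy [h'] carries the measurability of [h] over [belowT]. *)
Lemma Ex_project_le n (g h : Om -> R) (h' Y : belowT n -> R) :
  bmf g -> bmf h -> bmf (Y : Om -> R) -> bmf Y -> bmf h' -> h = h' ->
  (forall A, below n A -> Ex P (fun w => \1_A w * g w) = Ex P (fun w => \1_A w * h w)) ->
  Ex P (fun w => `|h w - Y w|) <= Ex P (fun w => `|g w - Y w|).
Proof.
move=> bg bh bY bY' bh' hE H.
pose A : set Om := [set w | Y w <= h' w].
have nA : below n A.
  have := (bmfB bh' bY').1 measurableT _ (measurable_itv `[(0 : R), +oo[).
  rewrite setTI (_ : _ @^-1` _ = A)//.
  by apply/seteqP; split=> w; rewrite /A /= in_itv/= andbT subr_ge0.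
have mA := sigma_of_measurable nA.
have bI : bmf (fun w => \1_A w : R) by exact: bmf_indic.
have E (f : Om -> R) : bmf f -> Ex P (fun w => (2 * \1_A w - 1) * (f w - Y w)) =
    2 * Ex P (fun w => \1_A w * f w) - 2 * Ex P (fun w => \1_A w * Y w) -
    Ex P (fun w => \1_setT w * f w) + Ex P Y.
  move=> bf.
  have bT : bmf (fun w : Om => \1_setT w * f w) by apply: bmfM => //; exact: bmf_indic.
  have b1 := bmfM bI bf; have b2 := bmfM bI bY.
  have c2 : bmf (fun w : Om => 2 : R) by exact: bmf_cst.
  rewrite -!ExZ// -ExB; [|exact: bmfM|exact: bmfM].
  rewrite -ExB//; last by apply: bmfB; exact: bmfM.
  rewrite -ExD//; last by apply: bmfB => //; apply: bmfB; exact: bmfM.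
  by apply: eq_Ex => w; rewrite indicT /=; ring.
have sgn w : (2 * \1_A w - 1 : R) = 1 \/ (2 * \1_A w - 1 : R) = -1.
  by rewrite indicE; case: (_ \in _) => /=; [left | right]; lra.
rewrite (_ : Ex P (fun w => `|h w - Y w|) = Ex P (fun w => (2 * \1_A w - 1) * (h w - Y w))).
  have nT : below n setT by exact: (@measurableT _ (belowT n)).
  rewrite E// -(H _ nA) -(H _ nT) -E//; apply: le_Ex.
  - by apply: bmfM; [apply: bmfB; [apply: bmfM => //|]; exact: bmf_cst | exact: bmfB].
  - by apply: bmf_norm; exact: bmfB.
  - move=> w; case: (sgn w) => ->; first by rewrite mul1r ler_norm.
    by rewrite mulN1r -normrN ler_norm.
apply: eq_Ex => w; rewrite hE indicE; case: (boolP (w \in A)) => wA.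
  have : Y w <= h' w by move: wA; rewrite inE.
  by rewrite -subr_ge0 => /ger0_norm ->; rewrite /=; ring.
have : h' w - Y w <= 0.
  by rewrite subr_le0 ltW// ltNge; apply: contra wA => ?; rewrite inE.
by move=> /ler0_norm ->; rewrite /=; ring.
Qed.

Variable S : seq nat -> {RV P >-> R}.
Variable C : seq nat -> {RV P >-> R}.
Variable mu : R.
Hypothesis mu01 : 0 <= mu <= 1.
Hypothesis solS : zero_one_solution Nu S mu.
Hypothesis condC : cond_prob_solution Nu S C.

Lemma u01_cval_below n s v : (size v + s <= n)%N -> @u01 _ (belowT n) R (cval Nu mu s v).
Proof.
elim: s v => [|s IH] v vs; first exact: u01_cst.
apply: u01_onem; apply: u01_eprod.
  by move=> _ B _; rewrite setTI; apply: below_Nu; rewrite (leq_trans _ vs)// addnS ltnS leq_addr.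
by move=> i; apply: IH; rewrite size_rcons addSnnS.
Qed.

Let E1 : set Om := S [::] @^-1` [set 1].

Let mE1 : measurable E1.
Proof. by apply: measurable_preimage (measurable_funPT _) _; exact: measurable_set1. Qed.

Let condE A : full A -> (\int[P]_(w in A) (C [::] w)%:E = P (A `&` E1))%E.
Proof. by have [_ _] := condC (u := [::]) isT; exact. Qed.

(** Testing the defining identity on the events where [C [::]] is negative or exceeds 1 forces both
    to be null. This allows the clipped version [Cc] to stand for [C [::]]. *)
Lemma cond_prob01 : {ae P, forall w, 0 <= C [::] w <= 1}.
Proof.
have [fullC intC _] := condC (u := [::]) isT.
have intA A : measurable A -> P.-integrable A (EFin \o C [::]).
  by move=> mA; exact: integrableS intC.
have f0 : full (C [::] @^-1` `]-oo, 0[%classic) by apply: fullC; exact: measurable_itv.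
have f1 : full (C [::] @^-1` `]1, +oo[%classic) by apply: fullC; exact: measurable_itv.
have m0 := sigma_of_measurable f0; have m1 := sigma_of_measurable f1.
have ae0 : {ae P, forall w, ~ (C [::] @^-1` `]-oo, 0[%classic) w}.
  apply: (ae_not_in (f := fun w => - C [::] w) m0).
  - by have := integrableN (intA _ m0); apply: eq_integrable => // w _.
  - by move=> w /=; rewrite in_itv/= oppr_gt0.
  - under eq_integral do rewrite -mulN1r EFinM.
    rewrite (integralZl m0 (intA _ m0)) condE//.
    by apply: mule_le0_ge0; rewrite ?lee_fin//; lra.
have ae1 : {ae P, forall w, ~ (C [::] @^-1` `]1, +oo[%classic) w}.
  apply: (ae_not_in (f := fun w => C [::] w - 1) m1).
  - have i1 : P.-integrable (C [::] @^-1` `]1, +oo[%classic) (EFin \o cst 1).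
      exact: finite_measure_integrable_cst.
    by have := integrableB m1 (intA _ m1) i1; apply: eq_integrable => // w _.
  - by move=> w /=; rewrite in_itv/= andbT subr_gt0.
  - under eq_integral do rewrite EFinB.
    rewrite integralB//; [|exact: intA|exact: finite_measure_integrable_cst].
    rewrite condE// integral_cst// mul1e leeBlDr ?fin_num_measure// add0e.
    by apply: le_measure; rewrite ?inE//; exact: measurableI.
apply: filterS2 ae0 ae1 => w; rewrite /= !in_itv/= andbT => /negP + /negP.
by rewrite -!leNgt => -> ->.
Qed.

Let Cc (w : Om) : R := clip (C [::] w).

Lemma u01_clipC : u01 Cc.
Proof.
split; last by move=> w; exact: clip01.
by apply: measurableT_comp; [exact: (u01_clip R).1 | exact: measurable_funPT].
Qed.

Lemma clipC_ae : {ae P, forall w, C [::] w = Cc w}.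
Proof. by apply: filterS cond_prob01 => w ?; rewrite /Cc clip_id. Qed.

Lemma Ex_clipC A : full A -> Ex P (fun w => \1_A w * Cc w) = Ex P (fun w => \1_A w * S [::] w).
Proof.
move=> fA; have mA := sigma_of_measurable fA; have [fullC intC _] := condC (u := [::]) isT.
apply: EFin_inj; transitivity (\int[P]_(w in A) (C [::] w)%:E)%E.
  rewrite -ExE; last by apply: bmfM; [exact: bmf_indic | exact: u01_bmf u01_clipC].
  rewrite [RHS]integral_mkcond; apply: ae_eq_integral => //.
  - apply/measurable_EFinP; apply: measurable_funM; first exact: measurable_indic.
    exact: u01_clipC.1.
  - apply/(measurable_restrictT _ mA); apply/measurable_EFinP.
    by apply: measurable_funTS; exact: measurable_funPT.
  - apply: filterS clipC_ae => w Cw _; rewrite patchE indicE -Cw.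
    by case: (_ \in _); rewrite /= ?mul1r ?mul0r.
rewrite condE// -Ex_indic; last exact: measurableI.
congr EFin; apply: eq_Ex => w; rewrite indicI; congr (_ * _).
rewrite indicE /E1; have [_ H _] := solS; case: (H [::] w isT) => Sw.
  by rewrite Sw memNset//= Sw => /eqP; rewrite eq_sym oner_eq0.
by rewrite Sw mem_set.
Qed.

(** Choose [Y] of finite depth within half of the tolerance of [Cc]. At every larger even depth
    [cval] is the projection of [Cc], hence as close to [Y] by [Ex_project_le]; the triangle
    inequality concludes. *)
Lemma cvg_cval : Ex P (fun w => `|Cc w - cval Nu mu n.*2 [::] w|) @[n --> \oo] --> 0.
Proof.
have fullCc B : measurable B -> full (Cc @^-1` B).
  move=> mB; have [fullC _ _] := condC (u := [::]) isT.
  by have := fullC _ (measurable_preimage (u01_clip R).1 mB).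
have uc n : u01 (cval Nu mu n.*2 [::]) by exact: u01_cval.
have bC := u01_bmf u01_clipC.
apply/cvgrPdist_le => e e0; have e2 : 0 < e / 2 by rewrite divr_gt0.
have [n [Y [bY' bY CY]]] := u01_full_approx u01_clipC fullCc e2.
exists n => // k /= nk.
have bd' : bmf (fun w => `|Cc w - cval Nu mu k.*2 [::] w|).
  by apply: bmf_norm; apply: bmfB => //; exact: u01_bmf.
rewrite sub0r normrN ger0_norm; last exact: Ex_ge0.
have mY : @bmf _ (belowT k.*2) R Y.
  have [mY [M YM]] := bY'; split; last by exists M.
  move=> _ B mB; have := mY measurableT B mB; rewrite !setTI.
  by apply: le_below; rewrite leq_double.
have := @Ex_project_le k.*2 Cc (cval Nu mu k.*2 [::]) (cval Nu mu k.*2 [::]) Y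
  bC (u01_bmf (uc k)) bY mY (u01_bmf (@u01_cval_below k.*2 k.*2 [::] (leqnn _))) erefl.
have fullb A : below k.*2 A -> full A.
  by apply: sub_sigma_algebra2 => B [v _ BE]; exists v.
move=> /(_ (fun A kA => etrans (Ex_clipC (fullb A kA)) (Ex_below mu01 solS kA))) h.
apply: (@le_trans _ _ (Ex P (fun w => `|Cc w - Y w| + `|cval Nu mu k.*2 [::] w - Y w|))).
  apply: le_Ex => //.
    by apply: bmfD; apply: bmf_norm; apply: bmfB => //; exact: u01_bmf.
  by move=> w; rewrite [X in _ <= _ + X]distrC (le_trans _ (ler_normD _ _))// addrA subrK.
rewrite ExD; [|by apply: bmf_norm; exact: bmfB|by apply: bmf_norm; apply: bmfB => //; exact: u01_bmf].
by rewrite [e](splitr e) lerD// (le_trans h).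
Qed.

End Density.

(** * From mean squares to integrals of continuous functions *)

Section UniformContinuity.
Context (R : realType).

(** Uniform continuity in a form that second moments can integrate. If every [K = n] failed, the
    offending pairs would satisfy n (x - y)^2 <= 2 M; along a subsequence both coordinates would
    tend to the same limit, against continuity of [g]. *)
Lemma continuous_sqr_modulus (g : R -> R) (e : R) : continuous g ->
  (exists M, forall x, `|g x| <= M) -> 0 < e ->
  exists2 K, 0 <= K & forall x y, 0 <= x <= 1 -> 0 <= y <= 1 ->
    `|g x - g y| <= e + K * (x - y) ^+ 2.
Proof.
move=> cg [M gM] e0; apply: contrapT => H.
have M0 : 0 <= M by apply: le_trans (gM 0).
have bad (n : nat) : exists p : R * R, [/\ 0 <= p.1 <= 1, 0 <= p.2 <= 1 &
    e + n%:R * (p.1 - p.2) ^+ 2 < `|g p.1 - g p.2| ].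
  apply: contrapT => nH; apply: H; exists n%:R => // x y x01 y01.
  by rewrite leNgt; apply/negP => xy; apply: nH; exists (x, y).
have {bad}/choice[p pP] := bad.
have [f finc] : exists2 f, increasing_seq f & cvgn ((fun n => (p n).1) \o f).
  apply: bolzano_weierstrass; exists 1; split; first exact: num_real.
  move=> c c1 n _ /=; rewrite (le_trans _ (ltW c1))//.
  by have [/andP[p0 p1] _ _] := pP n; rewrite ger0_norm.
move=> /cvg_ex[/= l fl].
have fge n : (n <= f n)%N.
  elim: n => // n IH; apply: leq_ltn_trans IH _.
  by have := finc n.+1 n; rewrite !leEnat => h; rewrite ltnNge h -ltnNge.
have d0 : (p (f n)).1 - (p (f n)).2 @[n --> \oo] --> 0.
  apply/cvgrPdist_le => r r0.
  pose n0 := (Num.truncn (2 * M / r ^+ 2)).+1.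
  exists n0 => // n /= n0n; rewrite sub0r normrN.
  have [_ _ h] := pP (f n).
  have h2 : `|g (p (f n)).1 - g (p (f n)).2| <= 2 * M.
    by rewrite (le_trans (ler_normB _ _))// mulr2n mulrDl mul1r lerD.
  rewrite leNgt; apply/negP => h3'.
  have h3 : r ^+ 2 < ((p (f n)).1 - (p (f n)).2) ^+ 2.
    by rewrite -[ltRHS]real_normK ?num_real// !expr2 ltr_pM// ltW.
  have r2 : 0 < r ^+ 2 by rewrite exprn_gt0.
  have n0f : n0%:R <= (f n)%:R :> R by rewrite ler_nat (leq_trans n0n).
  have h4 : 2 * M < n0%:R * r ^+ 2 by rewrite -ltr_pdivrMr// truncnS_gt.
  have h5 : n0%:R * r ^+ 2 <= (f n)%:R * ((p (f n)).1 - (p (f n)).2) ^+ 2.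
    by apply: ler_pM => //; exact: ltW.
  lra.
have fl2 : (p (f n)).2 @[n --> \oo] --> l.
  rewrite (_ : (fun n => _) = fun n => (p (f n)).1 - ((p (f n)).1 - (p (f n)).2)).
    by rewrite -[X in _ --> X]subr0; exact: cvgB.
  by apply/funext => n; rewrite subKr.
have g1 := cvg_comp _ _ fl (cg l); have g2 := cvg_comp _ _ fl2 (cg l).
have gg : g (p (f n)).1 - g (p (f n)).2 @[n --> \oo] --> 0.
  by rewrite -(subrr (g l)); apply: cvgB; [exact: g1 | exact: g2].
move/cvgrPdist_lt : gg => /(_ _ e0)[n _ /(_ n (leqnn n))] /=.
rewrite sub0r normrN; have [_ _ h] := pP (f n) => h2.
have : 0 <= (f n)%:R * ((p (f n)).1 - (p (f n)).2) ^+ 2 by rewrite mulr_ge0// sqr_ge0.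
by move: (lt_trans h h2) => h3; rewrite leNgt => /negP; apply; lra.
Qed.

Lemma cvg_Ex_sqr d (T : measurableType d) (P : probability T R) (X Y : nat -> T -> R)
    (g : R -> R) :
  (forall n, u01 (X n)) -> (forall n, u01 (Y n)) -> continuous g ->
  (exists M, forall x, `|g x| <= M) ->
  Ex P (fun w => (X n w - Y n w) ^+ 2) @[n --> \oo] --> 0 ->
  Ex P (fun w => g (X n w)) - Ex P (fun w => g (Y n w)) @[n --> \oo] --> 0.
Proof.
move=> uX uY cg gM cv; apply/cvgrPdist_le => e e0.
have e2 : 0 < e / 2 by rewrite divr_gt0.
have [K K0 HK] := continuous_sqr_modulus cg gM e2.
have K1 : 0 < K + 1 by lra.
have bg (Z : T -> R) : u01 Z -> bmf (fun w => g (Z w)).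
  move=> uZ; split; last by case: gM => M gM; exists M.
  by apply: measurableT_comp; [exact: continuous_measurable_fun | exact: uZ.1].
have /cvgrPdist_le /(_ _ (divr_gt0 e2 K1))[n0 _ H] := cv.
exists n0 => // n n0n; rewrite /= sub0r normrN -ExB; try exact: bg.
have bd : bmf (fun w => (X n w - Y n w) ^+ 2).
  by apply: bmfX; apply: bmfB; exact: u01_bmf.
apply: (le_trans (ler_norm_Ex P (bmfB (bg _ (uX n)) (bg _ (uY n))))).
apply: (@le_trans _ _ (Ex P (fun w => e / 2 + K * (X n w - Y n w) ^+ 2))).
  apply: le_Ex.
  - by apply: bmf_norm; apply: bmfB; exact: bg.
  - by apply: bmfD; [exact: bmf_cst | apply: bmfM => //; exact: bmf_cst].
  - by move=> w; apply: HK; [exact: (uX n).2 | exact: (uY n).2].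
rewrite ExD; [|exact: bmf_cst|by apply: bmfM => //; exact: bmf_cst].
rewrite Ex_cst ExZ// [leRHS](splitr e) lerD2l.
have := H n n0n; rewrite /= sub0r normrN ger0_norm; last first.
  by apply: Ex_ge0 => // w; exact: sqr_ge0.
rewrite ler_pdivlMr// mulrDr mulr1 mulrC.
have : 0 <= Ex P (fun w => (X n w - Y n w) ^+ 2) by apply: Ex_ge0 => // w; exact: sqr_ge0.
lra.
Qed.

End UniformContinuity.

(** * Coupled iterates and basins *)

Section Coupling.
Context (R : realType) d0 (S0 : measurableType d0) (P0 : probability S0 R).
Variables (N : {RV P0 >-> enat}) (lam : probability R R).
Hypothesis N_gt0 : forall w, N w <> Some 0%N.
Hypothesis convH : strictly_convex01 (pgf N).
Hypothesis lamE : forall s, lam `]-oo, s]%classic = (clip s)%:E.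

Local Notation H := (pgf N).
Local Notation D := (dpgf N).

Definition flow (a : R -> R) (n : nat) : R -> R := iter n (recfun N) a.
Definition flow1 a n := Ex lam (flow a n).
Definition flow2 a b n := Ex lam (fun x => flow a n x * flow b n x).

Section Moments.
Variables a b : R -> R.
Hypotheses (ua : u01 a) (ub : u01 b).

Lemma u01_flow n : u01 (flow a n).
Proof. by elim: n => //= n IH; exact: u01_recfun. Qed.

Lemma flow1S n : flow1 a n.+1 = 1 - H (flow1 a n).
Proof. by rewrite /flow1 /= Ex_recfun//; exact: u01_flow. Qed.

Lemma flow1_01 n : 0 <= flow1 a n <= 1.
Proof. by apply: Ex01; exact: u01_flow. Qed.

End Moments.

Lemma flow2S a b n : u01 a -> u01 b ->
  flow2 a b n.+1 = 1 - H (flow1 a n) - H (flow1 b n) + H (flow2 a b n).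
Proof. by move=> ua ub; rewrite /flow2 /= Ex_recfunM//; exact: u01_flow. Qed.

Lemma flow2_01 a b n : u01 a -> u01 b -> 0 <= flow2 a b n <= 1.
Proof. by move=> ua ub; apply: Ex01; apply: u01M; exact: u01_flow. Qed.

Lemma flow2_le a b n : u01 a -> u01 b -> flow2 a b n <= flow1 a n.
Proof.
move=> ua ub; have uA := u01_flow ua n; have uB := u01_flow ub n.
apply: le_Ex; [exact: u01_bmf (u01M uA uB) | exact: u01_bmf | move=> x].
by have /andP[? ?] := uA.2 x; have /andP[? ?] := uB.2 x; rewrite ler_piMr.
Qed.

Lemma flow_dist a b n : u01 a -> u01 b ->
  Ex lam (fun x => (flow a n x - flow b n x) ^+ 2) =
  flow2 a a n - 2 * flow2 a b n + flow2 b b n.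
Proof.
move=> ua ub; have uA := u01_flow ua n; have uB := u01_flow ub n.
have bm f g : u01 f -> u01 g -> bmf (fun x : R => f x * g x : R).
  by move=> uf ug; exact: u01_bmf (u01M uf ug).
rewrite /flow2 -ExZ; last exact: bm.
rewrite -ExB; [|exact: bm|by apply: bmfM; [exact: bmf_cst | exact: bm]].
rewrite -ExD; [|apply: bmfB; [exact: bm|by apply: bmfM; [exact: bmf_cst | exact: bm]]|exact: bm].
by apply: eq_Ex => x; ring.
Qed.

Lemma sqr_flow1_le a n : u01 a -> flow1 a n ^+ 2 <= flow2 a a n.
Proof.
move=> ua; have uA := u01_flow ua n; set m := flow1 a n.
have bA := u01_bmf uA.
have := @Ex_ge0 _ _ _ lam (fun x => (flow a n x - m) ^+ 2).
have b1 : bmf (fun x => flow a n x - m) by apply: bmfB => //; exact: bmf_cst.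
move=> /(_ (bmfX 2 b1) (fun x => sqr_ge0 _)).
rewrite (_ : Ex _ _ = flow2 a a n - 2 * m * m + m ^+ 2); first by lra.
rewrite /flow2 -[in LHS]/m -[m ^+ 2 in RHS](Ex_cst lam) -ExZ//.
have b2 : bmf (fun x => flow a n x * flow a n x) by exact: bmfM.
have b3 : bmf (fun x => 2 * m * flow a n x) by apply: bmfM => //; exact: bmf_cst.
rewrite -ExB// -ExD; [|exact: bmfB|exact: bmf_cst].
by apply: eq_Ex => x; ring.
Qed.

Section FixedMean.
Variables a b : R.
Hypothesis a01 : 0 <= a <= 1.
Hypothesis Ha : H a = 1 - b.
Hypothesis Hb : H b = 1 - a.

Let ca : R -> R := fun=> a.

Lemma u01_ca : u01 ca. Proof. exact: u01_cst. Qed.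

Lemma flow1_fixed x n : u01 x -> flow1 x 0 = a ->
  flow1 x n.*2 = a /\ flow1 x n.*2.+1 = b.
Proof.
move=> ux x0; elim: n => [|n [_ IH]]; first by rewrite flow1S// x0 Ha; split=> //; ring.
have e : flow1 x n.+1.*2 = a by rewrite doubleS flow1S// IH Hb; ring.
by split=> //; rewrite flow1S// e Ha; ring.
Qed.

Lemma flow1_ca n : flow1 ca n.*2 = a /\ flow1 ca n.*2.+1 = b.
Proof. by apply: flow1_fixed; [exact: u01_ca | exact: Ex_cst]. Qed.

(** [second_moment_attracts] applies to each of the three pairs made of [x] and [ca], so the mean
    square tends to a - 2 a + a. *)
Lemma critical_merge x : 0 < a < 1 -> D a * D b <= 1 -> u01 x ->
  flow1 x n.*2 @[n --> \oo] --> a ->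
  Ex lam (fun w => (flow x n.*2 w - flow ca n.*2 w) ^+ 2) @[n --> \oo] --> 0.
Proof.
move=> a01' DD ux xa; have uc := u01_ca.
have caa : flow1 ca n.*2 @[n --> \oo] --> a.
  by under eq_cvg => n do rewrite (flow1_ca n).1; exact: cvg_cst.
have S u v : u01 u -> u01 v -> flow1 u n.*2 @[n --> \oo] --> a ->
    flow1 v n.*2 @[n --> \oo] --> a -> flow2 u v n.*2 @[n --> \oo] --> a.
  move=> uu uv; apply: (second_moment_attracts N_gt0 convH a01' Ha Hb DD) => n.
  - exact: flow2_01.
  - exact: flow1_01.
  - exact: flow1_01.
  - exact: flow2_le.
  - exact: flow1S.
  - exact: flow1S.
  - exact: flow2S.
have c1 := S x x ux ux xa xa; have c2 := S x ca ux uc xa caa.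
have c3 := S ca ca uc uc caa caa.
have c4 : flow2 x x n.*2 - 2 * flow2 x ca n.*2 + flow2 ca ca n.*2 @[n --> \oo] --> a - 2 * a + a.
  by apply: cvgD => //; apply: cvgB => //; apply: cvgMr.
rewrite (_ : 0 = a - 2 * a + a :> R); last by ring.
by apply: cvg_trans c4; apply: near_eq_cvg; apply: nearW => n; rewrite flow_dist.
Qed.

(** For p and q in [0, 1], (p - q)^2 is at most p + q and at most (1 - p) + (1 - q). The first bound
    serves at a = 0 and the second at a = 1, where [ca] contributes nothing and only the mean of [x]
    is left. *)
Lemma boundary_merge x : a = 0 \/ a = 1 -> u01 x -> flow1 x n.*2 @[n --> \oo] --> a ->
  Ex lam (fun w => (flow x n.*2 w - flow ca n.*2 w) ^+ 2) @[n --> \oo] --> 0.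
Proof.
move=> abnd ux xa; have uc := u01_ca.
have le n : `|Ex lam (fun w => (flow x n.*2 w - flow ca n.*2 w) ^+ 2)| <= `|flow1 x n.*2 - a|.
  have uX := u01_flow ux n.*2; have uC := u01_flow uc n.*2.
  have bX := u01_bmf uX; have bC := u01_bmf uC.
  have b2 : bmf (fun w => (flow x n.*2 w - flow ca n.*2 w) ^+ 2) by apply: bmfX; exact: bmfB.
  rewrite ger0_norm; last by apply: Ex_ge0 => // w; exact: sqr_ge0.
  have c1 := (flow1_ca n).1; case: abnd => abnd.
    apply: (@le_trans _ _ (Ex lam (fun w => flow x n.*2 w + flow ca n.*2 w))).
      apply: le_Ex => //; first exact: bmfD.
      move=> w; have := uX.2 w; have := uC.2 w.
      move: (flow x _ w) (flow ca _ w) => p q; nra.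
    by rewrite ExD// [X in _ + X]c1 abnd addr0 subr0 ler_norm.
  apply: (@le_trans _ _ (Ex lam (fun w => (1 - flow x n.*2 w) + (1 - flow ca n.*2 w)))).
    apply: le_Ex => //; first by apply: bmfD; apply: bmfB => //; exact: bmf_cst.
    move=> w; have := uX.2 w; have := uC.2 w.
    move: (flow x _ w) (flow ca _ w) => p q; nra.
  have b1 := @bmf_cst _ _ R 1 : bmf (fun=> 1 : R).
  rewrite ExD; [|exact: bmfB|exact: bmfB].
  rewrite !ExB// !Ex_cst [X in _ + (_ - X)]c1 abnd subrr addr0 distrC.
  exact: ler_norm.
apply/cvgrPdist_le => e e0; move/cvgrPdist_le : xa => /(_ _ e0)[n0 _ H0].
exists n0 => // n /= /H0 /=; rewrite sub0r normrN distrC; exact: le_trans.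
Qed.

(** The mixed moment equals the second moment of [ca]: both start at a^2, one factor being constant,
    and obey the same recursion with the same means. So the mean square is a difference of deficits,
    and [deficits_merge] applies; a^2 being the least second moment at mean a, the deficit of [ca]
    starts at the largest possible value. *)
Lemma supercritical_merge x : 0 < a < 1 -> 1 < D a * D b -> u01 x -> flow1 x 0 = a ->
  flow2 x x 0 < a ->
  (exists2 l : R, 0 < l & a - flow2 ca ca n.*2 @[n --> \oo] --> l) /\
  Ex lam (fun w => (flow x n.*2 w - flow ca n.*2 w) ^+ 2) @[n --> \oo] --> 0.
Proof.
move=> a01' DD ux x0 xa; have uc := u01_ca.
have /andP[b0 b1] := b01 N_gt0 convH a01' Ha; have /andP[a0 a1] := a01'.
have xm n := flow1_fixed n ux x0; have cm := flow1_ca.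
pose def u n := flow1 u n - flow2 u u n.
have de u n : u01 u -> flow1 u 0 = a -> [/\ 0 <= def u n.*2 <= a, 0 <= def u n.*2.+1 <= b,
    def u n.*2.+1 = drop_pgf N a (def u n.*2) &
    def u n.+1.*2 = drop_pgf N b (def u n.*2.+1)].
  move=> uu u0; have [m0 m1] := flow1_fixed n uu u0.
  have [m2 _] := flow1_fixed n.+1 uu u0.
  have h1 := flow2_le n.*2 uu uu; have h2 := flow2_01 n.*2 uu uu.
  have h3 := flow2_le n.*2.+1 uu uu; have h4 := flow2_01 n.*2.+1 uu uu.
  rewrite m0 in h1; rewrite m1 in h3.
  have e1 : flow2 u u n.*2.+1 = 1 - H a - H a + H (flow2 u u n.*2) by rewrite flow2S// m0.
  have e2 : flow2 u u n.+1.*2 = 1 - H b - H b + H (flow2 u u n.*2.+1).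
    by rewrite doubleS flow2S// m1.
  rewrite /def m0 m1 m2 /drop_pgf !subKr; split; [lra | lra | |].
    by rewrite e1 Ha; ring.
  by rewrite e2 Hb; ring.
have c00 : flow2 ca ca 0 = a ^+ 2 by rewrite /flow2 /= /ca Ex_cst.
have cx0 n : flow2 x ca n = flow2 ca ca n.
  have same k : flow1 x k = flow1 ca k.
    by elim: k => [|k IH]; [rewrite x0 (cm 0%N).1 | rewrite !flow1S// IH].
  elim: n => [|n IH]; last by rewrite !flow2S// IH same.
  rewrite c00 /flow2 /= expr2 -[in RHS]x0 mulrC -ExZ; last exact: u01_bmf.
  by apply: eq_Ex => w; rewrite mulrC x0.
have [x00 c0] : flow1 x 0 = a /\ flow1 ca 0 = a by rewrite x0 (cm 0%N).1.
have sq2 : a ^+ 2 <= flow2 ca ca 2.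
  by have := sqr_flow1_le 2 uc; rewrite (cm 1%N).1.
have sq1 : b ^+ 2 <= flow2 ca ca 1.
  by have := sqr_flow1_le 1 uc; rewrite (cm 0%N).2.
have sq0 : a ^+ 2 <= flow2 x x 0 by have := sqr_flow1_le 0 ux; rewrite x0.
have a2 : 0 < a ^+ 2 by rewrite exprn_gt0.
have b2 : 0 < b ^+ 2 by rewrite exprn_gt0.
have [] := deficits_merge N_gt0 convH a01' Ha DD (x := def x) (y := def ca).
- by move=> n; have [] := de x n ux x00.
- by move=> n; have [] := de x n ux x00.
- by move=> n; have [] := de ca n uc c0.
- by move=> n; have [] := de ca n uc c0.
- by move=> n; have [] := de x n ux x00.
- by move=> n; have [] := de x n ux x00.
- by move=> n; have [] := de ca n uc c0.
- by move=> n; have [] := de ca n uc c0.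
- by rewrite /def x00; lra.
- by rewrite /def x00 c0 c00; lra.
- by rewrite /def c0 c00 [flow1 ca 2](cm 1%N).1; lra.
- by rewrite /def c0 c00; lra.
- by rewrite /def [flow1 ca 1](cm 0%N).2; lra.
move=> [l l0 cl] cxy; split.
  by exists l => //; move: cl; under eq_cvg => n do rewrite /def (cm n).1.
rewrite (_ : (fun n => _) = fun n => - (def x n.*2 - def ca n.*2)).
  by rewrite -oppr0; exact: cvgN.
by apply/funext => n; rewrite flow_dist// cx0 /def (xm n).1 (cm n).1; ring.
Qed.

End FixedMean.

End Coupling.

(** * Mean and concentration on the endpoints, read off the quantile function *)

Section Means.
Context (R : realType) (lam : probability R R).
Hypothesis lamE : forall s, lam `]-oo, s]%classic = (clip s)%:E.
Variable nu : probability R R.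
Hypothesis nu01 : on01 nu.

Lemma mom_quantile k : mom nu k = Ex lam (fun x => quantile nu x ^+ k).
Proof.
rewrite /mom (pushforward_Ex (Q := lam) (X := quantile nu)).
- by apply: eq_Ex => x; rewrite clip_id//; exact: quantile01.
- exact: measurable_quantile.
- by move=> A mA; rewrite (quantile_law nu01 lamE).
- exact: u01X (u01_clip R).
Qed.

Lemma on01_ae : {ae nu, forall x, 0 <= x <= 1}.
Proof.
exists (~` `[0, 1]%classic); split; first exact: measurableC.
  by rewrite probability_setC// nu01 subee.
by move=> x /=; apply: contra_not; rewrite in_itv.
Qed.

Lemma integral_mean : (\int[nu]_x x%:E = (Ex lam (quantile nu))%:E)%E.
Proof.
transitivity (mom nu 1)%:E; last by rewrite mom_quantile.
rewrite -ExE; last exact: u01_bmf (u01X 1 (u01_clip R)).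
apply: ae_eq_integral => //.
- by apply/measurable_EFinP; exact: (u01X 1 (u01_clip R)).1.
- by apply: filterS on01_ae => x x01 _; rewrite clip_id.
Qed.

(** x (1 - x) is nonnegative on [0, 1] and vanishes exactly at the endpoints, so its integral is 0
    exactly for these laws. *)
Lemma on_zero_oneP : on_zero_one nu <->
  Ex lam (fun x => quantile nu x * quantile nu x) = Ex lam (quantile nu).
Proof.
have m01 : measurable ([set 0; 1] : set R) by apply: measurableU; exact: measurable_set1.
have uc := u01_clip R.
have u1c := u01_onem uc.
have bcc : bmf (fun x : R => clip x * (1 - clip x)) by exact: u01_bmf (u01M uc u1c).
have E : Ex nu (fun x => clip x * (1 - clip x)) =
    Ex lam (quantile nu) - Ex lam (fun x => quantile nu x * quantile nu x).
  rewrite -[Ex lam (quantile nu)](mom_quantile 1) -[X in _ - X](mom_quantile 2).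
  rewrite /mom -ExB; [|exact: u01_bmf (u01X 1 uc)|exact: u01_bmf (u01X 2 uc)].
  by apply: eq_Ex => x; rewrite expr1 expr2; ring.
split=> [nu1|EE].
  have : Ex nu (fun x => clip x * (1 - clip x)) = Ex nu (fun=> 0).
    apply: Ex_ae => //; first exact: bmf_cst.
    exists (~` [set 0; 1]); split; first exact: measurableC.
      by rewrite probability_setC// nu1 subee.
    move=> x /=; apply: contra_not => -[|] ->.
      by rewrite clip_le0 ?mul0r.
    by rewrite clip_ge1// subrr mulr0.
  by rewrite Ex_cst E => /eqP; rewrite subr_eq0 => /eqP.
have /(ae_eq_integral_abs nu measurableT _).1 : (\int[nu]_x `|(clip x * (1 - clip x))%:E| = 0)%E.
  transitivity (\int[nu]_x (clip x * (1 - clip x))%:E)%E; last first.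
    by rewrite ExE// E EE subrr.
  by apply: eq_integral => x _; rewrite gee0_abs// lee_fin; case/andP: ((u01M uc u1c).2 x).
move=> /(_ (proj2 (measurable_EFinP _ _) bcc.1)) ae0.
have : nu (~` [set 0; 1]) = 0%E.
  have : {ae nu, forall x, [set 0; 1] x}.
    apply: filterS2 on01_ae ae0 => x x01 /(_ I) [].
    rewrite clip_id// => /eqP; rewrite mulf_eq0 => /orP[/eqP ->|]; first by left.
    by rewrite subr_eq0 => /eqP <-; right.
  move=> [A [mA A0 sub]]; apply/eqP; rewrite eq_le measure_ge0 andbT -A0.
  by apply: le_measure; rewrite ?inE//; exact: measurableC.
move=> h; rewrite /on_zero_one -[X in nu X]setCK probability_setC ?h ?sube0//.
exact: measurableC.
Qed.

End Means.

Lemma cvg_dist0 (R : realType) (u v : nat -> R) (l : R) :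
  v n @[n --> \oo] --> l -> u n - v n @[n --> \oo] --> 0 -> u n @[n --> \oo] --> l.
Proof.
move=> vl uv; rewrite (_ : (fun n => u n) = fun n => (u n - v n) + v n).
  by rewrite -[l]add0r; exact: cvgD.
by apply/funext => n; rewrite subrK.
Qed.

(** * The basin of attraction in terms of the flows *)

Section Basin.
Context (R : realType) d0 (S0 : measurableType d0) (P0 : probability S0 R).
Variable N : {RV P0 >-> enat}.
Hypothesis N_gt0 : forall w, N w <> Some 0%N.
Hypothesis convH : strictly_convex01 (pgf N).
Variable lam : probability R R.
Hypothesis lamE : forall s, lam `]-oo, s]%classic = (clip s)%:E.
Variable mu : R.
Hypothesis mu01 : 0 <= mu <= 1.
Context d (Om : measurableType d) (P : probability Om R).
Variables (Nu : seq nat -> {RV P >-> enat}) (S C : seq nat -> {RV P >-> R}).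
Hypotheses (hNu : iid_copies N Nu) (hS : zero_one_solution Nu S mu).
Hypothesis hC : cond_prob_solution Nu S C.

Let sigma : probability R R := distribution P (C [::]).
Let Cc (w : Om) : R := clip (C [::] w).
Let cmu : R -> R := fun=> mu.
Let fl := flow N.

Let uCc : u01 Cc. Proof. exact: u01_clipC. Qed.
Let ucmu : u01 cmu. Proof. exact: u01_cst. Qed.
Let ucval n : u01 (cval Nu mu n.*2 [::]). Proof. exact: u01_cval. Qed.

Lemma integral_sigma (g : R -> R) : continuous g -> (exists M, forall x, `|g x| <= M) ->
  (\int[sigma]_x (g x)%:E = (Ex P (fun w => g (Cc w)))%:E)%E.
Proof.
move=> cg gM; have mg := continuous_measurable_fun cg.
have bgC (X : Om -> R) : measurable_fun setT X -> bmf (fun w => g (X w)).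
  move=> mX; split; last by case: gM => M gM; exists M.
  exact: measurableT_comp.
have bC := bgC _ (measurable_funPT (C [::])).
rewrite integral_distribution//=; last 2 first.
- exact/measurable_EFinP.
- exact: bmf_integrable.
rewrite (ExE P bC); congr EFin; apply: Ex_ae => //; first exact: bgC uCc.1.
by apply: filterS (clipC_ae hC) => w ->.
Qed.

Lemma Ex_clipC_mean : Ex P Cc = mu.
Proof.
have fT : sigma_of setT (fun v => Nu v : Om -> enat) setT.
  exact: (@measurableT _ (g_sigma_algebraType _)).
have := Ex_clipC hS hC fT; under eq_Ex do rewrite indicT mul1r.
move=> ->; have [_ H PS] := hS; apply: EFin_inj; rewrite -(PS [::] isT).
rewrite -Ex_indic; last by apply: measurable_preimage (measurable_funPT _) _; exact: measurable_set1.
congr EFin; apply: eq_Ex => w; rewrite indicT mul1r indicE; case: (H [::] w isT) => Sw.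
  by rewrite Sw memNset//= Sw => /eqP; rewrite eq_sym oner_eq0.
by rewrite Sw mem_set.
Qed.

Lemma flow_cmom n k : Ex lam (fun x => fl cmu n x ^+ k) = cmom N mu n k.
Proof.
elim: n k => [|n IH] k; first by rewrite /fl /flow /= /cmu Ex_cst.
rewrite /fl /flow /= recfun_mom//; last exact: u01_flow.
by rewrite /cmom /=; congr (mommap N _ k); apply/funext => j; exact: IH.
Qed.

(** The flow of the point mass on the line and [cval] on the tree have the same moments [cmom], so
    [g] has the same mean under both. Convergence of [cval] in mean gives convergence in mean
    square, the differences being at most 1. *)
Lemma cvg_cval_cont (g : R -> R) : continuous g -> (exists M, forall x, `|g x| <= M) ->
  Ex lam (fun x => g (fl cmu n.*2 x)) @[n --> \oo] --> Ex P (fun w => g (Cc w)).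
Proof.
move=> cg gM.
have E n : Ex lam (fun x => g (fl cmu n.*2 x)) = Ex P (fun w => g (cval Nu mu n.*2 [::] w)).
  apply: Ex_moments => //; first exact: u01_flow.
  by move=> k; rewrite flow_cmom (Ex_cval hNu).
under eq_cvg do rewrite E.
have sq0 : Ex P (fun w => (Cc w - cval Nu mu n.*2 [::] w) ^+ 2) @[n --> \oo] --> 0.
  have c0 := cvg_cval mu01 hS hC.
  apply/cvgrPdist_le => e e0; move/cvgrPdist_le : c0 => /(_ _ e0)[n0 _ H0].
  exists n0 => // n /= /H0 /=; rewrite !sub0r !normrN.
  have bd : bmf (fun w => Cc w - cval Nu mu n.*2 [::] w).
    by apply: bmfB; exact: u01_bmf.
  rewrite !ger0_norm; first last.
  - by apply: Ex_ge0; [exact: bmf_norm | move=> w; exact: normr_ge0].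
  - by apply: Ex_ge0; [exact: bmfX | move=> w; exact: sqr_ge0].
  apply: le_trans; apply: le_Ex; [exact: bmfX | exact: bmf_norm | move=> w].
  rewrite -[leLHS](real_normK (num_real _)) expr2 ler_piMl//.
  by have := uCc.2 w; have := (ucval n).2 w; rewrite ler_norml; lra.
apply: (@cvg_dist0 _ _ (fun=> Ex P (fun w => g (Cc w)))); first exact: cvg_cst.
have h := cvg_Ex_sqr (fun=> uCc) ucval cg gM sq0.
rewrite (_ : (fun n => _) = fun n => - (Ex P (fun w => g (Cc w)) -
    Ex P (fun w => g (cval Nu mu n.*2 [::] w)))); last by apply/funext => n; rewrite opprB.
by rewrite -oppr0; exact: cvgN.
Qed.

Variable nu : probability R R.
Hypothesis nu01 : on01 nu.

Let q : R -> R := quantile nu.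
Let uq : u01 q. Proof. exact: u01_quantile. Qed.

Lemma merge_basin :
  Ex lam (fun x => (fl q n.*2 x - fl cmu n.*2 x) ^+ 2) @[n --> \oo] --> 0 ->
  basinT2 N sigma nu.
Proof.
move=> h; split=> // g cg gM.
rewrite integral_sigma//.
under eq_cvg => n do rewrite (iter_mapT2 N lamE n nu01 cg gM).
apply: cvg_EFin; first exact: nearW.
have uX n : u01 (fl q n.*2) by exact: u01_flow.
have uY n : u01 (fl cmu n.*2) by exact: u01_flow.
exact: cvg_dist0 (cvg_cval_cont cg gM) (cvg_Ex_sqr uX uY cg gM h).
Qed.

Lemma basin_integrals (g : R -> R) : continuous g -> (exists M, forall x, `|g x| <= M) ->
  basinT2 N sigma nu ->
  Ex lam (fun x => g (fl q n.*2 x)) @[n --> \oo] --> Ex P (fun w => g (Cc w)).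
Proof.
move=> cg gM [_ /(_ g cg gM)]; rewrite integral_sigma//.
under eq_cvg => n do rewrite (iter_mapT2 N lamE n nu01 cg gM).
by move/fine_cvgP => [].
Qed.

Let clipM : exists M : R, forall x : R, `|clip x| <= M.
Proof. by exists 1 => x; have := clip01 x; rewrite ler_norml; lra. Qed.

(** The identity is not bounded on the line; [clip] is a legitimate test function and agrees with it
    on [0, 1]. *)
Lemma basin_mean : basinT2 N sigma nu -> flow1 N lam q n.*2 @[n --> \oo] --> mu.
Proof.
move=> /(basin_integrals (@continuous_clip R) clipM).
rewrite (_ : Ex P _ = mu); last first.
  by rewrite -[RHS]Ex_clipC_mean; apply: eq_Ex => w; rewrite clip_id//; exact: uCc.2.
apply: cvg_trans; apply: near_eq_cvg; apply: nearW => n; apply: eq_Ex => x.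
by rewrite clip_id//; exact: (u01_flow _ uq n.*2).2.
Qed.

Lemma has_meanE m : has_mean nu m <-> flow1 N lam q 0 = m.
Proof.
rewrite /has_mean (integral_mean lamE nu01) -/q; split=> [h|<-//].
exact: EFin_inj h.
Qed.

Lemma iter_flow1 n : iter n (pgf_compl N \o pgf_compl N) (flow1 N lam q 0) = flow1 N lam q n.*2.
Proof.
by elim: n => // n IH; rewrite iterS IH doubleS !flow1S.
Qed.

End Basin.

Theorem theorem6p3 (R : realType)
    (d0 : measure_display) (S0 : measurableType d0) (P0 : probability S0 R)
    (N : {RV P0 >-> enat}) (hN : forall w, N w <> Some 0%N)
    (hH : strictly_convex01 (pgf N))
    (mu_plus mu_minus : R) (hmu : 0 <= mu_plus <= 1)
    (hfix : (pgf_compl N \o pgf_compl N) mu_plus = mu_plus)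
    (hminus : mu_minus = pgf_compl N mu_plus)
    (d : measure_display) (Om : measurableType d) (P : probability Om R)
    (Nu : seq nat -> {RV P >-> enat}) (hNu : iid_copies N Nu)
    (S C : seq nat -> {RV P >-> R})
    (hS : zero_one_solution Nu S mu_plus) (hC : cond_prob_solution Nu S C) :
  let sigma_plus : probability R R := distribution P (C [::]) in
  (0 < mu_plus < 1 ->
   (1 < slope01 (pgf N) mu_plus * slope01 (pgf N) mu_minus)%E ->
   basinT2 N sigma_plus =
     [set nu | on01 nu /\ has_mean nu mu_plus /\ ~ on_zero_one nu]) /\
  ((slope01 (pgf N) mu_plus * slope01 (pgf N) mu_minus <= 1)%E ->
   basinT2 N sigma_plus =
     [set nu | on01 nu /\ exists m : R,
        has_mean nu m /\ basin01 (pgf_compl N \o pgf_compl N) mu_plus m]).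
Proof.
move=> sigma_plus; have [lam lamE] := exists_uniform R.
have Ha : pgf N mu_plus = 1 - mu_minus by rewrite hminus /pgf_compl; ring.
have Hb : pgf N mu_minus = 1 - mu_plus by rewrite -[in RHS]hfix hminus /= /pgf_compl; ring.
have ca : u01 ((fun=> mu_plus) : R -> R) by exact: u01_cst.
have slopes : 0 < mu_plus < 1 ->
    (slope01 (pgf N) mu_plus * slope01 (pgf N) mu_minus =
     (dpgf N mu_plus * dpgf N mu_minus)%:E)%E.
  move=> a01; have /andP[b0 b1] := b01 hN hH a01 Ha; have /andP[a0 a1] := a01.
  by rewrite !slope01_pgf// EFinM.
split=> [a01|].
  rewrite slopes// lte_fin => DD; apply/seteqP; split=> nu /=.
    move=> bnu; have nu01 : on01 nu by case: bnu.
    have uq := u01_quantile nu01.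
    have q0 : flow1 N lam (quantile nu) 0 = mu_plus.
      apply: (mean_repels hN hH a01 Ha Hb DD (fun n => flow1_01 N lam uq n)).
        by move=> n; rewrite (flow1S N lamE uq).
      exact: (basin_mean lamE hS hC nu01 bnu).
    split=> //; split; first exact/(has_meanE N lamE nu01).
    (* A law on {0, 1} keeps deficit 0 under T, so its weak limit would have deficit 0, whereas the
       deficits of the point mass have a positive limit. *)
    move=> /(on_zero_oneP lamE nu01) nu2.
    have eqm n : flow2 N lam (quantile nu) (quantile nu) n = flow1 N lam (quantile nu) n.
      by elim: n => [|n IH]; [exact: nu2 | rewrite flow2S// flow1S// IH; ring].
    (* A bounded continuous function whose integral is the deficit, which makes the deficit visible
       to weak convergence. *)
    pose g (x : R) := clip x * (1 - clip x).
    have cg : continuous g.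
      move=> x; apply: cvgM; first exact: continuous_clip.
      by apply: cvgB; [exact: cvg_cst | exact: continuous_clip].
    have gM : exists M : R, forall x, `|g x| <= M.
      exists 1 => x; have /andP[? ?] := clip01 x; rewrite ler_norml /g; nra.
    have gE a n : u01 a -> Ex lam (fun x => g (flow N a n x)) = flow1 N lam a n - flow2 N lam a a n.
      move=> ua; have uA := u01_flow N ua n.
      rewrite /flow1 /flow2 -ExB; [|exact: u01_bmf|exact: u01_bmf (u01M uA uA)].
      by apply: eq_Ex => x; rewrite /g clip_id ?uA.2//; ring.
    have z1 := basin_integrals lamE hC nu01 cg gM bnu.
    have z2 := cvg_cval_cont lamE hmu hNu hS hC cg gM.
    have z0 : Ex P (fun w => g (clip (C [::] w))) = 0.
      have z3 : Ex lam (fun x => g (flow N (quantile nu) n.*2 x)) @[n --> \oo] --> (0 : R).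
        by under eq_cvg => n do rewrite gE// eqm subrr; exact: cvg_cst.
      exact: (cvg_unique _ z1 z3).
    have q2 : flow2 N lam (fun=> mu_plus) (fun=> mu_plus) 0 < mu_plus.
      rewrite /flow2 /= Ex_cst; case/andP: a01 => a0 a1; nra.
    have [[l l0 cl] _] := supercritical_merge hN hH lamE hmu Ha Hb a01 DD ca (Ex_cst lam mu_plus) q2.
    have : l = 0.
      have z3 : mu_plus - flow2 N lam (fun=> mu_plus) (fun=> mu_plus) n.*2 @[n --> \oo] --> (0 : R).
        by rewrite -z0; move: z2; under eq_cvg => n do
          rewrite gE// (flow1_ca lamE hmu Ha Hb n).1.
      exact: (cvg_unique _ cl z3).
    by move=> l_eq0; rewrite l_eq0 ltxx in l0.
  move=> [nu01 [/(has_meanE N lamE nu01) q0 nz]]; have uq := u01_quantile nu01.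
  apply: (merge_basin lamE hmu hNu hS hC nu01).
  apply: (supercritical_merge hN hH lamE hmu Ha Hb a01 DD uq q0 _).2.
  rewrite lt_neqAle -[X in _ <= X]q0 flow2_le// andbT.
  apply/eqP => q2; apply: nz; apply/(on_zero_oneP lamE nu01).
  by rewrite -[RHS]q0 in q2.
move=> DD; apply/seteqP; split=> nu /=.
  move=> bnu; have nu01 : on01 nu by case: bnu.
  have uq := u01_quantile nu01.
  split=> //; exists (flow1 N lam (quantile nu) 0); split; first exact/(has_meanE N lamE nu01).
  split; first exact: flow1_01.
  under eq_cvg => n do rewrite (iter_flow1 N lamE nu01).
  exact: (basin_mean lamE hS hC nu01 bnu).
move=> [nu01 [m [/(has_meanE N lamE nu01) <- [_]]]]; have uq := u01_quantile nu01.
under eq_cvg => n do rewrite (iter_flow1 N lamE nu01).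
move=> qa; apply: (merge_basin lamE hmu hNu hS hC nu01).
(* In the interior the slopes are the derivatives [dpgf]; at the endpoints convergence of the means
   by itself forces the flows to merge. *)
have [a01|] := boolP (0 < mu_plus < 1).
  apply: (critical_merge hN hH lamE hmu Ha Hb a01 _ uq qa).
  by move: DD; rewrite slopes// lee_fin.
move=> abnd; apply: (boundary_merge lamE hmu Ha Hb _ uq qa).
case/andP: hmu => a0 a1; move: abnd; rewrite negb_and -!leNgt => /orP[a0'|a1'].
  by left; apply/eqP; rewrite eq_le a0 a0'.
by right; apply/eqP; rewrite eq_le a1 a1'.
Qed.
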